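(* Let $N\ge 1$ be an integer, let $\eta>0$, let $\mathbf{x}_0\in\mathbb{R}^N$ be a fixed (deterministic) point, and let $\phi:\mathbb{R}^N\to\mathbb{R}$ be a centered Gaussian random field with continuously differentiable sample paths and covariance $\mathbb{E}[\phi(\mathbf{x})\phi(\mathbf{x}')]=\exp(-\|\mathbf{x}-\mathbf{x}'\|^2/2)$. Let $\Phi_0=\phi(\mathbf{x}_0)$, $\boldsymbol{\Xi}_0=\nabla\phi(\mathbf{x}_0)$, $\Xi_0^2=\|\boldsymbol{\Xi}_0\|^2$, $\mathbf{x}_1=\mathbf{x}_0-\eta\boldsymbol{\Xi}_0$ and $\Phi_1=\phi(\mathbf{x}_1)$. Then the conditional distribution of $\Phi_1$ given $\Phi_0=\varphi_0$ and $\Xi_0^2=\xi_0^2$ is normal with mean and variance $$m_1(\varphi_0,\xi_0^2)=e^{-\frac{\eta^2}{2}\xi_0^2}\left(\varphi_0-\eta\,\xi_0^2\right),\qquad v_1(\xi_0^2)=1-e^{-\eta^2\xi_0^2}\left(1+\eta^2\xi_0^2\right),$$ and $\Phi_1$ has the probability density function $$f_{\Phi_1}(\varphi_1)=\int_{-\infty}^{+\infty}d\varphi_0\int_0^{+\infty}d\xi_0^2\;\frac{f_{\Phi_0}(\varphi_0)\,f_{\Xi_0^2}(\xi_0^2)}{\left(2\pi\,v_1(\xi_0^2)\right)^{1/2}}\exp\left(-\frac{\left(\varphi_1-m_1(\varphi_0,\xi_0^2)\right)^2}{2\,v_1(\xi_0^2)}\right),$$ where $f_{\Phi_0}$ is the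 standard normal density and $f_{\Xi_0^2}$ is the density of the $\chi^2$-distribution with $N$ degrees of freedom.
   Context: The symbol $\xi_0^2$ is treated as a single nonnegative real variable (the value of $\Xi_0^2$), and $d\xi_0^2$ denotes integration with respect to that variable. The map $\mathbf{x}_0\mapsto\mathbf{x}_1$ is one step of gradient descent on $\phi$ with learning rate $\eta$. $\Phi_1$ is the same realization of the field evaluated at the random point $\mathbf{x}_1$. A version of the field with smooth sample paths exists since the covariance is smooth. *)

(* Defs.v *)
From HB Require Import structures.
From mathcomp Require Import all_boot all_order all_algebra.
From mathcomp Require Import all_classical all_reals all_analysis measurable_realfun.

Set Implicit Arguments.
Unset Strict Implicit.
Unset Printing Implicit Defensive.

Import Order.TTheory GRing.Theory Num.Theory.
Import numFieldNormedType.Exports.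

Local Open Scope classical_set_scope.
Local Open Scope ring_scope.

(* The library norm on ['rV[R]_N] is the sup norm, hence a separate squared
   Euclidean norm. *)
Definition sqnorm (R : realType) (N : nat) (x : 'rV[R]_N) : R :=
  \sum_(i < N) x 0 i ^+ 2.

Definition gradient (R : realType) (N : nat) (f : 'rV[R]_N -> R)
    (x : 'rV[R]_N) : 'rV[R]_N :=
  \row_(i < N) 'D_(delta_mx 0 i) f x.

Definition continuously_differentiable (R : realType) (N : nat)
    (f : 'rV[R]_N -> R) : Prop :=
  (forall x, differentiable f x) /\ continuous (gradient f).

(* Normal law with mean [m] and variance [v >= 0], the Dirac mass at [m] when
   [v = 0]. The library's [normal_prob m s] takes the standard deviation and
   is the uniform law on [0, 1] when [s = 0]. *)
Definition normal_law (R : realType) (m v : R) : set R -> \bar R :=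
  if v == 0 then dirac m else normal_prob m (Num.sqrt v).

Definition has_law d (T : measurableType d) (R : realType)
    (P : probability T R) (X : T -> R) (mu : set R -> \bar R) : Prop :=
  measurable_fun [set: T] X /\
  forall B : set R, measurable B -> P (X @^-1` B) = mu B.

(* All finite-dimensional distributions are (possibly degenerate) multivariate
   normal: every linear combination of finitely many values is normal. *)
Definition gaussian_field d (T : measurableType d) (R : realType)
    (P : probability T R) (N : nat) (phi : 'rV[R]_N -> T -> R) : Prop :=
  forall (n : nat) (x : 'I_n -> 'rV[R]_N) (a : 'I_n -> R),
  exists m v : R, 0 <= v /\
    has_law P (fun w => \sum_(i < n) a i * phi (x i) w) (normal_law m v).

Definition has_pdf d (T : measurableType d) (R : realType)
    (P : probability T R) (X : T -> R) (f : R -> R) : Prop :=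
  [/\ measurable_fun [set: R] f,
      forall y, 0 <= f y &
      has_law P X
        (fun B => \int[lebesgue_measure]_(y in B) (f y)%:E)%E].

(* [k] is a regular version of the conditional distribution of [Y] given [X]:
   a probability kernel with
   P (X \in A, Y \in B) = E [1_A(X) k(X, B)] for all measurable A, B. *)
Definition conditional_law d d1 d2 (T : measurableType d)
    (T1 : measurableType d1) (T2 : measurableType d2) (R : realType)
    (P : probability T R) (X : T -> T1) (Y : T -> T2)
    (k : T1 -> set T2 -> \bar R) : Prop :=
  [/\ measurable_fun [set: T] X,
      measurable_fun [set: T] Y,
      forall x, exists q : probability T2 R,
        forall B, measurable B -> k x B = q B,
      forall B, measurable B -> measurable_fun [set: T1] (k ^~ B) &
      forall A B, measurable A -> measurable B ->
        P (X @^-1` A `&` Y @^-1` B) = (\int[P]_(w in X @^-1` A) k (X w) B)%E].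

Definition Gamma (R : realType) (a : R) : R :=
  \int[lebesgue_measure]_(t in `]0, +oo[) (t `^ (a - 1) * expR (- t)).

Definition chi2_pdf (R : realType) (N : nat) (x : R) : R :=
  if 0 < x then
    x `^ (N%:R / 2 - 1) * expR (- x / 2) / (2 `^ (N%:R / 2) * Gamma (N%:R / 2))
  else 0.

(* In [m1] and [v1], [s] stands for the value of the squared gradient norm
   itself, not of the norm. *)
Definition m1 (R : realType) (eta p s : R) : R :=
  expR (- (eta ^+ 2 / 2 * s)) * (p - eta * s).

Definition v1 (R : realType) (eta s : R) : R :=
  1 - expR (- (eta ^+ 2 * s)) * (1 + eta ^+ 2 * s).

(* Main.v *)
(* A finite measure is determined on the sigma-algebra of a finite family [Z] by
   its integrals of [sin (s . Z + c)]. Gradients being limits of difference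
   quotients, these integrals are explicit for the family made of [phi x0],
   its gradient and [phi c]; for fixed [c] they show that, given the value and
   the gradient at [x0], [phi c] is normal with mean
   [e^(-|c-x0|^2/2) (phi x0 + (c-x0) . grad)] and variance
   [1 - e^(-|c-x0|^2) (1+|c-x0|^2)]. This passes to points [c] that are simple
   functions of the gradient and, by continuity of the paths, to the random
   point [x0 - eta grad].
   The chi-square density comes from a scaling argument: if [S] is a sum of [k]
   squares of independent standard normals, then [f -> E (f(S) e^(S/2))] is
   multiplied by [c^(-k/2)] when [f] is replaced by [f(c .)]; averaging over [c]
   in [[1, 2]] shows that it is [K * int f(r) r^(k/2-1) dr]. *)

Require Import Defs.
From HB Require Import structures.
From mathcomp Require Import all_boot all_order all_algebra.
From mathcomp Require Import all_classical all_reals all_analysis measurable_realfun.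
From mathcomp Require Import ring lra.

Set Implicit Arguments.
Unset Strict Implicit.
Unset Printing Implicit Defensive.

Import Order.TTheory GRing.Theory Num.Theory.
Import numFieldNormedType.Exports.

Local Open Scope classical_set_scope.
Local Open Scope ring_scope.

(** Real sines with a free phase replace complex characters: the phase covers both sine and cosine,
    and a product of two sines is again a combination of sines. The obstacle is that [Phi1] reads
    the field at a point that depends on the field, so the triple of [Phi0], [Xi0] and [Phi1] is not
    Gaussian and its transform is not given by a covariance. Conditioning is therefore expressed by
    identities between integrals over every event of the sigma-algebra of value and gradient; such
    identities can be cut along events described by the gradient. Conditioning on the whole gradient
    is enough for conditioning on its squared norm: at the descent point [c - x0] is a multiple of
    the gradient, so mean and variance depend on the gradient only through that norm. The variance
    vanishes where the gradient does, so normal laws are handled as images of the standard one under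
    [g -> m + sqrt v * g], which includes [v = 0]. In the chi-square argument [K] is found from the
    total mass being 1, which also shows that [K] and the Gamma integral are finite. *)

Definition bounded_mfun (R : realType) d (T : measurableType d) (f : T -> R) :=
  measurable_fun [set: T] f /\ exists M : R, forall x, `|f x| <= M.

(** * Bounded measurable functions and bounded convergence *)

Section bounded_mfun.
Context (R : realType) d (T : measurableType d).
Implicit Types f g : T -> R.

Lemma bounded_mfun_cst (c : R) : @bounded_mfun R d T (fun=> c).
Proof. by split => //; exists `|c|. Qed.

Lemma bounded_mfunD f g :
  bounded_mfun f -> bounded_mfun g -> bounded_mfun (fun x => f x + g x).
Proof.
move=> [mf [M fM]] [mg [K gK]]; split; first exact: measurable_funD.
by exists (M + K) => x; rewrite (le_trans (ler_normD _ _))// lerD.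
Qed.

Lemma bounded_mfunM f g :
  bounded_mfun f -> bounded_mfun g -> bounded_mfun (fun x => f x * g x).
Proof.
move=> [mf [M fM]] [mg [K gK]]; split; first exact: measurable_funM.
by exists (M * K) => x; rewrite normrM ler_pM.
Qed.

Lemma bounded_mfun_sin f : measurable_fun setT f -> bounded_mfun (fun x => sin (f x)).
Proof.
move=> mf; split; last by exists 1 => x; exact: sin_max.
apply: (@measurableT_comp _ _ _ _ _ _ (@sin R)) => //.
by apply: continuous_measurable_fun; exact: continuous_sin.
Qed.

Lemma bounded_mfun_indic (A : set T) : measurable A -> bounded_mfun (\1_A : T -> R).
Proof.
move=> mA; split; first exact: measurable_indic.
by exists 1 => x; rewrite indicE; case: (_ \in _); rewrite ?normr1 ?normr0.
Qed.

Lemma bounded_mfun_integrable (mu : {finite_measure set T -> \bar R}) f :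
  bounded_mfun f -> mu.-integrable setT (EFin \o f).
Proof.
move=> [mf [M fM]]; apply: measurable_bounded_integrable => //.
  by rewrite -ge0_fin_numE// fin_num_measure.
exists M; split; first exact: num_real.
by move=> K MK x _ /=; rewrite (le_trans (fM x))// ltW.
Qed.

Lemma bounded_cvg_Rintegral (mu : {finite_measure set T -> \bar R})
    (f_ : nat -> T -> R) f (M : R) :
  (forall n, measurable_fun setT (f_ n)) ->
  (forall n x, `|f_ n x| <= M) ->
  (forall x, f_ n x @[n --> \oo] --> f x) ->
  bounded_mfun f /\ (\int[mu]_x f_ n x) @[n --> \oo] --> \int[mu]_x f x.
Proof.
move=> mf_ fM ff.
have mf : measurable_fun setT f.
  exact: (measurable_fun_cvg (h := f_)).
split.
  split=> //; exists M => x.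
  have /cvg_lim <- // : `|f_ n x| @[n --> \oo] --> `|f x| by exact: cvg_norm.
  apply: limr_le; first by apply/cvg_ex; exists `|f x|; exact: cvg_norm.
  by apply: nearW => n; exact: fM.
have bM : mu.-integrable setT (EFin \o (fun=> M)).
  by apply: bounded_mfun_integrable; exact: bounded_mfun_cst.
have mfE n : measurable_fun setT (EFin \o f_ n) by apply/measurable_EFinP.
have fE : {ae mu, forall x, setT x -> (EFin \o f_ n) x @[n --> \oo] --> (EFin \o f) x}.
  by apply: aeW => x _; apply: cvg_EFin; [exact: nearW | exact: ff].
have fME : {ae mu, forall x n, setT x -> (`|(EFin \o f_ n) x| <= (EFin \o (fun=> M)) x)%E}.
  by apply: aeW => x n _ /=; rewrite lee_fin.
have mfE' : measurable_fun setT (EFin \o f) by apply/measurable_EFinP.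
have [intf _ H] := dominated_convergence measurableT mfE mfE' fE bM fME.
apply: fine_cvg; rewrite fineK; first exact: H.
exact: integrable_fin_num.
Qed.
End bounded_mfun.

(** * Elementary limits: polynomial thresholds, the sign of a sine, rounding *)

Section threshold.
Context (R : realType).
Implicit Types r u y : R.

Lemma ge0_bernoulli_le r n : 0 <= r <= 1 -> 1 - n%:R * r <= (1 - r) ^+ n.
Proof.
move=> /andP[r0 r1]; elim: n => [|n IH]; first by rewrite mul0r subr0 expr0.
have h : 0 <= n%:R * r ^+ 2 by rewrite mulr_ge0// exprn_ge0.
rewrite exprSr; apply: (@le_trans _ _ ((1 - n%:R * r) * (1 - r))).
  by rewrite -natr1; nra.
by rewrite ler_wpM2r// subr_ge0.
Qed.

(** Half of the decay absorbs the factor [n]: for [q = sqrt r], the sum [1 + q + ... + q^(n-1)] is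
    at least [n q^n], so [n q^n (1 - q) <= 1 - q^n]. Hence [n r^n = (n q^n) q^n] is at most
    [q^n / (1 - q)]. *)
Lemma natr_mul_exprn_cvg0 r : 0 <= r < 1 -> n%:R * r ^+ n @[n --> \oo] --> 0.
Proof.
move=> /andP[r0 r1]; pose q := Num.sqrt r.
have q0 : 0 <= q by exact: sqrtr_ge0.
have q1 : q < 1 by rewrite -[ltRHS]sqrtr1 ltr_sqrt.
have qn n : n%:R * q ^+ n * (1 - q) + q ^+ n <= 1.
  elim: n => [|n IH]; first by rewrite mul0r mul0r add0r expr0.
  have h : q ^+ n.+1 <= 1 by rewrite exprn_ile1// ltW.
  have -> : n.+1%:R * q ^+ n.+1 * (1 - q) + q ^+ n.+1 =
     q * (n%:R * q ^+ n * (1 - q) + q ^+ n) + q ^+ n.+1 * (1 - q).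
    by rewrite exprS -natr1; ring.
  have : q * (n%:R * q ^+ n * (1 - q) + q ^+ n) <= q by rewrite ler_piMr.
  have : q ^+ n.+1 * (1 - q) <= 1 - q by rewrite ler_piMl// subr_ge0 ltW.
  lra.
apply: (@squeeze_cvgr _ _ _ _ (cst 0) (fun n => (1 - q)^-1 * q ^+ n)).
- apply: nearW => n; rewrite mulr_ge0 ?exprn_ge0//=.
  rewrite ler_pdivlMl ?subr_gt0//.
  have -> : r = q * q by rewrite -expr2 sqr_sqrtr.
  rewrite exprMn.
  have := qn n; have : 0 <= q ^+ n by rewrite exprn_ge0.
  by move=> ? ?; nra.
- exact: cvg_cst.
- rewrite -[X in _ --> X](mulr0 (1 - q)^-1); apply: cvgM; first exact: cvg_cst.
  by apply: cvg_expr; rewrite ger0_norm.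
Qed.

(* As in elementary proofs of the Stone-Weierstrass theorem: polynomials in [u]
   converging to an indicator. *)
Lemma threshold_cvg u : 0 <= u <= 1 ->
  (1 - u ^+ n) ^+ (n * 2 ^ n) @[n --> \oo] --> ((u < 1 / 2)%R%:R : R).
Proof.
move=> /andP[u0 u1].
have un n : 0 <= u ^+ n <= 1 by rewrite exprn_ge0//= exprn_ile1.
(* The exponent is chosen so that exponent times [u ^+ n] is [n (2u)^n]. This tends to 0 for
   [u < 1/2], where Bernoulli's inequality applies, and is at least [n] for [u >= 1/2], where
   [1 - x <= e^(-x)] gives the bound [e^(-n)]; the extra factor [n] settles [u = 1/2]. *)
have e n : (n * 2 ^ n)%:R * u ^+ n = n%:R * (2 * u) ^+ n.
  by rewrite natrM natrX exprMn mulrA.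
case: ltP => /= u2.
- apply: (@squeeze_cvgr _ _ _ _ (fun n => 1 - n%:R * (2 * u) ^+ n) (cst 1)).
  + apply: nearW => n; rewrite -e ge0_bernoulli_le//=.
    by have := un n; case/andP => ? ?; rewrite exprn_ile1 ?subr_ge0// gerBl.
  + rewrite -[X in _ --> X]subr0; apply: cvgB; first exact: cvg_cst.
    by apply: natr_mul_exprn_cvg0; apply/andP; split; lra.
  + exact: cvg_cst.
- apply: (@squeeze_cvgr _ _ _ _ (cst 0) (fun n => (expR (-1)) ^+ n)).
  + apply: nearW => n; have /andP[h0 h1] := un n.
    rewrite exprn_ge0 ?subr_ge0//=.
    apply: (@le_trans _ _ (expR (- u ^+ n) ^+ (n * 2 ^ n))).
      by rewrite lerXn2r ?nnegrE ?subr_ge0 ?expR_ge0// expR_ge1Dx.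
    rewrite -!expRM_natl ler_expR mulrN e mulrN1 lerN2 ler_peMr//.
    by rewrite exprn_ege1//; lra.
  + exact: cvg_cst.
  + by apply: cvg_expr; rewrite ger0_norm ?expR_ge0// expR_lt1; lra.
Qed.

(** For large [n] the argument lies strictly between [-pi] and [pi], where a sine has the sign of
    its argument. Bounded trigonometric functions can thus detect on which side of a threshold a
    real number lies. *)
Lemma sin_sign_cvg y :
  ((sin (y / n.+1%:R) < 0)%R%:R : R) @[n --> \oo] --> ((y < 0)%R%:R : R).
Proof.
apply: cvg_near_cst.
have : y / n.+1%:R @[n --> \oo] --> 0.
  rewrite -[X in _ --> X](mulr0 y); apply: cvgM; first exact: cvg_cst.
  exact: cvg_harmonic.
move=> /cvgr0_norm_lt /(_ pi (@pi_gt0 R)).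
apply: filterS => n /=; set z := y / _ => zpi; congr (nat_of_bool _)%:R.
have -> : (y < 0) = (z < 0) by rewrite /z pmulr_llt0// invr_gt0.
move: zpi; rewrite ltr_norml => /andP[z1 z2].
have [z0|z0|->] := ltgtP z 0; last by rewrite sin0 ltxx.
- by rewrite -[z]opprK sinN oppr_lt0 sin_gt0_pi//; lra.
- by apply/negbTE; rewrite -leNgt sin_ge0_pi//; lra.
Qed.

End threshold.

(** First-order expansion of the exponential when [a] may be unbounded: the remainder is at most
    [2 |a u| |u|], a convergent factor times one tending to 0. It evaluates covariances of
    difference quotients. *)
Lemma cvg_mul_expRB1 (R : realType) (a u : nat -> R) (l : R) :
  u n @[n --> \oo] --> 0 -> a n * u n @[n --> \oo] --> l ->
  a n * (expR (u n) - 1) @[n --> \oo] --> l.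
Proof.
move=> u0 aul.
have bnd (x : R) : `|x| <= 1 / 2 -> `|expR x - 1 - x| <= 2 * x ^+ 2.
  rewrite ler_norml => /andP[x1 x2].
  have e0 := expR_ge1Dx x; have e1 := expR_ge1Dx (- x).
  have p0 := expR_gt0 x; have xx := sqr_ge0 x.
  have e2 : expR x * (1 - x) <= 1.
    rewrite -[leRHS]expR0 -(subrr x) expRD ler_wpM2l ?expR_ge0//.
  by rewrite ger0_norm; nra.
rewrite (_ : (fun n => _) = (fun n => a n * u n + a n * (expR (u n) - 1 - u n))); last first.
  by apply/funext => n; ring.
rewrite -[l]addr0; apply: cvgD => //; apply: norm_cvg0.
apply: (@squeeze_cvgr _ _ _ _ (cst 0) (fun n => 2 * (`|a n * u n| * `|u n|))).
- have h : 0 < 1 / 2 :> R by lra.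
  move: u0 => /cvgr0_norm_le/(_ _ h); apply: filterS => n un.
  rewrite normr_ge0/= 2!normrM -mulrA -expr2 (mulrCA 2) ler_wpM2l//.
  by rewrite real_normK ?num_real// bnd.
- exact: cvg_cst.
- rewrite -[X in _ --> X](mulr0 2); apply: cvgM; first exact: cvg_cst.
  rewrite -[X in _ --> X](mulr0 `|l|); apply: cvgM; first exact: cvg_norm.
  by rewrite -[X in _ --> X](@normr0 _ R); exact: cvg_norm.
Qed.

Lemma continuous_cvg_seq (R : realType) (f : R -> R) (u : nat -> R) (l : R) :
  continuous f -> u n @[n --> \oo] --> l -> f (u n) @[n --> \oo] --> f l.
Proof. by move=> cf ul; apply: cvg_comp ul _; exact: cf. Qed.

Lemma sum_unit_sum (R : zmodType) (J : finType) (F : unit + J -> R) :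
  \sum_j F j = F (inl tt) + \sum_j F (inr j).
Proof. by rewrite big_sumType/= (big_pred1 tt)//; case. Qed.

Lemma RintegralZD_bounded (R : realType) d (T : measurableType d)
    (mu : {finite_measure set T -> \bar R}) (k l : R) (f g : T -> R) :
  bounded_mfun f -> bounded_mfun g ->
  \int[mu]_w (k * f w + l * g w) = k * \int[mu]_w f w + l * \int[mu]_w g w.
Proof.
move=> bf bg.
have bk (c : R) (h : T -> R) : bounded_mfun h -> bounded_mfun (fun w => c * h w).
  by move=> bh; apply: bounded_mfunM => //; exact: bounded_mfun_cst.
rewrite RintegralD//; [|exact/bounded_mfun_integrable/bk..].
by rewrite !RintegralZl//; exact: bounded_mfun_integrable.
Qed.

Lemma cvg_row_entrywise (R : realType) (N : nat) (Y_ : nat -> 'rV[R]_N) (Y : 'rV[R]_N) :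
  (forall i, Y_ n 0 i @[n --> \oo] --> Y 0 i) -> Y_ n @[n --> \oo] --> Y.
Proof.
move=> YE; apply/cvg_ballP => e e0.
have : \forall n \near \oo, forall j, ball (Y 0 j) e (Y_ n 0 j).
  apply: filter_forall => j; have /cvg_ballP := YE j; exact.
apply: filterS => n Yn; split => // i j; rewrite ord1; exact: Yn.
Qed.

Lemma sum_ltn_index (k M : nat) : (k <= M)%N -> (\sum_(j < M) (j < k))%N = k.
Proof.
suff -> : (\sum_(j < M) (j < k))%N = minn k M by move=> /minn_idPl.
elim: M => [|M IH]; first by rewrite big_ord0 minn0.
rewrite big_ord_recr/= IH; case: (ltnP M k) => h.
  by rewrite addn1 (minn_idPr h).
by rewrite addn0 (minn_idPl (leqW h)).
Qed.

(* Rounding down to the grid of mesh [1 / (n+1)] on [[-(n+1), n+1]], written as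
   a sum of indicators of half-lines. *)
Definition grid_round (R : realType) (n : nat) (x : R) : R :=
  - n.+1%:R + \sum_(j < (2 * n.+1 ^ 2)%N) (- n.+1%:R + j.+1%:R / n.+1%:R <= x)%R%:R / n.+1%:R.

Lemma grid_round_cvg (R : realType) (x : R) : grid_round n x @[n --> \oo] --> x.
Proof.
have bnd n : `|x| <= n.+1%:R -> `|x - grid_round n x| <= n.+1%:R^-1.
  rewrite ler_norml; set m : R := n.+1%:R => /andP[xm1 xm2].
  have m0 : 0 < m by rewrite ltr0n.
  (* The distance from [-m] to [x] in units of the mesh; the [j]-th half-line contains [x] exactly
     when [j < truncn y], so the sum counts [truncn y] indicators. *)
  pose y := m * (x + m).
  have y0 : 0 <= y by rewrite /y mulr_ge0 ?(ltW m0)// -lerBlDr sub0r.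
  have yM : y <= (2 * n.+1 ^ 2)%N%:R.
    by rewrite natrM natrX expr2 -/m mulrCA ler_wpM2l ?(ltW m0)// mulr_natl mulr2n lerD2r.
  have kM : (Num.truncn y <= 2 * n.+1 ^ 2)%N.
    by rewrite -(ler_nat R); apply: le_trans yM; rewrite truncn_le.
  have gE : grid_round n x = - m + (Num.truncn y)%:R / m.
    rewrite /grid_round -mulr_suml -/m -natr_sum; congr (_ + _%:R / _).
    rewrite -[RHS](sum_ltn_index kM); apply: eq_bigr => j _; congr nat_of_bool.
    rewrite truncn_gt_nat /y -ler_pdivrMl// -lerBlDr (mulrC m^-1).
    by rewrite addrC.
  have /andP[k1 k2] := truncn_itv y0.
  rewrite gE (_ : x - _ = (y - (Num.truncn y)%:R) / m); last first.
    by rewrite /y; field; rewrite gt_eqF.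
  rewrite ger0_norm ?(divr_ge0 _ (ltW m0)) ?subr_ge0//.
  rewrite -[leRHS]mul1r ler_pM2r ?invr_gt0//.
  by rewrite lerBlDl natr1 ltW.
apply/cvgrPdist_le => e e0.
have : (n.+1%:R : R)^-1 @[n --> \oo] --> 0 by exact: cvg_harmonic.
move=> /cvgr0_norm_le /(_ _ e0) h1.
have h2 := @nbhs_infty_ger R `|x|.
apply: filterS2 h1 h2 => n; rewrite ger0_norm ?invr_ge0// => h1 h2.
apply: le_trans (bnd n _) h1; apply: (le_trans h2); by rewrite ler_nat.
Qed.

(** * Measures determined by trigonometric integrals *)

Section trig_determining.
Context (R : realType) d (T : measurableType d) (I : finType).
Variables (Z : I -> T -> R) (mu1 mu2 : {finite_measure set T -> \bar R}).
Hypothesis mZ : forall i, measurable_fun setT (Z i).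

Definition lincomb (s : I -> R) (w : T) : R := \sum_i s i * Z i w.

Lemma measurable_lincomb s : measurable_fun setT (lincomb s).
Proof.
apply: measurable_sum => i.
by apply: measurable_funM.
Qed.

Lemma bounded_sin_lincomb s c : bounded_mfun (fun w => sin (lincomb s w + c)).
Proof.
by apply: bounded_mfun_sin; apply: measurable_funD => //; exact: measurable_lincomb.
Qed.

(** The measures [h mu1] and [h mu2], possibly signed, have the same Fourier transform; the phase
    [c] yields its real and imaginary parts. *)
Definition trig_eq (h : T -> R) := bounded_mfun h /\
  forall s c, \int[mu1]_w (h w * sin (lincomb s w + c)) =
              \int[mu2]_w (h w * sin (lincomb s w + c)).

(* Multipliers form an algebra stable under bounded pointwise limits, so the
   sets whose indicator is a multiplier form a sigma-algebra. *)
Definition trig_multiplier (m : T -> R) := bounded_mfun m /\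
  forall h, trig_eq h -> trig_eq (fun w => h w * m w).

Lemma RintegralD_bounded (mu : {finite_measure set T -> \bar R}) f g :
  bounded_mfun f -> bounded_mfun g ->
  \int[mu]_w (f w + g w) = \int[mu]_w f w + \int[mu]_w g w.
Proof. by move=> bf bg; rewrite RintegralD//; exact: bounded_mfun_integrable. Qed.

Lemma RintegralZ_bounded (mu : {finite_measure set T -> \bar R}) (k : R) f :
  bounded_mfun f -> \int[mu]_w (k * f w) = k * \int[mu]_w f w.
Proof. by move=> bf; rewrite RintegralZl//; exact: bounded_mfun_integrable. Qed.

Lemma trig_eqZD (k l : R) g h : trig_eq g -> trig_eq h ->
  trig_eq (fun w => k * g w + l * h w).
Proof.
move=> [bg Eg] [bh Eh]; split.
  by apply: bounded_mfunD; apply: bounded_mfunM => //; exact: bounded_mfun_cst.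
move=> s c.
have bt := bounded_sin_lincomb s c.
have E (mu : {finite_measure set T -> \bar R}) :
    \int[mu]_w ((k * g w + l * h w) * sin (lincomb s w + c)) =
    k * \int[mu]_w (g w * sin (lincomb s w + c)) +
    l * \int[mu]_w (h w * sin (lincomb s w + c)).
  rewrite -!RintegralZ_bounded; [|exact: bounded_mfunM..].
  rewrite -RintegralD_bounded.
  - by apply: eq_Rintegral => w _; ring.
  - by apply: bounded_mfunM (bounded_mfunM bg bt); exact: bounded_mfun_cst.
  - by apply: bounded_mfunM (bounded_mfunM bh bt); exact: bounded_mfun_cst.
by rewrite !E Eg Eh.
Qed.

Lemma trig_multiplierZD (k l : R) m n : trig_multiplier m -> trig_multiplier n ->
  trig_multiplier (fun w => k * m w + l * n w).
Proof.
move=> [bm Em] [bn En]; split.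
  by apply: bounded_mfunD; apply: bounded_mfunM => //; exact: bounded_mfun_cst.
move=> h Eh; have := trig_eqZD k l (Em _ Eh) (En _ Eh).
by congr trig_eq; apply/funext => w; ring.
Qed.

Lemma trig_multiplier1 : trig_multiplier (fun=> 1).
Proof.
split; first exact: bounded_mfun_cst.
by move=> h; congr trig_eq; apply/funext => w; rewrite mulr1.
Qed.

Lemma trig_multiplierM m n : trig_multiplier m -> trig_multiplier n ->
  trig_multiplier (fun w => m w * n w).
Proof.
move=> [bm Em] [bn En]; split; first exact: bounded_mfunM.
move=> h Eh; have := En _ (Em _ Eh).
by congr trig_eq; apply/funext => w; rewrite mulrA.
Qed.

Lemma trig_multiplierX m k : trig_multiplier m -> trig_multiplier (fun w => m w ^+ k).
Proof.
move=> Em; elim: k => [|k IH].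
  by have := trig_multiplier1; congr trig_multiplier; apply/funext => w; rewrite expr0.
have := trig_multiplierM Em IH.
by congr trig_multiplier; apply/funext => w; rewrite exprS.
Qed.

(** [sin p sin q = (cos (p - q) - cos (p + q)) / 2], each cosine being a sine with phase shifted by
    [pi / 2]. The two new frequencies and phases are again of the kind tested in [trig_eq]. *)
Lemma trig_multiplier_sin s c : trig_multiplier (fun w => sin (lincomb s w + c)).
Proof.
split; first exact: bounded_sin_lincomb.
move=> h [bh Eh]; split; first by apply: bounded_mfunM => //; exact: bounded_sin_lincomb.
move=> s' c'.
have E (mu : {finite_measure set T -> \bar R}) :
    \int[mu]_w (h w * sin (lincomb s w + c) * sin (lincomb s' w + c')) =
    2^-1 * \int[mu]_w (h w * sin (lincomb (fun i => s i - s' i) w + (c - c' + pi / 2)))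
  + (- 2^-1) * \int[mu]_w (h w * sin (lincomb (fun i => s i + s' i) w + (c + c' + pi / 2))).
  have b s0 c0 : bounded_mfun (fun w => h w * sin (lincomb s0 w + c0)).
    by apply: bounded_mfunM => //; exact: bounded_sin_lincomb.
  rewrite -!RintegralZ_bounded// -RintegralD_bounded.
  - apply: eq_Rintegral => w _; rewrite !addrA !sinDpihalf.
    have -> : lincomb (fun i => s i - s' i) w + c - c' =
              (lincomb s w + c) - (lincomb s' w + c').
      rewrite /lincomb; under eq_bigr do rewrite mulrBl.
      by rewrite sumrB; ring.
    have -> : lincomb (fun i => s i + s' i) w + c + c' =
              (lincomb s w + c) + (lincomb s' w + c').
      rewrite /lincomb; under eq_bigr do rewrite mulrDl.
      by rewrite big_split/=; ring.
    by set p := (lincomb s w + c); set q := (lincomb s' w + c'); rewrite cosB cosD; field.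
  - by apply: bounded_mfunM => //; exact: bounded_mfun_cst.
  - by apply: bounded_mfunM => //; exact: bounded_mfun_cst.
by rewrite !E !Eh.
Qed.

Lemma trig_multiplier_cvg (m_ : nat -> T -> R) m (M : R) :
  (forall n, trig_multiplier (m_ n)) -> (forall n w, `|m_ n w| <= M) ->
  (forall w, m_ n w @[n --> \oo] --> m w) -> trig_multiplier m.
Proof.
move=> Em bm mm.
have mm_ n : measurable_fun setT (m_ n) by case: (Em n) => -[].
split; first by have [] := bounded_cvg_Rintegral mu1 mm_ bm mm.
move=> h Eh; have [[mh [K hK]] Eh'] := Eh.
split.
  by apply: bounded_mfunM; [split => //; exists K|have [] := bounded_cvg_Rintegral mu1 mm_ bm mm].
move=> s c.
have cv (mu : {finite_measure set T -> \bar R}) :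
    \int[mu]_w (h w * m_ n w * sin (lincomb s w + c)) @[n --> \oo] -->
             \int[mu]_w (h w * m w * sin (lincomb s w + c)).
  apply: (bounded_cvg_Rintegral (M := K * M * 1) mu _ _ _).2.
  - move=> n; apply: measurable_funM; first exact: measurable_funM.
    by have [] := bounded_sin_lincomb s c.
  - by move=> n w; rewrite !normrM !ler_pM ?sin_max ?mulr_ge0.
  - by move=> w; apply: cvgM; [apply: cvgM; [exact: cvg_cst|exact: mm]|exact: cvg_cst].
have := cv mu2; under eq_fun => n do rewrite -((Em n).2 _ Eh).2.
by move/(cvg_unique _ (cv mu1)) => <-.
Qed.

(** Two successive limits. The multiplier [u j] takes values in [[0, 1]] and is below [1/2] exactly
    where [sin ((Z i - a) / (j+1))] is negative; polynomials in it converge to the indicator of that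
    event, and as [j] grows these indicators converge to that of [Z i < a]. *)
Lemma trig_multiplier_indic_lt i (a : R) : trig_multiplier (\1_[set w | Z i w < a]).
Proof.
pose u (j : nat) w : R := 1 / 2 * 1 + 1 / 2 *
  sin (lincomb (fun k => (k == i)%:R / j.+1%:R) w + - a / j.+1%:R).
have uE j w : u j w = (1 + sin ((Z i w - a) / j.+1%:R)) / 2.
  rewrite /u /lincomb (bigD1 i)//= eqxx big1 => [|k /negbTE ->]; last by rewrite !mul0r.
  rewrite addr0.
  have -> : 1%:R / j.+1%:R * Z i w + - a / j.+1%:R = (Z i w - a) / j.+1%:R :> R.
    by rewrite mulrBl div1r mulrC mulNr.
  by field.
have u01 j w : 0 <= u j w <= 1.
  have := sin_le1 ((Z i w - a) / j.+1%:R); have := sin_geN1 ((Z i w - a) / j.+1%:R).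
  by rewrite uE; lra.
have mu_ j : trig_multiplier (u j).
  by apply: trig_multiplierZD; [exact: trig_multiplier1|exact: trig_multiplier_sin].
have bbool (b : bool) : `|b%:R : R| <= 1 by case: b; rewrite ?normr1 ?normr0.
have H j : trig_multiplier (fun w => (u j w < 1 / 2)%R%:R).
  apply: (@trig_multiplier_cvg (fun n w => (1 - u j w ^+ n) ^+ (n * 2 ^ n)) _ 1).
  - move=> n; apply: trig_multiplierX.
    have := trig_multiplierZD 1 (-1) trig_multiplier1 (trig_multiplierX n (mu_ j)).
    by congr trig_multiplier; apply/funext => w; ring.
  - move=> n w; have /andP[? ?] := u01 j w.
    have ? : u j w ^+ n <= 1 by rewrite exprn_ile1.
    by rewrite ger0_norm ?exprn_ge0 ?subr_ge0// exprn_ile1 ?subr_ge0// gerBl exprn_ge0.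
  - by move=> w; exact: threshold_cvg.
apply: (@trig_multiplier_cvg (fun j w => (u j w < 1 / 2)%R%:R) _ 1) => // w.
have -> : \1_[set w | Z i w < a] w = (Z i w - a < 0)%R%:R :> R.
  by rewrite indicE subr_lt0 mem_setE.
have uS j : (u j w < 1 / 2) = (sin ((Z i w - a) / j.+1%:R) < 0).
  by rewrite uE; apply/idP/idP => ?; lra.
by under eq_fun do rewrite uS; exact: sin_sign_cvg.
Qed.

(** Multipliers are closed under products, so finite intersections come for free and no monotone
    class argument is required. A countable union is treated through its complement, whose indicator
    is the limit of the partial products of [1 - \1_(A k)]. *)
Lemma sigma_algebra_trig_multiplier :
  sigma_algebra [set: T] [set A | measurable A /\ trig_multiplier (\1_A)].
Proof.
have C m : trig_multiplier m -> trig_multiplier (fun w => 1 - m w).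
  move=> Em; have := trig_multiplierZD 1 (-1) trig_multiplier1 Em.
  by congr trig_multiplier; apply/funext => w; ring.
split => /=.
- split => //; have := C _ trig_multiplier1.
  by congr trig_multiplier; apply/funext => w; rewrite indicE in_set0 subrr.
- move=> A [mA EA]; split; first exact: measurableD.
  have := C _ EA; congr trig_multiplier; apply/funext => w.
  rewrite !indicE setTD in_setC; case: (_ \in _) => /=; ring.
- move=> A EA; split; first by apply: bigcup_measurable => k _; case: (EA k).
  pose f (n : nat) w : R := \prod_(k < n) (1 - \1_(A k) w).
  have Ef n : trig_multiplier (f n).
    elim: n => [|n IH].
      have := trig_multiplier1; congr trig_multiplier; apply/funext => w.
      by rewrite /f big_ord0.
    have := trig_multiplierM IH (C _ (EA n).2).
    by congr trig_multiplier; apply/funext => w; rewrite /f big_ord_recr.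
  have F : trig_multiplier (\1_(~` \bigcup_k A k)).
    apply: (@trig_multiplier_cvg f _ 1) => //.
      move=> n w; rewrite /f; elim/big_ind: _ => [|x y hx hy|k _].
      - by rewrite normr1.
      - by rewrite normrM mulr_ile1.
      - by rewrite indicE; case: (_ \in _); rewrite ?subrr ?subr0 ?normr1 ?normr0.
    move=> w; apply: cvg_near_cst; rewrite indicE in_setC.
    have [wA|wA] := boolP (w \in \bigcup_k A k).
      move: wA; rewrite inE => -[k _ Akw]; exists k.+1 => // n /= kn.
      rewrite /f (bigD1 (Ordinal kn))//= indicE mem_set//=.
      by rewrite subrr mul0r.
    apply: nearW => n; rewrite /f big1// => k _; rewrite indicE memNset ?subr0//.
    by move=> Akw; move/negP: wA; apply; rewrite inE; exists k.
  have := C _ F; congr trig_multiplier; apply/funext => w.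
  rewrite !indicE in_setC; case: (_ \in _) => /=; ring.
Qed.

Definition generated_by_family : set (set T) :=
  [set A | exists i (B : set R), measurable B /\ A = Z i @^-1` B].

Lemma generated_by_family_trig_multiplier (E : set T) :
  <<s generated_by_family >> E -> measurable E /\ trig_multiplier (\1_E).
Proof.
have S := sigma_algebra_trig_multiplier.
move: E; apply: smallest_sub => // _ [i [B [mB ->]]].
pose G := [set A : set T | measurable A /\ trig_multiplier (\1_A)].
(* With [G] taken as the sigma-algebra of the source, the claim is the measurability of [Z i], which
   is checked on half-lines only. *)
suff : measurable_fun (setT : set (g_sigma_algebraType G)) (Z i).
  move=> /(_ measurableT _ mB); rewrite setTI.
  by rewrite measurable_g_measurableTypeE.
apply: (measurability _ (RGenInftyO.measurableE R)) => _ [_ [a ->] <-].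
rewrite measurable_g_measurableTypeE// setTI.
have -> : Z i @^-1` `]-oo, a[ = [set w | Z i w < a].
  by apply/seteqP; split => w /=; rewrite in_itv.
split; last exact: trig_multiplier_indic_lt.
have -> : [set w | Z i w < a] = setT `&` Z i @^-1` `]-oo, a[.
  by rewrite setTI; apply/seteqP; split => w /=; rewrite in_itv.
by apply: mZ => //; exact: measurable_itv.
Qed.

Lemma trig_eq_Rintegral h (E : set T) : trig_eq h -> <<s generated_by_family >> E ->
  \int[mu1]_w (h w * \1_E w) = \int[mu2]_w (h w * \1_E w).
Proof.
move=> Eh /generated_by_family_trig_multiplier[_ [_ /(_ _ Eh)[_ /(_ (fun=> 0) (pi / 2))]]].
(* Zero frequency and phase [pi / 2] make the test function equal to 1. *)
have s1 w : sin (lincomb (fun=> 0) w + pi / 2) = 1.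
  by rewrite /lincomb big1 ?add0r ?sin_pihalf// => k _; rewrite mul0r.
by under eq_Rintegral do rewrite s1 mulr1; under [in RHS]eq_Rintegral do rewrite s1 mulr1.
Qed.

End trig_determining.

(** * Integration against a measure with a density *)

Section density.
Context (R : realType) d (T : measurableType d).
Variables (mu nu : {measure set T -> \bar R}) (f : T -> R).
Hypotheses (mf : measurable_fun setT f) (f0 : forall x, 0 <= f x).
Hypothesis nuE : forall A, measurable A -> nu A = (\int[mu]_(x in A) (f x)%:E)%E.
Import HBNNSimple.
Local Open Scope ereal_scope.

Lemma ge0_integral_density (g : T -> \bar R) : measurable_fun setT g ->
  (forall x, 0 <= g x) -> \int[nu]_x g x = \int[mu]_x (g x * (f x)%:E).
Proof.
move=> mg g0; pose h := nnsfun_approx measurableT mg.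
have mfE : measurable_fun setT (EFin \o f) by exact/measurable_EFinP.
have gE x : g x = lim ((EFin \o h n) x @[n --> \oo]).
  by apply/esym/cvg_lim => //; exact: cvg_nnsfun_approx.
have -> : \int[nu]_x g x = lim (\int[nu]_x (EFin \o h n) x @[n --> \oo]).
  under eq_integral do rewrite gE.
  apply: monotone_convergence => //.
  - by move=> n; exact/measurable_EFinP.
  - by move=> n x _; rewrite lee_fin.
  - by move=> x _ a b ab; rewrite lee_fin; exact/lefP/nd_nnsfun_approx.
have -> : \int[mu]_x (g x * (f x)%:E) =
    lim (\int[mu]_x ((h n x)%:E * (f x)%:E) @[n --> \oo]).
  have gfE x : g x * (f x)%:E = lim ((h n x)%:E * (f x)%:E @[n --> \oo]).
    by apply/esym/cvg_lim => //; apply: cvgeZr => //; exact: cvg_nnsfun_approx.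
  under eq_integral do rewrite gfE.
  apply: monotone_convergence => //.
  - by move=> n; apply: emeasurable_funM => //; exact/measurable_EFinP.
  - by move=> n x _; rewrite mule_ge0// lee_fin.
  - move=> x _ a b ab/=; rewrite lee_wpmul2r ?lee_fin//.
    exact/lefP/nd_nnsfun_approx.
suff suf n : \int[nu]_x (EFin \o h n) x = \int[mu]_x ((h n x)%:E * (f x)%:E).
  by under eq_fun do rewrite suf.
transitivity (\int[nu]_x (\sum_(y \in range (h n)) (y * \1_(h n @^-1` [set y]) x)%:E)).
  by apply: eq_integral => t tE; rewrite /= fimfunE -fsumEFin.
have indich m r : measurable_fun setT (fun x => (r * \1_(h m @^-1` [set r]) x)%:E).
  by apply: (measurable_comp measurableT) => //; exact: measurable_funM.
rewrite ge0_integral_fsum//; last by move=> m y Ey; exact: nnfun_muleindic_ge0.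
transitivity (\int[mu]_x (\sum_(y \in range (h n))
    (y * \1_(h n @^-1` [set y]) x)%:E * (f x)%:E)); last first.
  apply: eq_integral => x _.
  rewrite -ge0_mule_fsuml => [|y]; last exact: nnfun_muleindic_ge0.
  by rewrite fsumEFin // -(fimfunE _ x).
rewrite ge0_integral_fsum//; last 2 first.
  - by move=> y; exact: emeasurable_funM.
  - move=> m y Ey; apply: mule_ge0; last by rewrite lee_fin.
    exact: nnfun_muleindic_ge0.
apply: eq_fsbigr => r rhn.
under [LHS]eq_integral do rewrite EFinM.
rewrite integralZl_indic_nnsfun => //.
under [RHS]eq_integral do rewrite EFinM -muleA.
rewrite ge0_integralZl//.
- rewrite integral_indic//= setIT nuE//; congr (_ * _).
  under [in RHS]eq_integral do rewrite muleC.
  rewrite [LHS]integral_mkcond; apply: eq_integral => x _.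
  by rewrite epatch_indic.
- by apply: emeasurable_funM => //; exact/measurable_EFinP.
- by move=> x _; rewrite mule_ge0// lee_fin.
- by move: rhn; rewrite inE => -[x _ <-]; rewrite lee_fin.
Qed.

Lemma integrable_density (g : T -> R) : measurable_fun setT g ->
  nu.-integrable setT (EFin \o g) <-> mu.-integrable setT (fun x => (g x * f x)%:E).
Proof.
move=> mg.
have mgE : measurable_fun setT (fun x => `|(g x)%:E|).
  by apply: measurableT_comp => //; exact/measurable_EFinP.
have E : \int[nu]_x `|(g x)%:E| = \int[mu]_x `|(g x * f x)%:E|.
  rewrite ge0_integral_density//; apply: eq_integral => x _.
  by rewrite EFinM abseM (gee0_abs (x := (f x)%:E)) ?lee_fin.
have mgf : measurable_fun setT (fun x => (g x * f x)%:E).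
  by apply/measurable_EFinP; exact: measurable_funM.
split => /integrableP[_ h]; apply/integrableP; split => //.
- by rewrite -E.
- exact/measurable_EFinP.
- by rewrite E.
Qed.

Lemma Rintegral_density (g : T -> R) : measurable_fun setT g ->
  (\int[nu]_x g x = \int[mu]_x (g x * f x))%R.
Proof.
move=> mg; rewrite /Rintegral; congr fine.
have mgE : measurable_fun setT (EFin \o g) by exact/measurable_EFinP.
rewrite [LHS]integralE [RHS]integralE; congr (_ - _).
- rewrite ge0_integral_density//; last exact: measurable_funepos.
  apply: eq_integral => x _; rewrite !funeposE EFinM.
  have [gx|gx] := leP 0%R (g x).
    by rewrite !max_l// ?mule_ge0 ?lee_fin.
  by rewrite !max_r ?mul0e// ?mule_le0_ge0 ?lee_fin// ltW.
- rewrite ge0_integral_density//; last exact: measurable_funeneg.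
  apply: eq_integral => x _; rewrite !funenegE EFinM -muleN.
  have [gx|gx] := leP 0%R (g x).
    by rewrite !max_r ?mul0e// ?muleN ?oppe_le0 ?mule_ge0 ?lee_fin ?oppr_le0.
  by rewrite !max_l ?muleN ?mulNe// ?oppe_ge0 ?mule_le0_ge0 ?lee_fin ?oppr_ge0// ltW.
Qed.

End density.

(** * Normal laws *)

Section normal_integration_by_parts.
Context (R : realType).
Variables (m s : R).
Hypothesis s0 : s != 0.
Notation p := (normal_pdf m s).
Notation leb := (@lebesgue_measure R).

Lemma is_derive_normal_pdf (x : R) :
  is_derive x (1 : R) (p : R -> R) (- (x - m) / s ^+ 2 * p x).
Proof.
rewrite normal_pdfE//.
have H : is_derive x (1 : R) (fun x : R => - (x - m) ^+ 2 / (s ^+ 2 *+ 2) : R) (- (x - m) / s ^+ 2).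
  by apply: is_derive_eq; rewrite /GRing.scale/=; field.
have H2 := @is_derive1_comp R expR _ x _ _ (is_derive_expR _) H.
have := @is_deriveZ _ _ _ _ (normal_peak s) _ _ _ H2.
move=> H3; apply: (@is_derive_eq _ _ _ _ _ _ _ _ H3).
by rewrite /normal_fun /GRing.scale/=; ring.
Qed.

(** With [w] the exponent of the density, [(x - m)^2 = 2 s^2 (-w)] and [(-w) e^w <= 1]. It makes the
    boundary terms of the integration by parts vanish. *)
Lemma normal_pdf_sqr_bound (x : R) :
  (1 + (x - m) ^+ 2) * p x <= (1 + 2 * s ^+ 2) * normal_peak s.
Proof.
rewrite normal_pdfE//= mulrCA mulrC ler_wpM2r ?normal_peak_ge0//.
rewrite /normal_fun; set w := - (x - m) ^+ 2 / (s ^+ 2 *+ 2).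
have wE : (x - m) ^+ 2 = 2 * s ^+ 2 * (- w) by rewrite /w; field.
have w0 : w <= 0 by rewrite /w mulNr oppr_le0 divr_ge0 ?sqr_ge0// mulrn_wge0 ?sqr_ge0.
rewrite wE mulrDl mul1r lerD//; first by rewrite -[leRHS]expR0 ler_expR.
rewrite -[leLHS]mulrA ler_piMr ?(mulr_ge0 _ (sqr_ge0 s))//.
have h : 0 < expR (- w) by exact: expR_gt0.
rewrite -(ler_pM2r h) mul1r -mulrA -expRD subrr expR0 mulr1.
by rewrite (le_trans _ (expR_ge1Dx _))// lerDr.
Qed.

(** Half of the exponent absorbs the quadratic factor, since [(x - m)^2 = 4 s^2 (-(w / 2))]; the
    other half is the exponent of a normal density of variance [2 s^2]. Integrability under
    quadratic growth thus follows before any moment is known. *)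
Lemma normal_pdf_sqr_dominated (x : R) :
  (1 + (x - m) ^+ 2) * p x <=
  (1 + 4 * s ^+ 2) * normal_peak s / normal_peak (Num.sqrt 2 * s) *
    normal_pdf m (Num.sqrt 2 * s) x.
Proof.
have s2 : Num.sqrt 2 * s != 0 by rewrite mulf_neq0// gt_eqF// sqrtr_gt0.
have pk : normal_peak (Num.sqrt 2 * s) != 0 by rewrite gt_eqF// normal_peak_gt0.
rewrite !normal_pdfE//.
have -> : (1 + 4 * s ^+ 2) * normal_peak s / normal_peak (Num.sqrt 2 * s) *
    (normal_peak (Num.sqrt 2 * s) * normal_fun m (Num.sqrt 2 * s) x) =
    normal_peak s * ((1 + 4 * s ^+ 2) * normal_fun m (Num.sqrt 2 * s) x) by field.
rewrite mulrCA ler_wpM2l ?normal_peak_ge0//.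
rewrite /normal_fun exprMn sqr_sqrtr//.
set w := - (x - m) ^+ 2 / (s ^+ 2 *+ 2).
have -> : - (x - m) ^+ 2 / (2 * s ^+ 2 *+ 2) = w / 2 by rewrite /w; field.
have wE : (x - m) ^+ 2 = 4 * s ^+ 2 * (- (w / 2)) by rewrite /w; field.
have w0 : w <= 0 by rewrite /w mulNr oppr_le0 divr_ge0 ?sqr_ge0// mulrn_wge0 ?sqr_ge0.
have -> : expR w = expR (w / 2) * expR (w / 2) by rewrite -expRD; congr expR; field.
rewrite mulrA ler_wpM2r ?expR_ge0// wE mulrDl mul1r lerD//.
  by rewrite -[leRHS]expR0 ler_expR; lra.
rewrite -[leLHS]mulrA ler_piMr ?(mulr_ge0 _ (sqr_ge0 s))//.
have h : 0 < expR (- (w / 2)) by exact: expR_gt0.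
rewrite -(ler_pM2r h) mul1r -mulrA -expRD subrr expR0 mulr1.
by rewrite (le_trans _ (expR_ge1Dx _))// lerDr.
Qed.

Lemma integrable_mul_normal_pdf (f : R -> R) (C : R) : measurable_fun setT f ->
  (forall x, `|f x| <= C * (1 + (x - m) ^+ 2)) ->
  leb.-integrable setT (fun x => (f x * p x)%:E).
Proof.
move=> mf fC.
have C0 : 0 <= C.
  have := le_trans (normr_ge0 _) (fC m); rewrite subrr expr0n/= addr0 mulr1//.
apply: (@le_integrable _ _ _ leb setT measurableT _
  (fun x => (C * ((1 + 4 * s ^+ 2) * normal_peak s / normal_peak (Num.sqrt 2 * s)))%:E *
    (normal_pdf m (Num.sqrt 2 * s) x)%:E)%E).
- by apply/measurable_EFinP/measurable_funM => //; exact: measurable_normal_pdf.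
- move=> x _; rewrite -EFinM !abse_EFin lee_fin [leRHS]ger0_norm; last first.
    rewrite !mulr_ge0 ?invr_ge0 ?normal_peak_ge0 ?normal_pdf_ge0//.
    by rewrite addr_ge0// mulr_ge0// sqr_ge0.
  rewrite normrM (ger0_norm (normal_pdf_ge0 _ _ _)).
  apply: (le_trans (ler_wpM2r (normal_pdf_ge0 _ _ _) (fC x))).
  by rewrite -[leLHS]mulrA -[leRHS]mulrA ler_wpM2l// normal_pdf_sqr_dominated.
- by apply: integrableZl => //; exact: integrable_normal_pdf.
Qed.

(** Stein's identity [E ((X - m) g(X)) = s^2 E g'(X)]: the integrand is the derivative of
    [F = - s^2 g p], so its integral over a growing interval around [m] is a difference of boundary
    values tending to 0. Mean, variance and characteristic function of the normal law all follow
    from it. *)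
Lemma normal_by_parts (g g' : R -> R) (C : R) :
  (forall x : R, is_derive x (1 : R) g (g' x)) -> continuous g' ->
  (forall x, `|g x| <= C * (1 + `|x - m|)) -> (forall x, `|g' x| <= C) ->
  \int[leb]_x (((x - m) * g x - s ^+ 2 * g' x) * p x) = 0.
Proof.
move=> dg cg' gC g'C.
have C0 : 0 <= C by apply: le_trans (g'C m); exact: normr_ge0.
pose h x := ((x - m) * g x - s ^+ 2 * g' x) * p x.
pose F x := (- s ^+ 2) * (g x * p x).
have cg : continuous g.
  by move=> x; apply/differentiable_continuous/derivable1_diffP; have [] := dg x.
have ch : continuous h.
  move=> x; apply: cvgM; last exact: continuous_normal_pdf.
  apply: cvgB; apply: cvgM.
  - by apply: cvgB; [exact: cvg_id|exact: cvg_cst].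
  - exact: cg.
  - exact: cvg_cst.
  - exact: cg'.
have dF x : is_derive x (1 : R) F (h x).
  have := @is_deriveZ _ _ _ _ (- s ^+ 2) _ _ _
    (is_deriveM (dg x) (is_derive_normal_pdf x)).
  move=> H3; apply: (@is_derive_eq _ _ _ _ _ _ _ _ H3).
  by rewrite /h /GRing.scale/=; field.
have mh : measurable_fun (setT : set R) (fun x : R => (x - m) * g x - s ^+ 2 * g' x : R).
  apply: measurable_funB; apply: measurable_funM => //.
  - exact: measurable_funB.
  - exact: continuous_measurable_fun.
  - exact: continuous_measurable_fun.
have ih : leb.-integrable setT (EFin \o h).
  apply: (@integrable_mul_normal_pdf _ (C * (2 + s ^+ 2))) => // x.
  apply: (le_trans (ler_normB _ _)); rewrite normrM (normrM (s ^+ 2)) (ger0_norm (sqr_ge0 s)).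
  have := gC x; have := g'C x; rewrite -(real_normK (num_real (x - m))).
  have := normr_ge0 (x - m); set y := `|x - m| => y0 hg' hg.
  have s20 := sqr_ge0 s.
  apply: (@le_trans _ _ (y * (C * (1 + y)) + s ^+ 2 * C)).
    by rewrite lerD// ler_wpM2l.
  rewrite -subr_ge0.
  have -> : C * (2 + s ^+ 2) * (1 + y ^+ 2) - (y * (C * (1 + y)) + s ^+ 2 * C) =
     C * (2 + y ^+ 2 - y + s ^+ 2 * y ^+ 2) by ring.
  rewrite mulr_ge0//.
  have := sqr_ge0 (y - 1); have := mulr_ge0 s20 (sqr_ge0 y); nra.
(* [g] grows at most linearly and [(1 + |x - m|)^2 p x] is bounded, so [F] decays at least like
   [1 / (1 + |x - m|)]. *)
have pF x : `|F x| * (1 + `|x - m|) <= C * s ^+ 2 * (2 * ((1 + 2 * s ^+ 2) * normal_peak s)).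
  rewrite /F normrM (normrM (g x)) normrN (ger0_norm (sqr_ge0 s)).
  rewrite (ger0_norm (normal_pdf_ge0 _ _ _)).
  have := gC x; have := normal_pdf_sqr_bound x; have := normal_pdf_ge0 m s x.
  rewrite -(real_normK (num_real (x - m))).
  have := normr_ge0 (x - m); set y := `|x - m| => y0 p0.
  move=> hp hg.
  have hq : (1 + y) ^+ 2 <= 2 * (1 + y ^+ 2) by have := sqr_ge0 (y - 1); nra.
  apply: (@le_trans _ _ (s ^+ 2 * (C * (1 + y) * p x) * (1 + y))).
    by rewrite ler_wpM2r ?addr_ge0// ler_wpM2l ?sqr_ge0// ler_wpM2r.
  have -> : s ^+ 2 * (C * (1 + y) * p x) * (1 + y) = C * s ^+ 2 * ((1 + y) ^+ 2 * p x).
    by ring.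
  rewrite ler_wpM2l ?(mulr_ge0 C0 (sqr_ge0 s))//.
  by apply: (le_trans (ler_wpM2r p0 hq)); rewrite -mulrA ler_wpM2l.
set K := C * s ^+ 2 * _ in pF.
have F0 (c : R) : `|c| = 1 -> F (m + c * n.+1%:R) @[n --> \oo] --> 0.
  move=> c1; apply: norm_cvg0.
  apply: (@squeeze_cvgr _ _ _ _ (cst 0) (fun n => K * n.+1%:R^-1)).
  - apply: nearW => n; rewrite normr_ge0/= ler_pdivlMr ?ltr0n//.
    apply: le_trans (pF (m + c * n.+1%:R)); rewrite ler_wpM2l//.
    by rewrite (addrC m) addrK normrM c1 mul1r ger0_norm ?ler0n// lerDr.
  - exact: cvg_cst.
  - rewrite -[X in _ --> X](mulr0 K); apply: cvgM; first exact: cvg_cst.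
    exact: cvg_harmonic.
pose D n : set R := `[m - n.+1%:R, m + n.+1%:R]%classic.
have E n : \int[leb]_(x in D n) h x = F (m + 1 * n.+1%:R) - F (m + (- 1) * n.+1%:R).
  rewrite /Rintegral (@continuous_FTC2 _ h F).
  - by rewrite mul1r mulN1r -EFinB.
  - by rewrite ltrD2l (@lt_trans _ _ 0)// ?oppr_lt0 ltr0n.
  - exact: continuous_subspaceT.
  - split.
    + by move=> x _; have [] := dF x.
    + apply: cvg_at_right_filter.
      by apply/differentiable_continuous/derivable1_diffP; have [] := dF (m - n.+1%:R).
    + apply: cvg_at_left_filter.
      by apply/differentiable_continuous/derivable1_diffP; have [] := dF (m + n.+1%:R).
  - by move=> x _; rewrite derive1E; have [_] := dF x.
have L1 : \int[leb]_(x in D n) h x @[n --> \oo] --> 0.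
  have H := @cvgB _ _ _ _ _ _ _ _ _ (F0 1 (normr1 _)) (F0 (-1) (normrN1 _)).
  by rewrite subrr in H; rewrite (funext E); exact: H.
have L2 : \int[leb]_(x in D n) h x @[n --> \oo] --> \int[leb]_x h x.
  under eq_fun do rewrite Rintegral_mkcond.
  have mfE n : measurable_fun (setT : set R) (EFin \o (h \_ (D n))).
    apply/measurable_EFinP; apply/(measurable_restrictT _ _).1 => //.
      exact: measurable_itv.
    by apply: measurable_funTS; exact: continuous_measurable_fun.
  have mfE' : measurable_fun (setT : set R) (EFin \o h).
    by apply/measurable_EFinP; exact: continuous_measurable_fun.
  have cE : {ae leb, forall x, setT x ->
      (EFin \o (h \_ (D n))) x @[n --> \oo] --> (EFin \o h) x}.
    apply: aeW => x _; apply: cvg_EFin; first exact: nearW.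
    apply: cvg_near_cst.
    have := @nbhs_infty_ger R `|x - m|; apply: filterS => n /= xn.
    rewrite patchE mem_set// /D/= in_itv/=.
    have := ler_norm (x - m); have := ler_norm (- (x - m)); rewrite normrN.
    have : n%:R <= n.+1%:R :> R by rewrite ler_nat.
    by move=> ? ? ?; apply/andP; split; lra.
  have dE : {ae leb, forall x n, setT x ->
      (`|(EFin \o (h \_ (D n))) x| <= (fun x => `|(h x)%:E|) x)%E}.
    apply: aeW => x n _ /=; rewrite lee_fin patchE.
    by case: ifP => // _; rewrite normr0.
  have ih' : leb.-integrable setT (fun x => `|(h x)%:E|)%E by exact: integrable_abse.
  have [intf _ H] := @dominated_convergence _ _ _ leb _ measurableT _ _ _ mfE mfE' cE ih' dE.
  by apply: fine_cvg; rewrite fineK ?integrable_fin_num//; exact: H.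
by rewrite -(cvg_unique _ L1 L2).
Qed.
End normal_integration_by_parts.

Section normal_moments.
Context (R : realType).
Variables (m s : R).
Hypothesis s0 : s != 0.
Notation N := (@normal_prob R m s).

Let cst_cont (k : R) : continuous (cst k : R -> R).
Proof. by move=> x; exact: cvg_cst. Qed.

Lemma integrable_normal_prob (f : R -> R) (C : R) : measurable_fun setT f ->
  (forall x, `|f x| <= C * (1 + (x - m) ^+ 2)) ->
  N.-integrable setT (EFin \o f).
Proof.
move=> mf fC.
apply/(@integrable_density R _ _ lebesgue_measure N (normal_pdf m s)) => //.
- exact: measurable_normal_pdf.
- exact: normal_pdf_ge0.
- exact: integrable_mul_normal_pdf.
Qed.

Lemma normal_prob_by_parts (g g' : R -> R) (C : R) :
  (forall x : R, is_derive x (1 : R) g (g' x)) -> continuous g' ->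
  (forall x, `|g x| <= C * (1 + `|x - m|)) -> (forall x, `|g' x| <= C) ->
  \int[N]_x ((x - m) * g x - s ^+ 2 * g' x) = 0.
Proof.
move=> dg cg' gC g'C.
rewrite (@Rintegral_density R _ _ lebesgue_measure N (normal_pdf m s)) => //.
- exact: normal_by_parts dg cg' gC g'C.
- exact: measurable_normal_pdf.
- exact: normal_pdf_ge0.
- have cg : continuous g.
    by move=> x; apply/differentiable_continuous/derivable1_diffP; have [] := dg x.
  apply: measurable_funB; apply: measurable_funM => //.
  + exact: measurable_funB.
  + exact: continuous_measurable_fun.
  + exact: continuous_measurable_fun.
Qed.

Lemma normal_prob_mean : \int[N]_x x = m.
Proof.
have ix : N.-integrable setT (fun x : R => (x - m)%:E).
  apply: (@integrable_normal_prob _ 1); first exact: measurable_funB.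
  move=> x; rewrite mul1r -(real_normK (num_real (x - m))).
  by have := sqr_ge0 (`|x - m| - 1); have := normr_ge0 (x - m); nra.
have E : \int[N]_x (x - m) = 0.
  rewrite -[RHS](@normal_prob_by_parts (cst 1) (cst 0) 1).
  - by apply: eq_Rintegral => x _; rewrite /cst/= mulr1 mulr0 subr0.
  - exact: cst_cont.
  - by move=> x /=; rewrite normr1 mul1r lerDl.
  - by move=> x /=; rewrite normr0.
have -> : \int[N]_x x = \int[N]_x ((x - m) + m).
  by apply: eq_Rintegral => x _; rewrite subrK.
rewrite RintegralD//; last by apply: bounded_mfun_integrable; exact: bounded_mfun_cst.
by rewrite E add0r Rintegral_cst//= probability_setT mulr1.
Qed.

Lemma normal_prob_variance : \int[N]_x (x - m) ^+ 2 = s ^+ 2.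
Proof.
have ix : N.-integrable setT (fun x : R => ((x - m) ^+ 2)%:E).
  apply: (@integrable_normal_prob _ 1).
    by apply: measurable_funX; exact: measurable_funB.
  by move=> x; rewrite mul1r ger0_norm ?sqr_ge0// lerDr.
have E : \int[N]_x ((x - m) * (x - m) - s ^+ 2) = 0.
  rewrite -[RHS](@normal_prob_by_parts (fun x => x - m) (cst 1) 1).
  - by apply: eq_Rintegral => x _; rewrite /cst/= mulr1.
  - by move=> x; apply: is_derive_eq; rewrite subr0.
  - exact: cst_cont.
  - by move=> x /=; rewrite mul1r lerDr.
  - by move=> x /=; rewrite normr1.
have -> : \int[N]_x (x - m) ^+ 2 =
    \int[N]_x (((x - m) * (x - m) - s ^+ 2) + s ^+ 2).
  by apply: eq_Rintegral => x _; rewrite subrK.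
have ic : N.-integrable setT (fun x : R => (s ^+ 2)%:E).
  by apply: bounded_mfun_integrable; exact: bounded_mfun_cst.
rewrite RintegralD//.
  by rewrite E add0r Rintegral_cst//= probability_setT mulr1.
have -> : (EFin \o (fun x : R => (x - m) * (x - m) - s ^+ 2)) =
    (fun x : R => ((x - m) ^+ 2)%:E - (s ^+ 2)%:E)%E.
  by apply/funext => x; rewrite /= expr2 EFinB.
exact: integrableB.
Qed.

(** As a function of [t] the integral satisfies [y' = - s^2 t y]: differentiate under the integral
    sign, then apply Stein's identity to the cosine. The value at [t = 0] is [sin c]. *)
Lemma normal_prob_sin (t c : R) :
  \int[N]_x sin (t * (x - m) + c) = sin c * expR (- (s ^+ 2 * t ^+ 2 / 2)).
Proof.
pose f t (x : R) := sin (t * (x - m) + c).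
have mS u (h : R -> R) : continuous h ->
    bounded_mfun (fun x : measurableTypeR R => sin (u * (x - m) + h x)).
  move=> ch; apply: bounded_mfun_sin; apply: measurable_funD; last first.
    exact: continuous_measurable_fun.
  by apply: measurable_funM => //; exact: measurable_funB.
have D u x : is_derive u (1 : R) (f ^~ x) ((x - m) * cos (u * (x - m) + c)).
  have H1 : is_derive u (1 : R) (fun u => u * (x - m) + c : R) (x - m).
    by apply: is_derive_eq; rewrite /GRing.scale/=; ring.
  have H2 := @is_derive1_comp R (@sin R) _ u _ _ (is_derive_sin _) H1.
  apply: (@is_derive_eq _ _ _ _ _ _ _ _ H2).
  by rewrite mulrC.
have dE u : is_derive u (1 : R) (fun u => \int[N]_x f u x)
    (- s ^+ 2 * u * \int[N]_x f u x).
  have iG : N.-integrable setT (EFin \o (fun x : R => `|x - m|)).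
    apply: (@integrable_normal_prob _ 1).
      by apply: measurableT_comp => //; exact: measurable_funB.
    move=> x; rewrite mul1r -(real_normK (num_real (x - m))) normr_id.
    by have := sqr_ge0 (`|x - m| - 1); have := normr_ge0 (x - m); nra.
  have intf (x : R) : `]u - 1, u + 1[%classic x -> N.-integrable setT (EFin \o f x).
    by move=> _; apply: bounded_mfun_integrable; apply: mS; exact: cst_cont.
  have uI : `]u - 1, u + 1[%classic u by rewrite /= in_itv/=; apply/andP; split; lra.
  have der (x y : R) : `]u - 1, u + 1[%classic x -> setT y -> derivable (f ^~ y) x 1.
    by move=> _ _; have [] := D x y.
  have ub (x y : R) : `]u - 1, u + 1[%classic x -> setT y ->
      `|partial1of2 f x y| <= `|y - m|.
    move=> _ _; rewrite partial1of2E; have [_ ->] := D x y.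
    by rewrite normrM ler_piMr// cos_max.
  have G0 (y : R) : 0 <= `|y - m| by [].
  split.
    exact: (derivable_under_integral measurableT uI intf der G0 iG ub).
  rewrite -derive1E (differentiation_under_integral measurableT uI intf der G0 iG ub).
  under eq_Rintegral do rewrite partial1of2E.
  have Df x : 'D_1 (f^~ x) u = (x - m) * cos (u * (x - m) + c) by have [] := D u x.
  under eq_Rintegral do rewrite Df.
  have mC (h : R -> R) : continuous h -> measurable_fun (setT : set R) h.
    by move=> ch; exact: continuous_measurable_fun.
  have clin : continuous (fun x : R => u * (x - m) + c).
    move=> x; apply: cvgD; last exact: cvg_cst.
    by apply: cvgM; [exact: cvg_cst|apply: cvgB; [exact: cvg_id|exact: cvg_cst]].
  have ccos : continuous (fun x : R => cos (u * (x - m) + c)).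
    by move=> x; apply: continuous_comp; [exact: clin|exact: continuous_cos].
  have csin : continuous (fun x : R => sin (u * (x - m) + c)).
    by move=> x; apply: continuous_comp; [exact: clin|exact: continuous_sin].
  have E : \int[N]_x ((x - m) * cos (u * (x - m) + c)
      - s ^+ 2 * (- u * sin (u * (x - m) + c))) = 0.
    apply: (@normal_prob_by_parts (fun x => cos (u * (x - m) + c))
      (fun x => - u * sin (u * (x - m) + c)) (1 + `|u|)).
    - move=> x; have H1 : is_derive x (1 : R) (fun x => u * (x - m) + c : R) u.
        by apply: is_derive_eq; rewrite /GRing.scale/=; ring.
      have H2 := @is_derive1_comp R (@cos R) _ x _ _ (is_derive_cos _) H1.
      apply: (@is_derive_eq _ _ _ _ _ _ _ _ H2); ring.
    - by move=> x; apply: cvgM; [exact: cvg_cst|exact: csin].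
    - move=> x; rewrite (le_trans (cos_max _))// -[leLHS]mulr1.
      by rewrite ler_pM// ?lerDl.
    - move=> x; rewrite normrM normrN ler_wpDl//.
      by rewrite ler_piMr// sin_max.
  have i1 : N.-integrable setT (fun x : R => ((x - m) * cos (u * (x - m) + c))%:E).
    apply: (@integrable_normal_prob _ 1).
      by apply: measurable_funM; [exact: measurable_funB|exact: mC].
    move=> x; rewrite mul1r -(real_normK (num_real (x - m))) normrM.
    apply: (@le_trans _ _ `|x - m|); first by rewrite ler_piMr// cos_max.
    by have := sqr_ge0 (`|x - m| - 1); have := normr_ge0 (x - m); nra.
  have bs : bounded_mfun (fun x : measurableTypeR R => sin (u * (x - m) + c)).
    by apply: bounded_mfun_sin; exact: mC.
  have i2 : N.-integrable setT (fun x : R => (s ^+ 2 * (- u * sin (u * (x - m) + c)))%:E).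
    apply: bounded_mfun_integrable.
    by apply: bounded_mfunM (bounded_mfunM _ bs); exact: bounded_mfun_cst.
  move: E; rewrite RintegralB//.
  under [X in _ - X = _ -> _]eq_Rintegral do rewrite mulrA.
  rewrite RintegralZl//; last exact: bounded_mfun_integrable.
  move/eqP; rewrite subr_eq0 => /eqP E; refine (etrans E _).
  by congr (_ * _); ring.
(* The integrating factor of the differential equation; [H] has derivative 0. *)
pose H u := \int[N]_x f u x * expR (s ^+ 2 * u ^+ 2 / 2).
have dH u : is_derive u (1 : R) H 0.
  have H1 : is_derive u (1 : R) (fun u => s ^+ 2 * u ^+ 2 / 2 : R) (s ^+ 2 * u).
    by apply: is_derive_eq; rewrite /GRing.scale/=; field.
  have H2 := @is_derive1_comp R expR _ u _ _ (is_derive_expR _) H1.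
  apply: (@is_derive_eq _ _ _ _ _ _ _ _ (is_deriveM (dE u) H2)).
  by rewrite /GRing.scale/=; ring.
have := is_derive_0_is_cst t 0 dH.
rewrite /H /f expr0n/= mulr0 mul0r expR0 mulr1 => Ht.
have -> : \int[N]_x sin (t * (x - m) + c) =
    H t * expR (- (s ^+ 2 * t ^+ 2 / 2)).
  by rewrite /H /f -mulrA -expRD subrr expR0 mulr1.
rewrite /H /f Ht; congr (_ * _).
under eq_Rintegral do rewrite mul0r add0r.
by rewrite Rintegral_cst//= probability_setT mulr1.
Qed.

Lemma normal_prob_char (t c : R) :
  \int[N]_x sin (t * x + c) = sin (t * m + c) * expR (- (s ^+ 2 * t ^+ 2 / 2)).
Proof.
rewrite -normal_prob_sin; apply: eq_Rintegral => x _; congr sin; ring.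
Qed.

End normal_moments.

(** * Laws restricted to an event, and their determination by sines *)

Section restricted_law.
Context (R : realType) d (T : measurableType d).

(** A finite measure of total mass [mu A], by which an integral of [f(X)] over an event becomes an
    integral over the line. The measurability proof of [X] is an argument so that the measure
    structure can be attached to this term. *)
Definition restricted_law (mu : {finite_measure set T -> \bar R}) (A : set T)
    (mA : measurable A) (X : T -> R) (mX : measurable_fun setT X) :
  set (measurableTypeR R) -> \bar R := pushforward (mrestr mu mA) X.

Variables (mu : {finite_measure set T -> \bar R}) (A : set T).
Variables (mA : measurable A) (X : T -> R) (mX : measurable_fun setT X).
Notation nu := (restricted_law mu mA mX).
Local Open Scope ereal_scope.

Let mpre (B : set (measurableTypeR R)) : measurable B -> measurable (X @^-1` B).
Proof. by move=> mB; rewrite -[X in measurable X]setTI; exact: mX. Qed.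

Let nu0 : nu set0 = 0.
Proof. by rewrite /restricted_law /pushforward preimage_set0 measure0. Qed.

Let nu_ge0 B : 0 <= nu B.
Proof. by rewrite /restricted_law /pushforward measure_ge0. Qed.

Let nu_sigma_additive : semi_sigma_additive nu.
Proof.
move=> F mF tF mUF; rewrite /restricted_law /pushforward preimage_bigcup.
apply: measure_semi_sigma_additive.
- by move=> n; exact: mpre.
- apply/trivIsetP => /= i j _ _ ij; rewrite -preimage_setI.
  by move/trivIsetP : tF => /(_ _ _ _ _ ij) ->//; rewrite preimage_set0.
- by rewrite -preimage_bigcup; exact: mpre.
Qed.

HB.instance Definition _ := isMeasure.Build _ _ _ nu nu0 nu_ge0 nu_sigma_additive.

Let nu_fin : fin_num_fun nu.
Proof.
move=> B mB; rewrite /restricted_law /pushforward /mrestr fin_num_measure//.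
by apply: measurableI => //; exact: mpre.
Qed.

HB.instance Definition _ := Measure_isFinite.Build _ _ _ nu nu_fin.

Lemma Rintegral_restricted_law (f : R -> R) :
  bounded_mfun (f : measurableTypeR R -> R) ->
  (\int[nu]_x f x = \int[mu]_w (f (X w) * \1_A w))%R.
Proof.
move=> [mf [M fM]].
have bfX : bounded_mfun (f \o X).
  by split; [exact: measurableT_comp|exists M => w; exact: fM].
have dE : forall B, measurable B -> mrestr mu mA B = \int[mu]_(x in B) (\1_A x)%:E.
  by move=> B mB; rewrite integral_indic// /mrestr setIC.
have m1 : measurable_fun setT (\1_A : T -> R) by exact: measurable_indic.
have i0 x : (0 <= \1_A x :> R)%R by rewrite indicE.
rewrite -(Rintegral_density m1 i0 dE); last by have [] := bfX.
rewrite /Rintegral; congr fine.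
apply: (@integral_pushforward _ _ _ (measurableTypeR R) _ _ mX (mrestr mu mA) setT
  (EFin \o f)) => //.
- exact/measurable_EFinP.
- apply/(integrable_density m1 i0 dE); first by have [] := bfX.
  apply: bounded_mfun_integrable; apply: bounded_mfunM bfX _.
  exact: bounded_mfun_indic.
Qed.

End restricted_law.

Section characteristic_uniqueness.
Context (R : realType).

Lemma finite_measure_char_unique (mu1 mu2 : {finite_measure set (measurableTypeR R) -> \bar R}) :
  (forall t c, \int[mu1]_x sin (t * x + c) = \int[mu2]_x sin (t * x + c)) ->
  forall B : set R, measurable B -> mu1 B = mu2 B.
Proof.
move=> E B mB.
pose Z (i : 'I_1) (x : measurableTypeR R) : R := x.
have mZ i : measurable_fun setT (Z i) by exact: measurable_id.
have tE : trig_eq Z mu1 mu2 (fun=> 1).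
  split; first exact: bounded_mfun_cst.
  move=> s c; under eq_Rintegral do rewrite mul1r /lincomb big_ord1.
  by under [in RHS]eq_Rintegral do rewrite mul1r /lincomb big_ord1.
have gB : <<s generated_by_family Z >> B.
  by apply: sub_sigma_algebra; exists ord0, B.
have := trig_eq_Rintegral mZ tE gB.
have I (mu : {finite_measure set (measurableTypeR R) -> \bar R}) :
    \int[mu]_w (1 * \1_B w) = fine (mu B).
  by under eq_Rintegral do rewrite mul1r; rewrite /Rintegral integral_indic// setIT.
rewrite !I => H; rewrite -[LHS]fineK ?fin_num_measure// H fineK//.
exact: fin_num_measure.
Qed.

(** The two variables may live on different spaces, so that a variable of the given probability
    space can be compared with an explicit model on a product space. *)
Lemma restricted_law_unique d1 d2 (T1 : measurableType d1) (T2 : measurableType d2)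
    (mu1 : {finite_measure set T1 -> \bar R}) (mu2 : {finite_measure set T2 -> \bar R})
    (A1 : set T1) (A2 : set T2) (X1 : T1 -> R) (X2 : T2 -> R) :
  measurable A1 -> measurable A2 ->
  measurable_fun setT X1 -> measurable_fun setT X2 ->
  (forall t c, \int[mu1]_w (sin (t * X1 w + c) * \1_A1 w) =
               \int[mu2]_w (sin (t * X2 w + c) * \1_A2 w)) ->
  forall B : set R, measurable B -> mu1 (A1 `&` X1 @^-1` B) = mu2 (A2 `&` X2 @^-1` B).
Proof.
move=> mA1 mA2 mX1 mX2 E B mB.
rewrite ![_ `&` _ @^-1` B]setIC.
apply: (@finite_measure_char_unique (restricted_law mu1 mA1 mX1)
  (restricted_law mu2 mA2 mX2)) => // t c.
have bs : bounded_mfun (fun x : measurableTypeR R => sin (t * x + c)).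
  by apply: bounded_mfun_sin; apply: measurable_funD => //; exact: measurable_funM.
by rewrite !Rintegral_restricted_law.
Qed.

(** The Dirac case [v = 0] and the nondegenerate case become one formula, whose dependence on [m]
    and [v] is jointly measurable and accessible to Fubini's theorem. *)
Lemma normal_law_affine (m v : R) (B : set R) : 0 <= v -> measurable B ->
  normal_law m v B = normal_prob 0 1 [set g | B (m + Num.sqrt v * g)].
Proof.
move=> v0 mB; rewrite /normal_law; case: eqVneq => [->|vn0].
  rewrite sqrtr0 /dirac indicE.
  have [mB'|mB'] := boolP (m \in B).
    rewrite (_ : [set g | _] = setT) ?probability_setT//.
    by apply/seteqP; split => // g _ /=; rewrite mul0r addr0; rewrite inE in mB'.
  rewrite (_ : [set g | _] = set0) ?measure0//.
  apply/seteqP; split => // g /=; rewrite mul0r addr0.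
  by rewrite notin_setE in mB'.
have s0 : Num.sqrt v != 0 by rewrite gt_eqF// sqrtr_gt0 lt_neqAle eq_sym vn0.
have mX : measurable_fun (setT : set (measurableTypeR R)) (fun g : R => m + Num.sqrt v * g).
  by apply: measurable_funD => //; exact: measurable_funM.
pose N1 : {finite_measure set (measurableTypeR R) -> \bar R} := normal_prob m (Num.sqrt v).
pose N2 : {finite_measure set (measurableTypeR R) -> \bar R} := normal_prob 0 1.
have E t c : \int[N1]_x (sin (t * x + c) * \1_setT x) =
    \int[N2]_x (sin (t * (m + Num.sqrt v * x) + c) * \1_setT x).
  under eq_Rintegral do rewrite indicT mulr1.
  rewrite normal_prob_char// sqr_sqrtr//.
  have eN2 x : sin (t * (m + Num.sqrt v * x) + c) * \1_setT x =
      sin ((t * Num.sqrt v) * x + (t * m + c)).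
    by rewrite indicT mulr1; congr sin; ring.
  under [in RHS]eq_Rintegral do rewrite eN2.
  rewrite normal_prob_char ?oner_neq0// mulr0 add0r exprMn sqr_sqrtr//.
  by congr (_ * expR _); ring.
have := @restricted_law_unique _ _ (measurableTypeR R) (measurableTypeR R) N1 N2
  setT setT id _ measurableT measurableT (@measurable_id _ _ _) mX E B mB.
by rewrite !setTI.
Qed.

End characteristic_uniqueness.

Section normal_mixture.
Context (R : realType) d (T : measurableType d) (P : probability T R).
Variables (A : set T) (Phi m v : T -> R).
Hypotheses (mA : measurable A) (mPhi : measurable_fun setT Phi).
Hypotheses (mm : measurable_fun setT m) (mv : measurable_fun setT v).
Hypothesis v0 : forall w, 0 <= v w.
Hypothesis charE : forall t k, \int[P]_w (sin (t * Phi w + k) * \1_A w) =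
  \int[P]_w (expR (- (t ^+ 2 * v w / 2)) * sin (t * m w + k) * \1_A w).

(** The hypothesis [charE] is the transform of a variable that is normal with random parameters [m]
    and [v]. Such a variable is built on the product with an independent standard normal coordinate,
    and uniqueness of transforms identifies the two laws on [A]. *)
Lemma normal_mixture (B : set R) : measurable B ->
  P (A `&` Phi @^-1` B) = (\int[P]_(w in A) normal_law (m w) (v w) B)%E.
Proof.
move=> mB.
pose N01 : probability (measurableTypeR R) R := normal_prob 0 1.
pose PN : probability (T * measurableTypeR R)%type R := (P \x N01)%E.
pose X2 (z : T * measurableTypeR R) : R := m z.1 + Num.sqrt (v z.1) * z.2.
have mX2 : measurable_fun setT X2.
  apply: measurable_funD; first exact: (measurableT_comp mm).
  apply: measurable_funM; last exact: measurable_snd.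
  apply: (measurableT_comp _ (measurableT_comp mv measurable_fst)).
  by apply: continuous_measurable_fun; exact: sqrt_continuous.
have mA2 : measurable (fst @^-1` A : set (T * measurableTypeR R)).
  by rewrite -[X in measurable X]setTI; exact: measurable_fst.
have E t k : \int[P]_w (sin (t * Phi w + k) * \1_A w) =
    \int[PN]_z (sin (t * X2 z + k) * \1_(fst @^-1` A) z).
  rewrite charE.
  have bf : bounded_mfun (fun z => sin (t * X2 z + k) * \1_(fst @^-1` A) z : R).
    apply: bounded_mfunM; last exact: bounded_mfun_indic.
    by apply: bounded_mfun_sin; apply: measurable_funD => //; exact: measurable_funM.
  have := integral12_prod_meas1 (bounded_mfun_integrable PN bf).
  rewrite {2}/Rintegral => <-; rewrite /Rintegral; congr fine.
  apply: eq_integral => w _; rewrite /fubini_F.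
  have bs : bounded_mfun (fun y : measurableTypeR R =>
      sin (t * Num.sqrt (v w) * y + (t * m w + k))).
    by apply: bounded_mfun_sin; apply: measurable_funD => //; exact: measurable_funM.
  transitivity ((\int[N01]_y (sin (t * Num.sqrt (v w) * y + (t * m w + k)) * \1_A w))%R%:E).
    rewrite RintegralZr//; last exact: bounded_mfun_integrable.
    rewrite normal_prob_char ?oner_neq0// mulr0 add0r expr1n mul1r exprMn sqr_sqrtr//.
    by congr EFin; rewrite [expR _ * _]mulrC.
  rewrite /Rintegral fineK.
    apply: eq_integral => y _ /=; congr EFin; congr (sin _ * _).
    by rewrite /X2/=; ring.
  apply: integrable_fin_num => //.
  apply: bounded_mfun_integrable; apply: bounded_mfunM => //; exact: bounded_mfun_cst.
have /= -> := restricted_law_unique mA mA2 mPhi mX2 E mB.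
rewrite [RHS]integral_mkcond /= /product_measure1; apply: eq_integral => w _.
rewrite patchE; case: ifPn => wA.
  rewrite [RHS]normal_law_affine; [|exact: v0|exact: mB].
  apply: (congr1 (normal_prob 0 1)).
  apply/seteqP; split => g; rewrite /xsection/= ?inE/=; first by case.
  by move=> Bg; split => //; rewrite inE in wA.
rewrite /= (_ : xsection _ _ = set0) ?measure0//.
apply/seteqP; split => g //; rewrite /xsection/= inE/= => -[Aw _].
by rewrite notin_setE in wA.
Qed.

End normal_mixture.

(** * Conditional identities and independence read off transforms *)

Section trig_given_family.
Context (R : realType) d (T : measurableType d) (P : probability T R) (I : finType).
Variable Z : I -> T -> R.
Hypothesis mZ : forall i, measurable_fun setT (Z i).

(** The trigonometric integrals of [sin U - E sin V] against the family all vanish, hence so do its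
    integrals over every event of the generated sigma-algebra. The factor [E] must be a constant
    here. *)
Lemma sin_given_family (U V : T -> R) (E : R) (A : set T) :
  measurable_fun setT U -> measurable_fun setT V ->
  (forall s k, \int[P]_w sin (lincomb Z s w + U w + k) =
               E * \int[P]_w sin (lincomb Z s w + V w + k)) ->
  <<s generated_by_family Z >> A ->
  \int[P]_w (sin (U w) * \1_A w) = \int[P]_w (E * sin (V w) * \1_A w).
Proof.
move=> mU mV UV GA.
have ml s : measurable_fun setT (lincomb Z s) by exact: measurable_lincomb.
have bs s k W : measurable_fun setT W -> bounded_mfun (fun w => sin (lincomb Z s w + W w + k)).
  by move=> mW; apply: bounded_mfun_sin; do 2 apply: measurable_funD => //.
have b0 W : measurable_fun setT W -> bounded_mfun (fun w => sin (W w)).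
  by move=> mW; exact: bounded_mfun_sin.
have bE W : bounded_mfun W -> bounded_mfun (fun w => E * W w).
  by move=> bW; apply: bounded_mfunM => //; exact: bounded_mfun_cst.
(* The null measure [mzero] on the other side says that the integrals are 0. *)
have H : trig_eq Z P mzero (fun w => 1 * sin (U w) + - E * sin (V w)).
  split.
    by apply: bounded_mfunD; apply: bounded_mfunM; rewrite //; try exact: b0;
      exact: bounded_mfun_cst.
  move=> s c; rewrite [RHS](_ : _ = 0); last by rewrite /Rintegral integral_measure_zero.
  pose D s k w := 1 * sin (lincomb Z s w + U w + k) + - E * sin (lincomb Z s w + V w + k).
  have bD s' k : bounded_mfun (D s' k).
    by apply: bounded_mfunD; apply: bounded_mfunM; rewrite //; try exact: bs;
      exact: bounded_mfun_cst.
  have D0 s' k : \int[P]_w D s' k w = 0.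
    rewrite RintegralZD_bounded; [|exact: bs..].
    by rewrite UV mul1r mulNr subrr.
  (* With frequencies [- s] and [s] and a phase [pi / 2] the two sines become [cos (x - z)] and
     [cos (x + z)], whose half difference is [sin x sin z], for [x] either [U] or [V] and [z] the
     test argument. *)
  transitivity (\int[P]_w (2^-1 * D (fun i => - s i) (- c + pi / 2) w +
      (- 2^-1) * D s (c + pi / 2) w)); last first.
    by rewrite RintegralZD_bounded// !D0 !mulr0 addr0.
  apply: eq_Rintegral => w _; rewrite /D !addrA !sinDpihalf.
  have -> : lincomb Z (fun i => - s i) w = - lincomb Z s w.
    by rewrite /lincomb -sumrN; apply: eq_bigr => i _; rewrite mulNr.
  set l := lincomb Z s w.
  have h x : - l + x - c = x - (l + c) /\ l + x + c = x + (l + c) by split; ring.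
  rewrite !(h _).1 !(h _).2; move: (U w) (V w) (l + c) => x y z.
  by rewrite !cosB !cosD; field.
have [mA _] := @generated_by_family_trig_multiplier _ _ _ _ Z P P mZ _ GA.
have := trig_eq_Rintegral mZ H GA.
rewrite [X in _ = X -> _](_ : _ = 0); last by rewrite /Rintegral integral_measure_zero.
have bA W : bounded_mfun W -> bounded_mfun (fun w => W w * \1_A w).
  by move=> bW; apply: bounded_mfunM => //; exact: bounded_mfun_indic.
under eq_Rintegral do rewrite mul1r mulNr mulrBl.
rewrite RintegralB//; [|apply: bounded_mfun_integrable..].
- by move/eqP; rewrite subr_eq0 => /eqP.
- by apply: bA; exact: b0.
- by apply: bA; apply: bE; exact: b0.
Qed.

(** A transform that factors means independence; it is obtained as the mixture with constant mean 0
    and variance 1. *)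
Lemma normal_independent_family (Y : T -> R) (A : set T) (B : set R) :
  measurable_fun setT Y ->
  (forall s t k, \int[P]_w sin (lincomb Z s w + t * Y w + k) =
    expR (- (t ^+ 2 / 2)) * \int[P]_w sin (lincomb Z s w + k)) ->
  <<s generated_by_family Z >> A -> measurable B ->
  P (A `&` Y @^-1` B) = (P A * normal_prob 0 1 B)%E.
Proof.
move=> mY YE GA mB.
have [mA _] := @generated_by_family_trig_multiplier _ _ _ _ Z P P mZ _ GA.
rewrite (@normal_mixture _ _ _ P A Y (cst 0) (cst 1))//.
  transitivity (\int[P]_(w in A) normal_prob 0 1 B)%E; last by rewrite integral_cst// muleC.
  by apply: eq_integral => w _; rewrite /normal_law/= oner_eq0 sqrtr1.
move=> t k.
rewrite /cst; under [RHS]eq_Rintegral do rewrite mulr0 mulr1 add0r.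
apply: (sin_given_family (V := cst k)) => //.
  by apply: measurable_funD => //; exact: measurable_funM.
move=> s c; under eq_Rintegral do rewrite -addrA -addrA addrA.
by rewrite YE; congr (_ * _); apply: eq_Rintegral => w _; rewrite addrA.
Qed.

End trig_given_family.

(** * Fubini for independent variables, and scaling of Lebesgue measure *)

Section independent_integral.
Context (R : realType) d d1 d2 (T : measurableType d) (T1 : measurableType d1)
  (T2 : measurableType d2) (P : probability T R) (mu : probability T2 R).
Variables (X : T -> T1) (Y : T -> T2).
Hypotheses (mX : measurable_fun setT X) (mY : measurable_fun setT Y).
Hypothesis indep : forall A B, measurable A -> measurable B ->
  P (X @^-1` A `&` Y @^-1` B) = (P (X @^-1` A) * mu B)%E.
Local Open Scope ereal_scope.

Lemma ge0_independent_integral (h : T1 * T2 -> \bar R) : measurable_fun setT h ->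
  (forall z, 0 <= h z) ->
  \int[P]_w h (X w, Y w) = \int[P]_w \int[mu]_y h (X w, y).
Proof.
move=> mh h0.
have mXY : measurable_fun setT (fun w => (X w, Y w)) by exact: measurable_fun_pair.
pose X' : {mfun T >-> T1} := HB.pack X (isMeasurableFun.Build _ _ _ _ X mX).
pose XY : {mfun T >-> (T1 * T2)%type} :=
  HB.pack (fun w => (X w, Y w)) (isMeasurableFun.Build _ _ _ _ (fun w => (X w, Y w)) mXY).
pose PX : probability T1 R := distribution P X'.
transitivity (\int[pushforward P XY]_z h z).
  by rewrite [RHS]ge0_integral_pushforward.
transitivity (\int[PX \x mu]_z h z).
  apply: eq_measure_integral => C mC _.
  apply/esym; apply: (@product_measure_unique _ _ _ _ _ PX mu (pushforward P XY)); last exact: mC.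
  by move=> A B mA mB; exact: indep.
rewrite fubini_tonelli1//.
rewrite [LHS]ge0_integral_pushforward//.
- by apply: measurable_fun_fubini_tonelli_F.
- by move=> x _; exact: integral_ge0.
Qed.

End independent_integral.

Section lebesgue_scaling.
Context (R : realType) (c : R).
Hypothesis c0 : 0 < c.
Local Open Scope ereal_scope.
Notation leb := (@lebesgue_measure R).

Let mulc (x : measurableTypeR R) : measurableTypeR R := (c * x)%R.

Let mmulc : measurable_fun setT mulc.
Proof. exact: measurable_funM. Qed.

Let cnng : {nonneg R} := NngNum (ltW c0).

Let push : {measure set (measurableTypeR R) -> \bar R}.
Proof. by pose nu : {measure set _ -> \bar R} := pushforward leb mulc; exact: (nu mmulc). Defined.

Lemma lebesgue_measureZ (A : set R) : measurable A ->
  c%:E * leb (mulc @^-1` A) = leb A.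
Proof.
move=> mA; apply/esym.
apply: (@lebesgue_measure_unique _ (mscale cnng push) _ A mA) => //= _ [[a b]] _ <-.
have E : mulc @^-1` `]a, b]%classic = `](c^-1 * a)%R, (c^-1 * b)%R]%classic.
  by apply/seteqP; split => x /=; rewrite !in_itv/= /mulc ler_pdivlMl// ltr_pdivrMl.
rewrite /mscale/= /pushforward/= E.
rewrite !lebesgue_measure_itv/= !lte_fin ltr_pM2l ?invr_gt0//.
case: ifP => _; last by rewrite mule0.
by rewrite -!EFinB -EFinM -mulrBr mulVKf// gt_eqF.
Qed.

Lemma ge0_integral_lebesgueZ (f : R -> \bar R) : measurable_fun setT f ->
  (forall x, 0 <= f x) -> \int[leb]_x f x = c%:E * \int[leb]_x f (c * x)%R.
Proof.
move=> mf f0.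
transitivity (\int[mscale cnng push]_x f x).
  by apply: eq_measure_integral => A mA _; apply/esym; exact: lebesgue_measureZ.
rewrite ge0_integral_mscale//; congr (_ * _).
exact: ge0_integral_pushforward.
Qed.

End lebesgue_scaling.

(** * The chi-square law *)

Section radial.
Context (R : realType) d (T : measurableType d) (P : probability T R).
Local Open Scope ereal_scope.
Notation N01 := (normal_prob (0 : R) 1).

(** The weight cancels the Gaussian exponential and leaves Lebesgue measure times the constant
    [normal_peak 1], to which the scaling of Lebesgue measure applies. *)
Lemma ge0_integral_normal01Z (b : R) (g : R -> \bar R) : (0 < b)%R ->
  measurable_fun setT g -> (forall y, 0 <= g y) ->
  \int[N01]_y (g y * (expR (y ^+ 2 / 2))%:E) =
  b%:E * \int[N01]_y (g (b * y)%R * (expR (y ^+ 2 / 2))%:E).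
Proof.
move=> b0 mg g0.
have E (h : R -> \bar R) : measurable_fun setT h -> (forall y, 0 <= h y) ->
    \int[N01]_y (h y * (expR (y ^+ 2 / 2))%:E) =
    (normal_peak 1)%:E * \int[@lebesgue_measure R]_y h y.
  move=> mh h0.
  pose nu : {measure set (measurableTypeR R) -> \bar R} := N01.
  pose mu : {measure set (measurableTypeR R) -> \bar R} := @lebesgue_measure R.
  have me : measurable_fun setT (fun y : R => (expR (y ^+ 2 / 2))%:E).
    apply/measurable_EFinP; apply: measurableT_comp; first exact: measurable_expR.
    by apply: measurable_funM => //; exact: measurable_funX.
  have H : forall A, measurable A -> nu A = \int[mu]_(x in A) (normal_pdf 0 1 x)%:E by [].
  rewrite (@ge0_integral_density _ _ (measurableTypeR R) mu nu (normal_pdf 0 1) _ _ H).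
  - rewrite -ge0_integralZl//; last by rewrite lee_fin normal_peak_ge0.
    apply: eq_integral => y _; rewrite -muleA muleC -EFinM normal_pdfE ?oner_neq0//.
    rewrite mulrCA /normal_fun -expRD subr0 expr1n mulNr subrr expR0 mulr1//.
  - exact: measurable_normal_pdf.
  - by move=> x; exact: normal_pdf_ge0.
  - exact: emeasurable_funM.
  - by move=> x; rewrite mule_ge0// lee_fin expR_ge0.
have mgb : measurable_fun setT (fun y => g (b * y)%R).
  by apply: measurableT_comp => //; exact: measurable_funM.
by rewrite !E// (@ge0_integral_lebesgueZ _ b)// muleCA.
Qed.

(* For [S = |X|^2] with [X] standard normal in [R^k], the factor [e^(S/2)]
   cancels the Gaussian weight, and this is the scaling [x -> b x] of the
   Lebesgue measure of [R^k]. *)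
Definition radial (k : nat) (S : T -> R) := forall (f : R -> \bar R) (b : R),
  measurable_fun setT f -> (forall x, 0 <= f x) -> (0 < b)%R ->
  \int[P]_w (f (S w) * (expR (S w / 2))%:E) =
  (b ^+ k)%:E * \int[P]_w (f (b ^+ 2 * S w)%R * (expR (S w / 2))%:E).

(** The variables are scaled one at a time. With [y] fixed, [radial k] applied to [s -> f (s + y^2)]
    scales [S] and gives [b^k]; with [S] fixed, scaling the normal coordinate gives one more factor
    [b]. *)
Lemma radial_addsqr (k : nat) (S Y : T -> R) :
  measurable_fun setT S -> measurable_fun setT Y ->
  (forall A B : set R, measurable A -> measurable B ->
    P (S @^-1` A `&` Y @^-1` B) = P (S @^-1` A) * N01 B) ->
  radial k S -> radial k.+1 (fun w => S w + Y w ^+ 2)%R.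
Proof.
move=> mS mY indep rS f b mf f0 b0.
pose N : probability (measurableTypeR R) R := N01.
have mexp d' (T' : measurableType d') (h : T' -> R) : measurable_fun setT h ->
    measurable_fun setT (fun z => (expR (h z / 2))%:E).
  move=> mh; apply/measurable_EFinP; apply: measurableT_comp; first exact: measurable_expR.
  exact: measurable_funM.
have mY2 (T' := (T * measurableTypeR R)%type) :
    measurable_fun (setT : set T') (fun z => z.2 ^+ 2)%R.
  by apply: measurable_funX; exact: measurable_snd.
have mS1 (T' := (T * measurableTypeR R)%type) : measurable_fun (setT : set T') (fun z => S z.1).
  by apply: measurableT_comp.
have e0 (x : R) : 0 <= (expR x)%:E by rewrite lee_fin expR_ge0.
pose h (g : R -> R -> R) (z : T * measurableTypeR R) :=
  f (g (S z.1) z.2) * (expR (S z.1 / 2))%:E * (expR (z.2 ^+ 2 / 2))%:E.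
have h0 g z : 0 <= h g z by rewrite !mule_ge0.
have mh g : measurable_fun (setT : set (T * measurableTypeR R)) (fun z => g (S z.1) z.2) ->
    measurable_fun setT (h g).
  move=> mg; apply: emeasurable_funM; last exact: mexp.
  by apply: emeasurable_funM; [exact: measurableT_comp|exact: mexp].
have indepE (g : R -> R -> R) : measurable_fun setT (fun z : R * R => g z.1 z.2) ->
    \int[P]_w (f (g (S w) (Y w)) * (expR ((S w + Y w ^+ 2) / 2))%:E) =
    \int[P]_w \int[N]_y h g (w, y).
  move=> mg.
  pose H (z : R * measurableTypeR R) := f (g z.1 z.2) * (expR ((z.1 + z.2 ^+ 2) / 2))%:E.
  transitivity (\int[P]_w H (S w, Y w)) => //.
  rewrite (@ge0_independent_integral _ _ _ _ _ _ _ P N S Y mS mY indep).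
  - apply: eq_integral => w _; apply: eq_integral => y _.
    by rewrite /H/h/= mulrDl expRD EFinM muleA.
  - apply: emeasurable_funM; first by apply: measurableT_comp => //.
    apply: mexp; apply: measurable_funD; first exact: measurable_fst.
    by apply: measurable_funX; exact: measurable_snd.
  - by move=> z; rewrite mule_ge0.
have m1 : measurable_fun setT (fun z : R * R => z.1 + z.2 ^+ 2)%R.
  apply: measurable_funD; first exact: measurable_fst.
  by apply: measurable_funX; exact: measurable_snd.
have m2 : measurable_fun setT (fun z : R * R => b ^+ 2 * (z.1 + z.2 ^+ 2))%R.
  exact: measurable_funM.
rewrite (indepE (fun s y => s + y ^+ 2)%R m1) (indepE (fun s y => b ^+ 2 * (s + y ^+ 2))%R m2).
(* The intermediate stage: [S] is scaled, the new coordinate is not yet. *)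
pose g1 (s y : R) := (b ^+ 2 * s + y ^+ 2)%R.
have mg1 : measurable_fun (setT : set (T * measurableTypeR R)) (fun z => g1 (S z.1) z.2).
  by apply: measurable_funD => //; exact: measurable_funM.
transitivity ((b ^+ k)%:E * \int[P]_w \int[N]_y h g1 (w, y)).
  rewrite (@fubini_tonelli _ _ _ _ _ P N)//; last first.
    by apply: mh; exact: measurable_funD.
  rewrite (@fubini_tonelli _ _ _ _ _ P N (h g1))//; last exact: mh.
  rewrite -ge0_integralZl//.
  - apply: eq_integral => y _; rewrite /h/=.
    have mfy c : measurable_fun setT (fun w => f (c * S w + y ^+ 2)%R * (expR (S w / 2))%:E).
      apply: emeasurable_funM; last exact: mexp.
      by apply: measurableT_comp => //; apply: measurable_funD => //; exact: measurable_funM.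
    have := mfy 1%R; under eq_fun do rewrite mul1r; move=> mfy1.
    rewrite ge0_integralZr//; last by move=> w _; rewrite mule_ge0.
    rewrite ge0_integralZr//; [|exact: mfy|by move=> w _; rewrite mule_ge0].
    rewrite muleA; congr (_ * _).
    apply: (rS (fun s => f (s + y ^+ 2)%R)) => //.
    by apply: measurableT_comp => //; exact: measurable_funD.
  - by apply: (@measurable_fun_fubini_tonelli_G _ _ _ _ _ P) => //; exact: mh.
  - by move=> y _; exact: integral_ge0.
  - by rewrite lee_fin exprn_ge0 ?ltW.
rewrite exprSr EFinM -muleA; congr (_ * _).
rewrite -ge0_integralZl//.
- apply: eq_integral => w _; rewrite /h/=.
  have E x y : f x * (expR (S w / 2))%:E * (expR (y ^+ 2 / 2))%:E =
      (expR (S w / 2))%:E * (f x * (expR (y ^+ 2 / 2))%:E).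
    by rewrite -muleA muleCA.
  under eq_integral do rewrite E; under [in RHS]eq_integral do rewrite E.
  have mg (a c : R) : measurable_fun setT (fun y : R => f (a + c * y ^+ 2)%R).
    apply: measurableT_comp => //; apply: measurable_funD => //.
    by apply: measurable_funM => //; exact: measurable_funX.
  have mge (a c : R) : measurable_fun (setT : set R)
      (fun y => f (a + c * y ^+ 2)%R * (expR (y ^+ 2 / 2))%:E).
    by apply: emeasurable_funM => //; apply: mexp; exact: measurable_funX.
  have := mge (b ^+ 2 * S w)%R 1%R; under eq_fun do rewrite mul1r; move=> mge1.
  have := mg (b ^+ 2 * S w)%R 1%R; under eq_fun do rewrite mul1r; move=> mg_1.
  have := mge (b ^+ 2 * S w)%R (b ^+ 2)%R; under eq_fun do rewrite -mulrDr; move=> mgeb.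
  rewrite ge0_integralZl//; [|by move=> y _; rewrite mule_ge0..].
  rewrite ge0_integralZl//; [|by move=> y _; rewrite mule_ge0..].
  rewrite muleCA; congr (_ * _).
  rewrite (ge0_integral_normal01Z (g := fun y => f (b ^+ 2 * S w + y ^+ 2)%R) b0)//.
  congr (_ * _); apply: eq_integral => y _; congr (f _ * _).
  by rewrite exprMn mulrDr.
- apply: (@measurable_fun_fubini_tonelli_F _ _ _ _ _ N) => //.
  by apply: mh; apply: measurable_funM => //; exact: measurable_funD.
- by move=> y _; exact: integral_ge0.
- by rewrite lee_fin ltW.
Qed.

End radial.

Section radial_density.
Context (R : realType) d (T : measurableType d) (P : probability T R).
Variables (k : nat) (S : T -> R).
Hypotheses (mS : measurable_fun setT S) (S0 : forall w, 0 <= S w) (rS : radial P k S).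
Let a : R := k%:R / 2.
Local Open Scope ereal_scope.
Notation leb := (@lebesgue_measure R).

Lemma radial_powR (f : R -> \bar R) (c : R) :
  measurable_fun setT f -> (forall x, 0 <= f x) -> (0 < c)%R ->
  \int[P]_w (f (S w) * (expR (S w / 2))%:E) =
  (c `^ a)%:E * \int[P]_w (f (c * S w)%R * (expR (S w / 2))%:E).
Proof.
move=> mf f0 c0; rewrite (rS (b := Num.sqrt c))// ?sqrtr_gt0// sqr_sqrtr ?ltW//.
by rewrite /a mulrC powRrM powR_mulrn ?powR_ge0// powR12_sqrt// ltW.
Qed.

(* [ka s r dr] is the image of [c `^ a dc] on [[1, 2]] under [r = c * s]: the
   scaling identity is averaged over [c]. The powers [-1] stand for inverses
   of nonnegative reals, because [powR] is known to be measurable. *)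
Let u (c : R) : R := (\1_(`[1%R, 2%R]%classic : set R) c * c `^ a)%R.
Let ka (s r : R) : R := (s `^ (- 1) * u (s `^ (- 1) * r))%R.

Let u0 c : (0 <= u c)%R. Proof. by rewrite mulr_ge0 ?powR_ge0. Qed.

Let ka0 s r : (0 <= ka s r)%R. Proof. by rewrite mulr_ge0 ?powR_ge0. Qed.

Let mu_ : measurable_fun setT u.
Proof. by apply: measurable_funM => //; exact: measurable_powR. Qed.

Let mka : measurable_fun setT (fun z : R * R => ka z.1 z.2).
Proof.
have mi : measurable_fun setT (fun z : R * R => z.1 `^ (- 1))%R.
  exact: (measurableT_comp (measurable_powR _) measurable_fst).
apply: measurable_funM => //; apply: (measurableT_comp mu_).
by apply: measurable_funM => //; exact: measurable_snd.
Qed.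

(** Apart from its prefactor, [ka s r] depends only on the ratio of [r] to [s], so it is homogeneous
    of degree -1. Together with the factor [r^a] of the scaling identity this produces the power
    [r^(a - 1)]. *)
Let kaZ r s : (0 < r)%R -> (0 <= s)%R -> ka (r * s) r = (r `^ (- 1) * ka s 1)%R.
Proof.
move=> r0 s0; have rV : (r `^ (- 1) = r^-1)%R by rewrite powR_inv1 ?ltW.
rewrite /ka (powRM _ (ltW r0) s0) mulr1 mulrA; congr (_ * u _)%R.
by rewrite rV mulrAC mulVf ?mul1r// gt_eqF.
Qed.

(** Average over [c], substitute [r = c S] so that [f] is evaluated at a deterministic [r], exchange
    the integrals, and scale [S] by [r] in the remaining expectation. [K] may be infinite at this
    stage. Since the substitution fails where [S] is 0, [f] has to vanish there. *)
Lemma radial_average : exists2 K : \bar R, 0 <= K &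
  forall f : R -> \bar R, measurable_fun setT f -> (forall x, 0 <= f x) ->
    (forall x, (x <= 0)%R -> f x = 0) ->
    \int[P]_w (f (S w) * (expR (S w / 2))%:E) =
    K * \int[leb]_r (f r * (r `^ (a - 1))%:E).
Proof.
pose E w := (expR (S w / 2))%:E.
have mE : measurable_fun setT E.
  apply/measurable_EFinP; apply: measurableT_comp; first exact: measurable_expR.
  exact: measurable_funM.
have e0 w : 0 <= E w by rewrite lee_fin expR_ge0.
pose K := \int[P]_w ((ka (S w) 1)%:E * E w).
exists K => [|f mf f0 fN]; first by apply: integral_ge0 => w _; rewrite mule_ge0// lee_fin ka0.
pose G (z : T * measurableTypeR R) := (u z.2)%:E * (f (z.2 * S z.1)%R * E z.1).
have mG : measurable_fun setT G.
  apply: emeasurable_funM; first by apply/measurable_EFinP; exact: (measurableT_comp mu_).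
  apply: emeasurable_funM; last exact: (measurableT_comp mE).
  apply: (measurableT_comp mf); apply: measurable_funM; first exact: measurable_snd.
  exact: (measurableT_comp mS).
have G0 z : 0 <= G z by rewrite !mule_ge0// lee_fin.
pose H (z : T * measurableTypeR R) := (ka (S z.1) z.2)%:E * f z.2 * E z.1.
have mSz : measurable_fun (setT : set (T * measurableTypeR R)) (fun z => (S z.1, z.2 : R)).
  by apply: measurable_fun_pair => //; exact: (measurableT_comp mS).
have mH : measurable_fun setT H.
  apply: emeasurable_funM; last exact: (measurableT_comp mE).
  apply: emeasurable_funM; last exact: (measurableT_comp mf).
  by apply/measurable_EFinP; exact: (measurableT_comp mka mSz).
have H0 z : 0 <= H z by rewrite !mule_ge0// lee_fin.
transitivity (\int[leb]_c \int[P]_w G (w, c)).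
  transitivity (\int[leb]_c ((\1_(`[1%R, 2%R]%classic : set R) c)%:E *
      \int[P]_w (f (S w) * E w))).
    rewrite ge0_integralZr//; last 2 first.
    - by apply/measurable_EFinP; exact: measurable_indic.
    - by apply: integral_ge0 => w _; rewrite mule_ge0.
    (* The interval of averaging has length 1, so the left-hand side is unchanged. *)
    have l1 : leb `[1%R, 2%R]%classic = 1.
      rewrite lebesgue_measure_itv/= lte_fin ltr1n -EFinB.
      by congr EFin; ring.
    by rewrite integral_indic// setIT [X in X * _](l1 : _ = _) mul1e.
  apply: eq_integral => c _; rewrite /G/= /u.
  have mfc : measurable_fun setT (fun w => f (c * S w)%R * E w).
    by apply: emeasurable_funM => //; apply: measurableT_comp => //; exact: measurable_funM.
  rewrite ge0_integralZl//; last 2 first.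
  - by move=> w _; rewrite mule_ge0.
  - by rewrite lee_fin; exact: u0.
  rewrite EFinM -muleA indicE; case: (boolP (c \in _)) => [|_]; last by rewrite !mul0e.
  rewrite inE/= in_itv/= => /andP[c1 _]; congr (_ * _).
  by apply: radial_powR => //; exact: lt_le_trans c1.
rewrite -(@fubini_tonelli _ _ _ _ _ P leb)//.
transitivity (\int[P]_w \int[leb]_r H (w, r)).
  apply: eq_integral => w _; rewrite /G /H/=.
  (* Where [S] is 0 both sides vanish: the left one because [f 0 = 0], the right one because [powR]
     gives 0 to the power -1 the value 0. *)
  have [s0|s0] := ltP 0%R (S w); last first.
    have -> : S w = 0%R by apply/le_anti; rewrite s0 S0.
    rewrite !integral0_eq// => c _.
      by rewrite /ka powR0 ?oppr_eq0 ?oner_neq0// mul0r !mul0e.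
    by rewrite mulr0 fN// mul0e mule0.
  have mg : measurable_fun setT (fun c : R => (u c)%:E * (f (c * S w)%R * E w)).
    apply: emeasurable_funM; first exact/measurable_EFinP.
    by apply: emeasurable_funM => //; apply: measurableT_comp => //; exact: measurable_funM.
  have si0 : (0 < (S w)^-1)%R by rewrite invr_gt0.
  rewrite (ge0_integral_lebesgueZ si0 mg); last by move=> c; rewrite !mule_ge0// lee_fin.
  rewrite -ge0_integralZl//.
  - apply: eq_integral => r _; rewrite /ka powR_inv1// [in RHS]EFinM.
    rewrite -[in RHS]muleA -[in RHS]muleA; congr (_ * (_ * (f _ * _))).
    by rewrite mulrAC mulVf ?mul1r// gt_eqF.
  - by apply: (measurableT_comp mg); exact: measurable_funM.
  - by move=> r _; rewrite !mule_ge0// lee_fin.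
  - by rewrite lee_fin ltW.
rewrite (@fubini_tonelli _ _ _ _ _ P leb)//.
rewrite [RHS]muleC -ge0_integralZr//.
- apply: eq_integral => r _; rewrite /H/=.
  have [r0|r0] := leP r 0%R.
    by rewrite fN// !mul0e integral0_eq// => w _; rewrite mule0 mul0e.
  have mk (c : R) : measurable_fun setT (fun s : R => (ka s c)%:E).
    apply/measurable_EFinP.
    have mc : measurable_fun setT (fun s : R => (s, c)) by exact: measurable_fun_pair.
    exact: (measurableT_comp mka mc).
  under eq_integral do rewrite muleAC muleC.
  have mkE c : measurable_fun setT (fun w => (ka (S w) c)%:E * E w).
    by apply: emeasurable_funM mE; exact: (measurableT_comp (mk c)).
  have kE0 c w : setT w -> 0 <= (ka (S w) c)%:E * E w by rewrite mule_ge0// lee_fin ka0.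
  rewrite (ge0_integralZl P measurableT (mkE r) (kE0 r) (f0 r)).
  rewrite -muleA; congr (_ * _).
  have k0 x : 0 <= (ka x r)%:E by rewrite lee_fin; exact: ka0.
  (* The scaling factor is the integration variable [r] itself; [kaZ] then leaves [r^(a - 1)] times
     the integral defining [K]. *)
  apply: (etrans (radial_powR (mk r) k0 r0)).
  under eq_integral => w _ do rewrite (kaZ r0 (S0 w)) EFinM -muleA.
  have rp0 : 0 <= (r `^ (- 1))%:E by rewrite lee_fin powR_ge0.
  rewrite (ge0_integralZl P measurableT (mkE 1%R) (kE0 1%R) rp0).
  by rewrite muleA -EFinM -powRD// (gt_eqF r0) implybT.
- by apply: emeasurable_funM => //; apply/measurable_EFinP; exact: measurable_powR.
- by move=> r _; rewrite mule_ge0// lee_fin powR_ge0.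
- by apply: integral_ge0 => w _; rewrite mule_ge0// lee_fin.
Qed.

Let g (r : R) : R := (\1_(`]0%R, +oo[%classic : set R) r * (r `^ (a - 1) * expR (- (r / 2))))%R.

Let g0 r : (0 <= g r)%R.
Proof. by rewrite mulr_ge0 ?mulr_ge0 ?powR_ge0 ?expR_ge0. Qed.

Let mg : measurable_fun setT g.
Proof.
apply: measurable_funM => //; apply: measurable_funM; first exact: measurable_powR.
apply: (measurableT_comp (@measurable_expR R)); apply: measurable_funN.
exact: measurable_funM.
Qed.

Hypothesis k0 : (0 < k)%N.

Let a0 : (0 < a)%R. Proof. by rewrite divr_gt0// ltr0n. Qed.

Let G := \int[leb]_(t in `]0%R, +oo[) (t `^ (a - 1) * expR (- t))%:E.

Let integral_g : \int[leb]_r (g r)%:E = (2 `^ a)%:E * G.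
Proof.
have mgE : measurable_fun setT (fun r : R => (g r)%:E) by exact/measurable_EFinP.
rewrite (@ge0_integral_lebesgueZ _ 2)//.
have -> : G = \int[leb]_t (\1_(`]0%R, +oo[%classic : set R) t * (t `^ (a - 1) * expR (- t)))%:E.
  rewrite /G [LHS]integral_mkcond; apply: eq_integral => t _; rewrite patchE indicE.
  by case: ifPn => _; rewrite ?mul1r ?mul0r.
rewrite -(@mulr_powRB1 _ 2 a)// EFinM -muleA; congr (_ * _).
rewrite -ge0_integralZl//.
- apply: eq_integral => t _; rewrite -EFinM /g; congr EFin.
  rewrite (_ : 2 * t / 2 = t)%R; last by field.
  rewrite !indicE !mem_setE/= !in_itv/= !andbT pmulr_rgt0//.
  have [t0|t0] := ltP 0%R t; last by rewrite !mul0r mulr0.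
  by rewrite !mul1r powRM ?ltW// mulrA.
- apply/measurable_EFinP; apply: measurable_funM => //.
  apply: measurable_funM; first exact: measurable_powR.
  by apply: (measurableT_comp (@measurable_expR R)); exact: measurable_funN.
- by move=> t _; rewrite lee_fin !mulr_ge0 ?powR_ge0 ?expR_ge0.
Qed.

Let mpre (B : set R) : measurable B -> measurable (S @^-1` B).
Proof. by move=> mB; rewrite -[X in measurable X]setTI; exact: mS. Qed.

Let P_pre (B : set R) : measurable B -> P (S @^-1` B) = \int[P]_w (\1_B (S w))%:E.
Proof.
by move=> mB; rewrite -[X in P X]setIT -integral_indic//; exact: mpre.
Qed.

(** Scaling preserves the event that [S] is 0, and the weight is 1 on it; the scaling identity with
    [b = 2] gives [p = 2^k p], hence [p = 0] because [k > 0]. *)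
Let P_S0 : P (S @^-1` [set 0%R]) = 0.
Proof.
have f0 (x : R) : 0 <= (\1_[set 0%R] x)%:E :> \bar R by rewrite lee_fin indicE.
have mf : measurable_fun setT (fun x : R => (\1_[set 0%R] x)%:E : \bar R).
  by apply/measurable_EFinP; exact: measurable_indic.
have := rS mf f0 (ltr0n R 2).
have E (c : R) : (0 < c)%R -> \int[P]_w ((\1_[set 0%R] (c * S w)%R)%:E * (expR (S w / 2))%:E) =
    P (S @^-1` [set 0%R]).
  move=> c0; rewrite P_pre//.
  apply: eq_integral => w _; rewrite !indicE.
  have [S00|/eqP Sn] := eqVneq (S w) 0%R.
    by rewrite S00 mulr0 mul0r expR0 mule1.
  rewrite memNset ?memNset ?mul0e//= => /eqP; rewrite mulf_eq0 (gt_eqF c0)/= => /eqP //.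
have := E _ ltr01; under eq_integral do rewrite mul1r; move=> ->.
rewrite E// -natrX => /eqP.
rewrite -(fineK (fin_num_measure P _ (mpre (measurable_set1 0%R)))) -EFinM eqe.
move: (fine _) => x; rewrite -{1}[x]mul1r -subr_eq0 -mulrBl mulf_eq0.
case/orP => [|/eqP -> //]; rewrite subr_eq0 eq_sym pnatr_eq1 => /eqP.
by case: k k0 => // n _ /(congr1 odd); rewrite expnS oddM.
Qed.

Let law_S (K : \bar R) :
  (forall f : R -> \bar R, measurable_fun setT f -> (forall x, 0 <= f x) ->
    (forall x, (x <= 0)%R -> f x = 0) ->
    \int[P]_w (f (S w) * (expR (S w / 2))%:E) =
    K * \int[leb]_r (f r * (r `^ (a - 1))%:E)) ->
  forall B : set R, measurable B -> P (S @^-1` B) = K * \int[leb]_(r in B) (g r)%:E.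
Proof.
move=> KE B mB.
pose D : set R := B `&` `]0%R, +oo[%classic.
have mD : measurable D by exact: measurableI.
have -> : P (S @^-1` B) = P (S @^-1` D).
  have -> : S @^-1` B = S @^-1` D `|` S @^-1` (B `&` [set 0%R]).
    apply/seteqP; split => w /=; rewrite /D/= in_itv/= andbT; last by case => -[].
    move=> Bw; have := S0 w; rewrite le_eqVlt => /orP[/eqP Sw|Sw]; [right|left]; split => //.
  rewrite measureU0//; [exact: mpre|by apply: mpre; exact: measurableI|].
  apply: (subset_measure0 (B := S @^-1` [set 0%R])) => //; [|exact: mpre|by move=> w []].
  by apply: mpre; exact: measurableI.
(* The factor [e^(-x/2)] undoes the weight of the averaged identity, leaving the law of [S]
   itself. *)
have := KE (fun x => (\1_D x * expR (- (x / 2)))%:E).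
have -> : \int[P]_w ((\1_D (S w) * expR (- (S w / 2)))%:E * (expR (S w / 2))%:E) = P (S @^-1` D).
  rewrite P_pre//.
  by apply: eq_integral => w _; rewrite -EFinM -mulrA -expRD addNr expR0 mulr1.
move=> ->.
- congr (_ * _); rewrite [RHS]integral_mkcond; apply: eq_integral => r _.
  rewrite patchE /D -EFinM indicI/= /g; case: ifPn => rB.
    rewrite [\1_B r]indicE rB mul1r; congr EFin; ring.
  by rewrite [\1_B r]indicE (negbTE rB) !mul0r.
- apply/measurable_EFinP; apply: measurable_funM; first exact: measurable_indic.
  apply: (measurableT_comp (@measurable_expR R)); apply: measurable_funN.
  exact: measurable_funM.
- by move=> x; rewrite lee_fin mulr_ge0 ?expR_ge0.
- move=> x x0; rewrite indicE memNset ?mul0r// => -[_]/=.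
  by rewrite in_itv/= andbT ltNge x0.
Qed.

(** Total mass 1 reads [K * (2^a * G) = 1] in the extended reals. This excludes 0 and infinity for
    both [K] and [G], so the convergence of the Gamma integral is a consequence, and it identifies
    the normalizing constant. *)
Lemma radial_law : has_pdf P S (chi2_pdf k).
Proof.
have [K K0 /law_S KE] := radial_average.
have G0 : 0 <= G by apply: integral_ge0 => t _; rewrite lee_fin mulr_ge0 ?powR_ge0 ?expR_ge0.
have KG : K * ((2 `^ a)%:E * G) = 1.
  by rewrite -integral_g -KE// preimage_setT probability_setT.
have p0 : (0 < 2 `^ a :> R)%R by rewrite powR_gt0.
have [c c0 Gc] : exists2 c : R, (0 <= c)%R & G = c%:E.
  move: G0 KG; case: G => [c|_|//]; first by rewrite lee_fin; exists c.
  rewrite gt0_muley ?lte_fin//.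
  move: K0; rewrite le_eqVlt => /orP[/eqP <-|K0].
    by rewrite mul0e => /eqP; rewrite eq_sym onee_eq0.
  by rewrite gt0_muley.
have Gm : Gamma a = c by rewrite /Gamma /Rintegral -/G Gc.
have cn0 : (0 < c)%R.
  rewrite lt_neqAle c0 andbT; apply/eqP => c_0.
  by move: KG; rewrite Gc -c_0 !mule0 => /eqP; rewrite eq_sym onee_eq0.
have Kc : K = ((2 `^ a * c)^-1)%:E.
  move: KG; rewrite Gc -EFinM; move: (2 `^ a * c)%R (mulr_gt0 p0 cn0) => q q0.
  move: K0; case: K {KE} => [x _|_|//].
    by rewrite -EFinM => -[xq]; congr EFin; rewrite -[RHS]mul1r -xq mulfK// gt_eqF.
  by rewrite gt0_mulye.
have chiE r : chi2_pdf k r = ((2 `^ a * c)^-1 * g r)%R.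
  rewrite /chi2_pdf -/a Gm /g indicE mem_setE/= in_itv/= andbT mulNr.
  by case: ifP => _; rewrite ?mul0r ?mulr0// mul1r mulrC.
have qc0 : (0 <= (2 `^ a * c)^-1 :> R)%R by rewrite invr_ge0 mulr_ge0// ltW.
split.
- by rewrite (funext chiE); exact: measurable_funM.
- by move=> r; rewrite chiE mulr_ge0.
- split => // B mB; rewrite KE// Kc -ge0_integralZl//.
  + by apply: eq_integral => r _; rewrite chiE.
  + by apply/measurable_EFinP; exact: measurable_funS mg.
  + by move=> r _; rewrite lee_fin.
Qed.

End radial_density.

(** * Sums of squares of independent standard normals *)

Section standard_gaussian_family.
Context (R : realType) d (T : measurableType d) (P : probability T R).

Lemma measurable_generated_by_family (I : finType) (Z : I -> T -> R) (i : I) :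
  measurable_fun (setT : set (g_sigma_algebraType (generated_by_family Z))) (Z i).
Proof.
by move=> _ B mB; rewrite setTI; apply: sub_sigma_algebra; exists i, B.
Qed.

Lemma preimage_generated_by_family (I : finType) (Z : I -> T -> R) d'
    (T' : measurableType d') (f : T -> T') (A : set T') :
  measurable_fun (setT : set (g_sigma_algebraType (generated_by_family Z))) f ->
  measurable A -> <<s generated_by_family Z >> (f @^-1` A).
Proof. by move=> mf mA; have := mf measurableT _ mA; rewrite setTI. Qed.

(** Induction on the number of variables. The joint transform splits off the first variable as a
    factor, so it is standard normal and independent of the sum of the other squares. *)
Lemma radial_sum_sqr (k : nat) (X : 'I_k -> T -> R) :
  (forall i, measurable_fun setT (X i)) ->
  (forall s c, \int[P]_w sin (lincomb X s w + c) =
    sin c * expR (- ((\sum_i s i ^+ 2) / 2))) ->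
  radial P k (fun w => \sum_i X i w ^+ 2).
Proof.
elim: k X => [|k IH] X mX charX.
  move=> f b mf f0 b0; rewrite expr0 mul1e; apply: eq_integral => w _.
  by rewrite big_ord0 mulr0.
pose X' (i : 'I_k) := X (lift ord0 i).
have mX' i : measurable_fun setT (X' i) by exact: mX.
have charX1 (s : 'I_k -> R) t c :
    \int[P]_w sin (lincomb X' s w + t * X ord0 w + c) =
    sin c * expR (- (((\sum_i s i ^+ 2) + t ^+ 2) / 2)).
  pose e i := if unlift ord0 i is Some j then s j else t.
  have e0 : e ord0 = t by rewrite /e unlift_none.
  have eS i : e (lift ord0 i) = s i by rewrite /e liftK.
  have := charX e c; rewrite big_ord_recl e0; under eq_bigr do rewrite eS.
  rewrite [t ^+ 2 + _]addrC => <-; apply: eq_Rintegral => w _; congr (sin (_ + _)).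
  rewrite /lincomb big_ord_recl e0 addrC; congr (_ + _).
  by apply: eq_bigr => i _; rewrite eS.
have charX' (s : 'I_k -> R) c : \int[P]_w sin (lincomb X' s w + c) =
    sin c * expR (- ((\sum_i s i ^+ 2) / 2)).
  have := charX1 s 0 c; rewrite expr0n/= addr0 => <-.
  by apply: eq_Rintegral => w _; rewrite mul0r addr0.
have -> : (fun w => \sum_i X i w ^+ 2) = (fun w => \sum_i X' i w ^+ 2 + X ord0 w ^+ 2).
  by apply/funext => w; rewrite big_ord_recl addrC.
apply: radial_addsqr => //.
- by apply: measurable_sum => i; exact: measurable_funX.
- move=> A B mA mB; apply: (@normal_independent_family _ _ _ P _ X' mX') => //.
    move=> s t c; rewrite charX1 charX' mulrCA -expRD; congr (_ * expR _).
    by field.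
  apply: preimage_generated_by_family mA.
  apply: measurable_sum => i; apply: measurable_funX.
  exact: measurable_generated_by_family.
- exact: IH.
Qed.

End standard_gaussian_family.

(** * Normal laws as a kernel, and the parameters of one descent step *)

Section normal_law_kernel.
Context (R : realType).
Local Open Scope ereal_scope.

Lemma normal_law_probability (m v : R) : (0 <= v)%R ->
  exists q : probability R R, forall B, measurable B -> normal_law m v B = q B.
Proof.
move=> v0; pose N01 : probability (measurableTypeR R) R := normal_prob 0 1.
pose X (g : measurableTypeR R) : R := (m + Num.sqrt v * g)%R.
have mX : measurable_fun setT X by apply: measurable_funD => //; exact: measurable_funM.
pose X' : {mfun measurableTypeR R >-> R} := HB.pack X (isMeasurableFun.Build _ _ _ _ X mX).
by exists (distribution N01 X') => B mB; rewrite normal_law_affine.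
Qed.

(** By the affine form, the value at [z] is the standard normal mass of the section at [z] of one
    measurable set. *)
Lemma measurable_normal_law d (T : measurableType d) (m v : T -> R) (B : set R) :
  measurable_fun setT m -> measurable_fun setT v -> (forall z, 0 <= v z)%R ->
  measurable B -> measurable_fun setT (fun z => normal_law (m z) (v z) B).
Proof.
move=> mm mv v0 mB; pose N01 : probability (measurableTypeR R) R := normal_prob 0 1.
pose X (z : T * measurableTypeR R) : R := (m z.1 + Num.sqrt (v z.1) * z.2)%R.
have mX : measurable_fun setT X.
  apply: measurable_funD; first exact: (measurableT_comp mm).
  apply: measurable_funM; last exact: measurable_snd.
  apply: (measurableT_comp _ (measurableT_comp mv measurable_fst)).
  by apply: continuous_measurable_fun; exact: sqrt_continuous.
have mXB : measurable (X @^-1` B) by rewrite -[X in measurable X]setTI; exact: mX.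
rewrite (_ : (fun z => _) = (fun z => N01 (xsection (X @^-1` B) z))).
  exact: measurable_fun_xsection.
apply/funext => z; rewrite normal_law_affine//; congr (N01 _).
by apply/seteqP; split => g; rewrite /xsection/= inE.
Qed.

End normal_law_kernel.

Section descent_parameters.
Context (R : realType) (eta : R).

Lemma v1_ge0 s : 0 <= v1 eta s.
Proof.
rewrite /v1 subr_ge0 -ler_pdivlMl ?expR_gt0// expRN invrK mulr1.
exact: expR_ge1Dx.
Qed.

Lemma v1_gt0 s : eta != 0 -> 0 < s -> 0 < v1 eta s.
Proof.
move=> eta0 s0; rewrite /v1 subr_gt0 -ltr_pdivlMl ?expR_gt0// expRN invrK mulr1.
by apply: expR_gt1Dx; rewrite mulf_neq0 ?expf_neq0// gt_eqF.
Qed.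

Lemma measurable_v1 : measurable_fun setT (v1 eta).
Proof.
apply: measurable_funB => //; apply: measurable_funM.
  apply: (measurableT_comp (@measurable_expR R)); apply: measurable_funN.
  exact: measurable_funM.
by apply: measurable_funD => //; exact: measurable_funM.
Qed.

Lemma measurable_m1 : measurable_fun setT (fun z : R * R => m1 eta z.1 z.2).
Proof.
apply: measurable_funM.
  apply: (measurableT_comp (@measurable_expR R)); apply: measurable_funN.
  by apply: measurable_funM => //; exact: measurable_snd.
apply: measurable_funB; first exact: measurable_fst.
by apply: measurable_funM => //; exact: measurable_snd.
Qed.

End descent_parameters.

(** * Mixture density of the value after one step *)

Section descent_density.
Context (R : realType) (eta : R) (chi : R -> R).
Hypotheses (eta0 : 0 < eta) (mchi : measurable_fun setT chi) (chi_ge0 : forall s, 0 <= chi s).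
Hypotheses (chi0 : forall s, s <= 0 -> chi s = 0)
  (chi1 : (\int[@lebesgue_measure R]_s (chi s)%:E = 1)%E).
Notation leb := (@lebesgue_measure R).

Let Q (y p s : R) : R := (normal_pdf 0 1 p * chi s) / Num.sqrt (2 * pi * v1 eta s)
  * expR (- ((y - m1 eta p s) ^+ 2 / (2 * v1 eta s))).

Let Q_ge0 y p s : 0 <= Q y p s.
Proof. by rewrite !mulr_ge0 ?normal_pdf_ge0 ?expR_ge0 ?invr_ge0 ?sqrtr_ge0. Qed.

Let mv d (T : measurableType d) (s : T -> R) :
  measurable_fun setT s -> measurable_fun setT (fun z => v1 eta (s z)).
Proof. by move=> ms; exact: (measurableT_comp (measurable_v1 eta)). Qed.

Let measurable_invr d (T : measurableType d) (f : T -> R) :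
  measurable_fun setT f -> (forall z, 0 <= f z) -> measurable_fun setT (fun z => (f z)^-1).
Proof.
move=> mf f0; rewrite (_ : (fun z => _) = (fun z => f z `^ (- 1))).
  exact: (measurableT_comp (measurable_powR _)).
by apply/funext => z; rewrite powR_inv1.
Qed.

Let mQ d (T : measurableType d) (y p s : T -> R) : measurable_fun setT y ->
  measurable_fun setT p -> measurable_fun setT s ->
  measurable_fun setT (fun z => (Q (y z) (p z) (s z))%:E).
Proof.
move=> my mp ms; have mvs := mv ms; apply/measurable_EFinP.
apply: measurable_funM; first apply: measurable_funM.
- apply: measurable_funM; last exact: (measurableT_comp mchi).
  exact: (measurableT_comp (measurable_normal_pdf 0 1)).
- apply: measurable_invr => [|z]; last exact: sqrtr_ge0.
  apply: (@measurableT_comp _ _ _ _ _ _ (@Num.sqrt R)); last exact: measurable_funM.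
  by apply: continuous_measurable_fun; exact: sqrt_continuous.
- apply: (measurableT_comp (@measurable_expR R)); apply: measurable_funN.
  apply: measurable_funM.
    apply: measurable_funX; apply: measurable_funB => //.
    exact: (measurableT_comp (measurable_m1 eta) (measurable_fun_pair mp ms)).
  apply: measurable_invr => [|z]; first exact: measurable_funM.
  by rewrite mulr_ge0// v1_ge0.
Qed.

(** Positivity of [s] keeps the variance away from 0, where [normal_pdf] takes its default form and
    the identity would fail. *)
Let QE y p s : 0 < s ->
  Q y p s = normal_pdf 0 1 p * chi s * normal_pdf (m1 eta p s) (Num.sqrt (v1 eta s)) y.
Proof.
move=> s0; have v0 := v1_gt0 (lt0r_neq0 eta0) s0.
rewrite /Q (@normal_pdfE _ _ (Num.sqrt (v1 eta s))) ?sqrtr_eq0 -?ltNge// /normal_peak /normal_fun.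
rewrite sqr_sqrtr ?ltW// -!mulrA; do 2 congr (_ * _); congr (_ * _).
  by congr ((Num.sqrt _)^-1); ring.
by congr expR; rewrite mulNr mulr_natl expr2 mulrA.
Qed.

(** With [u <= w] for the two values of [eta^2 s], the claim is [1 + w <= e^(w - u) (1 + u)], and
    already [(1 + (w - u)) (1 + u) >= 1 + w] as [u >= 0]. *)
Let v1_le s t : 0 <= s -> s <= t -> v1 eta s <= v1 eta t.
Proof.
move=> s0 st; rewrite /v1 lerD2l lerN2.
have : eta ^+ 2 * s <= eta ^+ 2 * t by rewrite ler_wpM2l ?sqr_ge0.
have : 0 <= eta ^+ 2 * s by rewrite mulr_ge0 ?sqr_ge0.
move: (eta ^+ 2 * s) (eta ^+ 2 * t) => u w u0 uw.
rewrite -ler_pdivlMl ?expR_gt0// -expRN opprK mulrA -expRD.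
apply: le_trans (_ : (1 + (w - u)) * (1 + u) <= _); first by nra.
by rewrite ler_wpM2r ?expR_ge1Dx//; lra.
Qed.

Local Open Scope ereal_scope.

Let D (y : R) : \bar R := \int[leb]_p \int[leb]_(s in `[0%R, +oo[) (Q y p s)%:E.

Let DE y : D y = \int[leb]_p \int[leb]_s (Q y p s)%:E.
Proof.
apply: eq_integral => p _; rewrite integral_mkcond; apply: eq_integral => s _.
rewrite patchE; case: ifPn => //; rewrite notin_setE/= in_itv/= andbT => /negP.
by rewrite -ltNge => s0; rewrite /Q chi0 ?ltW// mulr0 !mul0r.
Qed.

Let QE0 y p s : 0 <= (Q y p s)%:E. Proof. by rewrite lee_fin Q_ge0. Qed.

Notation RR := (measurableTypeR R).

Let D_swap y : D y = \int[leb]_s \int[leb]_p (Q y p s)%:E.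
Proof.
rewrite DE (@fubini_tonelli _ _ RR RR _ leb leb (fun z => (Q y z.1 z.2)%:E))//.
exact: mQ.
Qed.

Let normal_pdfC (m sd y : R) : sd != 0%R -> normal_pdf m sd y = normal_pdf y sd m.
Proof.
by move=> sd0; rewrite !normal_pdfE// /normal_fun -[((y - m) ^+ 2)%R]sqrrN opprB.
Qed.

Let measurable_normal_pdf_mean (y s : R) : (0 < s)%R ->
  measurable_fun setT (fun p => (normal_pdf (m1 eta p s) (Num.sqrt (v1 eta s)) y)%:E).
Proof.
move=> s0; have v0 := v1_gt0 (lt0r_neq0 eta0) s0.
have sq0 : Num.sqrt (v1 eta s) != 0%R by rewrite sqrtr_eq0 -ltNge.
apply/measurable_EFinP.
rewrite (_ : (fun p => _) = (fun p => normal_pdf y (Num.sqrt (v1 eta s)) (m1 eta p s))).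
  apply: (measurableT_comp (measurable_normal_pdf _ _)).
  by apply: measurable_funM => //; exact: measurable_funB.
by apply/funext => p; exact: normal_pdfC.
Qed.

Let normal_peak_le (v w : R) : (0 < v)%R -> (v <= w)%R ->
  (normal_peak (Num.sqrt w) <= normal_peak (Num.sqrt v))%R.
Proof.
move=> v0 vw; have w0 := lt_le_trans v0 vw.
have q0 x : (0 < x)%R -> (0 < x * pi *+ 2 :> R)%R.
  by move=> x0; rewrite mulrn_wgt0// mulr_gt0// pi_gt0.
rewrite /normal_peak (sqr_sqrtr (ltW v0)) (sqr_sqrtr (ltW w0)) lef_pV2 ?posrE ?sqrtr_gt0 ?q0//.
by rewrite ler_wsqrtr// lerMn2r ler_wpM2r// ltW// pi_gt0.
Qed.

(** The mean is affine in [p] with slope [e^(- eta^2 s / 2)]. Substituting [c * p] for [p], with [c]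
    the inverse slope, turns the integrand into a normal density in [p], and [c] is the Jacobian. *)
Let integral_normal_pdf_mean (y s : R) : (0 < s)%R ->
  \int[leb]_p (normal_pdf (m1 eta p s) (Num.sqrt (v1 eta s)) y)%:E =
  (expR (eta ^+ 2 / 2 * s))%:E.
Proof.
move=> s0; have v0 := v1_gt0 (lt0r_neq0 eta0) s0.
have sq0 : Num.sqrt (v1 eta s) != 0%R by rewrite sqrtr_eq0 -ltNge.
set c := expR _; have c0 : (0 < c)%R by exact: expR_gt0.
have E (p : R) : normal_pdf (m1 eta (c * p) s) (Num.sqrt (v1 eta s)) y =
    normal_pdf (y + c^-1 * (eta * s)) (Num.sqrt (v1 eta s)) p.
  rewrite normal_pdfC// /m1 expRN -/c mulrBr mulKf ?gt_eqF//.
  move: (Num.sqrt _) sq0 (c^-1 * _)%R => sd sd0 h.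
  by rewrite !(normal_pdfE _ sd0) /normal_fun (_ : p - h - y = p - (y + h))%R//; ring.
have mn := measurable_normal_pdf_mean y s0.
rewrite (ge0_integral_lebesgueZ c0 mn); last by move=> p; rewrite lee_fin normal_pdf_ge0.
under eq_integral do rewrite E.
by rewrite integral_normal_pdf// mule1.
Qed.

(* For [s <= 1] the factor [normal_pdf 0 1 p] is bounded by its peak and the
   conditional density is integrated over [p]; for [s > 1] the conditional
   density is bounded by its peak, [v1] being nondecreasing. *)
Let D_lty y : D y < +oo.
Proof.
pose C : R := (normal_peak 1 * expR (eta ^+ 2 / 2) + normal_peak (Num.sqrt (v1 eta 1)))%R.
have v11 : (0 < v1 eta 1)%R by exact: v1_gt0 (lt0r_neq0 eta0) _.
have C0 : (0 <= C)%R.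
  by rewrite addr_ge0 ?mulr_ge0 ?normal_peak_ge0 ?expR_ge0.
have le_C s : \int[leb]_p (Q y p s)%:E <= C%:E * (chi s)%:E.
  have [s0|s0] := leP s 0%R.
    rewrite integral0_eq ?mule_ge0 ?lee_fin// => p _.
    by rewrite /Q chi0// mulr0 !mul0r.
  have v0 := v1_gt0 (lt0r_neq0 eta0) s0.
  have sq0 : Num.sqrt (v1 eta s) != 0%R by rewrite sqrtr_eq0 -ltNge.
  have mn := measurable_normal_pdf_mean y s0.
  have n0 (p : R) : 0 <= (normal_pdf (m1 eta p s) (Num.sqrt (v1 eta s)) y)%:E.
    by rewrite lee_fin normal_pdf_ge0.
  have mQs : measurable_fun setT (fun p => (Q y p s)%:E) by exact: mQ.
  have [s1|s1] := leP s 1%R.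
    apply: (@le_trans _ _ (\int[leb]_p ((normal_peak 1 * chi s)%:E *
        (normal_pdf (m1 eta p s) (Num.sqrt (v1 eta s)) y)%:E))).
      apply: ge0_le_integral => //.
      - exact: emeasurable_funM.
      - move=> p _; rewrite -EFinM lee_fin QE// ler_wpM2r ?normal_pdf_ge0//.
        by rewrite ler_wpM2r// normal_pdf_ub// oner_neq0.
    rewrite ge0_integralZl//; last by rewrite lee_fin mulr_ge0// normal_peak_ge0.
    rewrite integral_normal_pdf_mean// -!EFinM lee_fin mulrAC ler_wpM2r//.
    rewrite -[leLHS]addr0 lerD ?normal_peak_ge0// ler_wpM2l ?normal_peak_ge0//.
    by rewrite ler_expR ler_piMr// divr_ge0 ?sqr_ge0.
  have mp : measurable_fun setT (fun p : R => (normal_pdf 0 1 p)%:E).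
    by apply/measurable_EFinP; exact: measurable_normal_pdf.
  apply: (@le_trans _ _ (\int[leb]_p ((normal_peak (Num.sqrt (v1 eta 1)) * chi s)%:E *
      (normal_pdf 0 1 p)%:E))).
    apply: ge0_le_integral => //.
    - exact: emeasurable_funM.
    - move=> p _; rewrite -EFinM lee_fin QE// mulrC -[leRHS]mulrA [(chi s * _)%R]mulrC.
      rewrite ler_wpM2r ?mulr_ge0 ?normal_pdf_ge0//.
      by rewrite (le_trans (normal_pdf_ub _ _ sq0))// normal_peak_le// v1_le// ltW.
  rewrite ge0_integralZl//; last 2 first.
  - by move=> p _; rewrite lee_fin normal_pdf_ge0.
  - by rewrite lee_fin mulr_ge0// normal_peak_ge0.
  rewrite integral_normal_pdf ?oner_neq0// mule1 -EFinM lee_fin ler_wpM2r//.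
  by rewrite -[leLHS]add0r lerD// mulr_ge0 ?normal_peak_ge0// expR_ge0.
rewrite D_swap (@le_lt_trans _ _ (\int[leb]_s (C%:E * (chi s)%:E)))//.
  apply: ge0_le_integral => //.
  - by move=> s _; exact: integral_ge0.
  - apply: (@measurable_fun_fubini_tonelli_G _ _ RR RR _ leb (fun z => (Q y z.1 z.2)%:E)) => //.
    exact: mQ.
  - by apply: emeasurable_funM => //; exact/measurable_EFinP.
rewrite ge0_integralZl//; [|exact/measurable_EFinP|by move=> s _; rewrite lee_fin].
by rewrite chi1 mule1 ltry.
Qed.

Let RRm d (T : measurableType d) (f : T * RR -> \bar R) :
  measurable_fun setT f -> (forall z, 0 <= f z) ->
  measurable_fun setT (fun x => \int[leb]_s f (x, s)).
Proof.
move=> mf f0.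
exact: (@measurable_fun_fubini_tonelli_F _ _ T RR _ leb f).
Qed.

Let mD : measurable_fun setT D.
Proof.
rewrite (funext DE).
apply: (RRm (f := fun z : RR * RR => \int[leb]_s (Q z.1 z.2 s)%:E)).
  apply: (RRm (f := fun z : (RR * RR) * RR => (Q z.1.1 z.1.2 z.2)%:E)) => //.
  by apply: mQ; [exact: (measurableT_comp measurable_fst measurable_fst)
    |exact: (measurableT_comp measurable_snd measurable_fst)|exact: measurable_snd].
by move=> z; exact: integral_ge0.
Qed.

(** Tonelli's theorem applied three times to the nonnegative [J], moving [y] from the innermost to
    the outermost place. *)
Lemma integral_descent_density (B : set R) : measurable B ->
  \int[leb]_s ((chi s)%:E * \int[normal_prob 0 1]_p normal_law (m1 eta p s) (v1 eta s) B) =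
  \int[leb]_(y in B) D y.
Proof.
move=> mB.
pose J y p s : \bar R := (\1_B y)%:E * (Q y p s)%:E.
have J0 y p s : 0 <= J y p s by rewrite mule_ge0.
have mJ d (T : measurableType d) (y p s : T -> R) : measurable_fun setT y ->
    measurable_fun setT p -> measurable_fun setT s ->
    measurable_fun setT (fun z => J (y z) (p z) (s z)).
  move=> my mp ms; apply: emeasurable_funM; last exact: mQ.
  by apply/measurable_EFinP; apply: (measurableT_comp _ my).
transitivity (\int[leb]_s \int[leb]_p \int[leb]_y J y p s).
  apply: eq_integral => s _.
  have [s0|s0] := leP s 0%R.
    rewrite chi0// mul0e integral0_eq// => p _; rewrite integral0_eq// => y _.
    by rewrite /J /Q chi0// mulr0 !mul0r mule0.
  have v0 := v1_gt0 (lt0r_neq0 eta0) s0.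
  have ml : measurable_fun setT (fun p => normal_law (m1 eta p s) (v1 eta s) B).
    apply: measurable_normal_law => //; last by move=> z; exact: v1_ge0.
    by apply: measurable_funM => //; exact: measurable_funB.
  have l0 p : 0 <= normal_law (m1 eta p s) (v1 eta s) B.
    by have [q ->] := normal_law_probability (m1 eta p s) (v1_ge0 eta s).
  pose nu : {measure set RR -> \bar R} := normal_prob 0 1.
  pose mu : {measure set RR -> \bar R} := leb.
  have H : forall A, measurable A -> nu A = \int[mu]_(x in A) (normal_pdf 0 1 x)%:E by [].
  rewrite (@ge0_integral_density _ _ RR mu nu (normal_pdf 0 1)
    (measurable_normal_pdf 0 1) _ H)//; last first.
    by move=> p; exact: normal_pdf_ge0.
  rewrite -ge0_integralZl//; last 3 first.
  - apply: emeasurable_funM; first exact: ml.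
    by apply/measurable_EFinP; exact: measurable_normal_pdf.
  - by move=> p _; rewrite mule_ge0// lee_fin normal_pdf_ge0.
  - by rewrite lee_fin.
  apply: eq_integral => p _.
  rewrite /normal_law (gt_eqF v0) /normal_prob muleCA muleC -EFinM -ge0_integralZl//; last 3 first.
  - apply: measurable_funS (measurableT) _ _ => //.
    by apply/measurable_EFinP; exact: measurable_normal_pdf.
  - by move=> y _; rewrite lee_fin normal_pdf_ge0.
  - by rewrite lee_fin mulr_ge0// normal_pdf_ge0.
  rewrite integral_mkcond; apply: eq_integral => y _; rewrite patchE /J.
  case: ifPn => yB; rewrite indicE; last by rewrite (negbTE yB) mul0e.
  by rewrite yB mul1e -EFinM QE// [(chi s * _)%R]mulrC.
have mJ3 : measurable_fun setT (fun z : (RR * RR) * RR => J z.2 z.1.1 z.1.2).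
  by apply: mJ; [exact: measurable_snd|exact: (measurableT_comp measurable_fst measurable_fst)
    |exact: (measurableT_comp measurable_snd measurable_fst)].
have mJ3' : measurable_fun setT (fun z : (RR * RR) * RR => J z.1.2 z.1.1 z.2).
  by apply: mJ; [exact: (measurableT_comp measurable_snd measurable_fst)
    |exact: (measurableT_comp measurable_fst measurable_fst)|exact: measurable_snd].
transitivity (\int[leb]_p \int[leb]_s \int[leb]_y J y p s).
  apply/esym.
  apply: (@fubini_tonelli _ _ RR RR _ leb leb (fun z => \int[leb]_y J y z.1 z.2)).
    exact: (RRm mJ3).
  by move=> z; exact: integral_ge0.
transitivity (\int[leb]_p \int[leb]_y \int[leb]_s J y p s).
  apply: eq_integral => p _.
  apply: (@fubini_tonelli _ _ RR RR _ leb leb (fun z => J z.2 p z.1)) => //.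
  by apply: mJ; [exact: measurable_snd|exact: measurable_cst|exact: measurable_fst].
transitivity (\int[leb]_y \int[leb]_p \int[leb]_s J y p s).
  apply: (@fubini_tonelli _ _ RR RR _ leb leb (fun z => \int[leb]_s J z.2 z.1 s)).
    exact: (RRm mJ3').
  by move=> z; exact: integral_ge0.
rewrite [RHS]integral_mkcond; apply: eq_integral => y _.
rewrite patchE DE /J; case: ifPn => yB.
  by apply: eq_integral => p _; apply: eq_integral => s _; rewrite indicE yB mul1e.
rewrite integral0_eq// => p _; rewrite integral0_eq// => s _.
by rewrite indicE (negbTE yB) mul0e.
Qed.

(** [D] is finite at every [y], not merely almost everywhere, so its real part is a density that
    agrees with the integral formula pointwise. *)
Lemma descent_density_has_pdf d (T : measurableType d) (P : probability T R) (X : T -> R) :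
  measurable_fun setT X ->
  (forall B : set R, measurable B -> P (X @^-1` B) =
    \int[leb]_s ((chi s)%:E * \int[normal_prob 0 1]_p normal_law (m1 eta p s) (v1 eta s) B)) ->
  exists f : R -> R, has_pdf P X f /\ forall y, (f y)%:E = D y.
Proof.
move=> mX lawX.
have D0 y : 0 <= D y by apply: integral_ge0 => p _; exact: integral_ge0.
have fD y : (fine (D y))%:E = D y by apply: fineK; rewrite (ge0_fin_numE (D0 y)); exact: D_lty.
exists (fine \o D); split => //; split.
- exact: measurableT_comp.
- by move=> y; exact: fine_ge0.
- split=> // B mB; rewrite lawX// integral_descent_density//.
  by apply: eq_integral => y _; exact/esym/fD.
Qed.

End descent_density.

Lemma has_pdf_ge0_integral (R : realType) d (T : measurableType d) (P : probability T R)
    (X : T -> R) (f : R -> R) (g : R -> \bar R) :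
  has_pdf P X f -> measurable_fun setT g -> (forall x, 0 <= g x)%E ->
  (\int[P]_w g (X w) = \int[@lebesgue_measure R]_x (g x * (f x)%:E))%E.
Proof.
move=> [mf f0 [mX lawX]] mg g0.
pose X' : {mfun T >-> measurableTypeR R} :=
  HB.pack (X : T -> measurableTypeR R)
    (isMeasurableFun.Build _ _ _ _ (X : T -> measurableTypeR R) mX).
pose nu : {measure set (measurableTypeR R) -> \bar R} := distribution P X'.
pose mu : {measure set (measurableTypeR R) -> \bar R} := @lebesgue_measure R.
have H A : measurable A -> nu A = (\int[mu]_(x in A) (f x)%:E)%E by exact: lawX.
rewrite -(@ge0_integral_density _ _ (measurableTypeR R) mu nu f mf f0 H)//.
by rewrite [RHS]ge0_integral_pushforward.
Qed.

(** * The field and its gradient at a point *)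

Section gaussian_field_transforms.
Context (R : realType) d (T : measurableType d) (P : probability T R).

Lemma Rintegral_same_law (L : T -> R) (M : {measure set (measurableTypeR R) -> \bar R})
    (f : R -> R) : measurable_fun setT L ->
  (forall B : set R, measurable B -> P (L @^-1` B) = M B) ->
  measurable_fun setT f -> P.-integrable setT (EFin \o f \o L) ->
  \int[P]_w f (L w) = \int[M]_x f x.
Proof.
move=> mL LM mf fL; rewrite /Rintegral; congr fine.
transitivity (\int[pushforward P (L : T -> measurableTypeR R)]_x (f x)%:E)%E.
  apply/esym.
  apply: (@integral_pushforward _ _ _ (measurableTypeR R) _ _ mL P setT (EFin \o f)) => //.
  exact/measurable_EFinP.
by apply: eq_measure_integral => A mA _; exact: LM.
Qed.

Variables (N : nat) (phi : 'rV[R]_N -> {RV P >-> R}).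
Hypothesis hgauss : gaussian_field P phi.
Hypothesis hcentered : forall x, ('E_P[phi x] = 0)%E.
Hypothesis hcov : forall x x',
  ('E_P[(fun w => phi x w * phi x' w)%R] = (expR (- sqnorm (x - x') / 2))%:E)%E.

(** At equal points the covariance is the integral of a nonnegative function, so its finiteness
    gives square integrability; products are dominated by sums of squares. *)
Lemma integrable_field_mul x y : P.-integrable setT (fun w => (phi x w * phi y w)%:E).
Proof.
have sq z : P.-integrable setT (fun w => (phi z w ^+ 2)%:E).
  apply/integrableP; split; first by apply/measurable_EFinP; exact: measurable_funX.
  have := hcov z z; rewrite unlock => E.
  under eq_integral do rewrite /= ger0_norm ?sqr_ge0// expr2.
  by rewrite E ltry.
have s2 : P.-integrable setT (fun w => (phi x w ^+ 2 + phi y w ^+ 2)%:E).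
  have := integrableD measurableT (sq x) (sq y).
  by apply: eq_integrable => // w _; rewrite EFinD.
apply: le_integrable s2 => //.
  by apply/measurable_EFinP; exact: measurable_funM.
move=> w _ /=; rewrite lee_fin normrM [leRHS]ger0_norm ?addr_ge0 ?sqr_ge0//.
rewrite -(real_normK (num_real (phi x w))) -(real_normK (num_real (phi y w))).
have := sqr_ge0 (`|phi x w| - `|phi y w|).
by have := normr_ge0 (phi x w); have := normr_ge0 (phi y w); nra.
Qed.

Lemma integrable_field x : P.-integrable setT (EFin \o phi x).
Proof.
have i1 : P.-integrable setT (fun w => (phi x w * phi x w + 1)%:E).
  have := integrableD measurableT (integrable_field_mul x x)
    (bounded_mfun_integrable P (bounded_mfun_cst T 1)).
  by apply: eq_integrable => // w _; rewrite EFinD.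
apply: le_integrable i1 => //; first exact/measurable_EFinP.
move=> w _ /=; rewrite lee_fin [leRHS]ger0_norm ?addr_ge0 -?expr2 ?sqr_ge0//.
rewrite -(real_normK (num_real (phi x w))).
by have := sqr_ge0 (`|phi x w| - 1); have := normr_ge0 (phi x w); nra.
Qed.

Definition fieldcov (x y : 'rV[R]_N) : R := expR (- sqnorm (x - y) / 2).

Section finite_combination.
Variables (J : finType) (a : J -> R) (x : J -> 'rV[R]_N).
Let L (w : T) := \sum_j a j * phi (x j) w.
Let q := \sum_j \sum_k a j * a k * fieldcov (x j) (x k).

Let mL : measurable_fun setT L.
Proof. by apply: measurable_sum => j; exact: measurable_funM. Qed.

Let iZ j : P.-integrable setT (fun w => (a j * phi (x j) w)%:E).
Proof. by have := integrableZl measurableT (a j) (integrable_field (x j)). Qed.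

Let iZZ j k : P.-integrable setT (fun w => (a j * a k * (phi (x j) w * phi (x k) w))%:E).
Proof.
by have := integrableZl measurableT (a j * a k) (integrable_field_mul (x j) (x k)).
Qed.

Let iL : P.-integrable setT (EFin \o L).
Proof.
have := integrable_sum measurableT (index_enum J) (P := xpredT) (fun j _ => iZ j).
by apply: eq_integrable => // w _; rewrite /L /= sumEFin.
Qed.

Let LL w : L w ^+ 2 = \sum_(jk : J * J) a jk.1 * a jk.2 * (phi (x jk.1) w * phi (x jk.2) w).
Proof.
rewrite expr2 /L mulr_suml -(pair_bigA _ (fun j k => a j * a k * (phi (x j) w * phi (x k) w))) /=.
apply: eq_bigr => j _; rewrite mulr_sumr; apply: eq_bigr => k _; ring.
Qed.

Let iLL : P.-integrable setT (fun w => (L w ^+ 2)%:E).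
Proof.
have := integrable_sum measurableT (index_enum (J * J)%type) (P := xpredT)
  (fun jk _ => iZZ jk.1 jk.2).
by apply: eq_integrable => // w _; rewrite LL /= sumEFin.
Qed.

Let meanL : \int[P]_w L w = 0.
Proof.
rewrite /Rintegral /L; under eq_integral do rewrite -sumEFin.
rewrite integral_sum//.
rewrite big1// => j _; under eq_integral do rewrite EFinM.
rewrite integralZl//; last exact: integrable_field.
by have := hcentered (x j); rewrite unlock => ->; rewrite mule0.
Qed.

Let varL : \int[P]_w L w ^+ 2 = q.
Proof.
rewrite /Rintegral; under eq_integral do rewrite LL -sumEFin.
rewrite integral_sum//.
transitivity (fine (\sum_(jk : J * J) (a jk.1 * a jk.2 * fieldcov (x jk.1) (x jk.2))%:E)%E).
  congr fine; apply: eq_bigr => jk _; under eq_integral do rewrite EFinM.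
  rewrite integralZl//; last exact: integrable_field_mul.
  by have := hcov (x jk.1) (x jk.2); rewrite unlock => ->; rewrite -EFinM.
by rewrite sumEFin/= -(pair_bigA _ (fun j k => a j * a k * fieldcov (x j) (x k))).
Qed.

(** The definition of a Gaussian field leaves the parameters of the normal law unspecified; they are
    recovered as the first two moments, 0 and the quadratic form [q]. In the Dirac case these
    moments force [m = 0] and [q = 0]. *)
Lemma field_combination_char c :
  \int[P]_w sin (L w + c) = sin c * expR (- (q / 2)).
Proof.
have [m [v [v0 [_ Llaw]]]] : exists m v : R, 0 <= v /\ has_law P L (normal_law m v).
  have [m [v [v0 Llaw]]] := @hgauss #|J| (x \o enum_val) (a \o enum_val).
  exists m, v; split => //.
  rewrite (_ : L = fun w => \sum_(i < #|J|) (a \o enum_val) i * phi ((x \o enum_val) i) w)//.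
  apply/funext => w; rewrite /L (reindex (fun i : 'I_#|J| => enum_val i))//.
  by apply: onW_bij; exact: enum_val_bij.
have bs : bounded_mfun (fun w => sin (L w + c)).
  by apply: bounded_mfun_sin; exact: measurable_funD.
have is_ : P.-integrable setT (EFin \o (fun x => sin (x + c)) \o L).
  exact: bounded_mfun_integrable.
have ms : measurable_fun (setT : set R) (fun x => sin (x + c)).
  apply: continuous_measurable_fun => y.
  apply: (@continuous_comp _ _ _ (fun y => y + c) (@sin R)); last exact: continuous_sin.
  by apply: cvgD; [exact: cvg_id|exact: cvg_cst].
have msq : measurable_fun (setT : set R) (fun x : R => x ^+ 2) by exact: measurable_funX.
move: Llaw; rewrite /normal_law; case: eqVneq => [vE|vn0] Llaw.
- pose M : {measure set (measurableTypeR R) -> \bar R} := dirac (m : measurableTypeR R).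
  have LM B : measurable B -> P (L @^-1` B) = M B by exact: Llaw.
  have D (f : R -> R) : measurable_fun setT f -> \int[M]_y f y = f m.
    move=> mf; rewrite /Rintegral integral_dirac ?diracT ?mul1e//.
    exact/measurable_EFinP.
  have m0 : m = 0.
    rewrite -meanL (Rintegral_same_law mL LM (@measurable_id _ _ _) iL) D//.
  have q0 : q = 0.
    by rewrite -varL (Rintegral_same_law mL LM msq iLL) D// m0 expr0n.
  rewrite (Rintegral_same_law mL LM ms is_) D// m0 q0.
  by rewrite add0r mul0r oppr0 expR0 mulr1.
- have s0 : Num.sqrt v != 0 by rewrite gt_eqF// sqrtr_gt0 lt_neqAle eq_sym vn0.
  pose M : {measure set (measurableTypeR R) -> \bar R} := normal_prob m (Num.sqrt v).
  have LM B : measurable B -> P (L @^-1` B) = M B by exact: Llaw.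
  have E1 := Rintegral_same_law mL LM (@measurable_id _ _ _) iL.
  have E2 := Rintegral_same_law mL LM msq iLL.
  rewrite (Rintegral_same_law mL LM ms is_).
  have m0 : m = 0 by rewrite -(normal_prob_mean m s0) -meanL E1.
  have vq : v = q.
    rewrite -varL E2 -[LHS](sqr_sqrtr v0) -(normal_prob_variance m s0).
    by apply: eq_Rintegral => y _; rewrite m0 subr0.
  transitivity (\int[M]_y sin (1 * y + c)).
    by apply: eq_Rintegral => y _; rewrite mul1r.
  rewrite normal_prob_char// sqr_sqrtr// expr1n mulr1 vq.
  by rewrite m0 mulr0 add0r.
Qed.

End finite_combination.

Hypothesis hdiff : forall w x, differentiable (fun x => phi x w) x.
Variable x0 : 'rV[R]_N.
Let G (i : 'I_N) (w : T) : R := gradient (fun x => phi x w) x0 0 i.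
Let incr (i : 'I_N) (n : nat) (w : T) : R :=
  n.+1%:R * (phi (x0 + n.+1%:R^-1 *: delta_mx 0 i) w - phi x0 w).

Lemma cvg_increment i w : incr i n w @[n --> \oo] --> G i w.
Proof.
rewrite /G /gradient mxE.
have /cvg_ex[l fl] : derivable (fun x => phi x w) x0 (delta_mx 0 i).
  exact: diff_derivable.
rewrite /derive (cvg_lim _ fl)//.
have t0 : (forall n, (n.+1%:R : R)^-1 != 0) /\ (n.+1%:R : R)^-1 @[n --> \oo] --> 0.
  by split; [move=> n; rewrite invr_eq0 pnatr_eq0|exact: cvg_harmonic].
move: fl => /cvgr_dnbhsP/(_ _ t0).
rewrite (_ : (fun n => _) = incr i ^~ w)//; apply/funext => n.
by rewrite /incr invrK /= [_ + x0]addrC.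
Qed.

Lemma measurable_gradient i : measurable_fun setT (G i).
Proof.
apply: (measurable_fun_cvg (h := incr i)) => [n|w _]; last exact: cvg_increment.
by apply: measurable_funM => //; exact: measurable_funB.
Qed.

(** * Joint transform of value, gradient and a further value of the field *)

Section quadratic_form_limit.
Variables (a t : R) (b : 'I_N -> R) (c : 'rV[R]_N).
Let J : finType := (bool + 'I_N)%type.
Let r (n : nat) : R := n.+1%:R.
Let B := \sum_i b i.
(** Coefficients of [a phi(x0) + sum_i b_i incr_i + t phi(c)] regrouped by evaluation point.
    [inl true] stands for [x0], which also collects the subtracted terms of all difference
    quotients, and [inl false] for [c]. *)
Let coef n (j : J) : R := match j with
  | inl true => a - r n * B | inl false => t | inr i => r n * b i end.
Let pt n (j : J) : 'rV[R]_N := match j with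
  | inl true => x0 | inl false => c | inr i => x0 + (r n)^-1 *: delta_mx 0 i end.
Let q n := \sum_j \sum_k coef n j * coef n k * fieldcov (pt n j) (pt n k).
Let L n w := \sum_j coef n j * phi (pt n j) w.

Let LE n w : L n w = a * phi x0 w + \sum_i b i * incr i n w + t * phi c w.
Proof.
rewrite /L big_sumType/= big_bool/=.
have -> : \sum_i b i * incr i n w = \sum_i r n * b i * phi (pt n (inr i)) w - r n * B * phi x0 w.
  rewrite /B mulr_sumr mulr_suml -sumrB; apply: eq_bigr => i _.
  by rewrite /incr /r /pt; ring.
ring.
Qed.

Let sqnormN (x : 'rV[R]_N) : sqnorm (- x) = sqnorm x.
Proof. by apply: eq_bigr => i _; rewrite mxE sqrrN. Qed.

Let fieldcovC (x y : 'rV[R]_N) : fieldcov x y = fieldcov y x.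
Proof. by rewrite /fieldcov -sqnormN opprB. Qed.

Let fieldcov_refl (x : 'rV[R]_N) : fieldcov x x = 1.
Proof.
by rewrite /fieldcov subrr /sqnorm big1 ?oppr0 ?mul0r ?expR0// => i _; rewrite mxE expr0n.
Qed.

Lemma sqnorm_addZ_delta (x : 'rV[R]_N) h i :
  sqnorm (x + h *: delta_mx 0 i) = sqnorm x + 2 * h * x 0 i + h ^+ 2.
Proof.
rewrite /sqnorm (bigD1 i)//= [in RHS](bigD1 i)//= !mxE !eqxx mulr1.
rewrite [X in _ + X](eq_bigr (fun k => x 0 k ^+ 2)); first ring.
by move=> k /negbTE ki; rewrite !mxE ki andbF mulr0 addr0.
Qed.

Let e n : R := expR (- (r n)^-1 ^+ 2 / 2).

Let cov0i n i : fieldcov x0 (pt n (inr i)) = e n.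
Proof.
rewrite fieldcovC /fieldcov /pt (addrC x0) addrK -[_ *: _]add0r sqnorm_addZ_delta.
by rewrite mxE mulr0 /sqnorm big1 ?add0r// => k _; rewrite mxE expr0n.
Qed.

Let covij n i j : fieldcov (pt n (inr i)) (pt n (inr j)) =
  e n ^+ 2 + (i == j)%:R * (1 - e n ^+ 2).
Proof.
case: (eqVneq i j) => [->|ij]; first by rewrite fieldcov_refl mul1r addrC subrK.
rewrite mul0r addr0 /fieldcov /pt opprD addrACA subrr add0r.
rewrite -scaleNr sqnorm_addZ_delta -[X in sqnorm X]add0r sqnorm_addZ_delta.
rewrite /sqnorm big1 ?add0r; last by move=> k _; rewrite mxE expr0n.
rewrite !mxE eqxx/= eq_sym (negbTE ij) !mulr0 add0r addr0 sqrrN.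
by rewrite [RHS]expr2 /e -expRD; congr expR; move: (r n)^-1 => h; field.
Qed.

Let K := fieldcov x0 c.

Let covci n i : fieldcov c (pt n (inr i)) =
  K * expR ((r n)^-1 * (c - x0) 0 i - (r n)^-1 ^+ 2 / 2).
Proof.
rewrite fieldcovC /fieldcov /pt addrAC sqnorm_addZ_delta.
rewrite /K /fieldcov -expRD; congr expR; rewrite !mxE; move: (r n)^-1 => h.
by field.
Qed.

(** The coefficients grow like [r n], but the variance can be arranged so that each growing factor
    multiplies a difference [exp - 1] that compensates it. *)
Let qE n : q n = a ^+ 2 + 2 * a * B * (r n * (e n - 1)) + (B * (r n * (e n - 1))) ^+ 2
  - (r n ^+ 2 * (e n ^+ 2 - 1)) * \sum_i b i ^+ 2 + t ^+ 2 + 2 * t * a * K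
  + 2 * t * K * \sum_i b i * (r n * (expR ((r n)^-1 * (c - x0) 0 i - (r n)^-1 ^+ 2 / 2) - 1)).
Proof.
have S1 : \sum_i r n * b i = r n * B by rewrite mulr_sumr.
have S2 : \sum_i \sum_j r n * b i * (r n * b j) * fieldcov (pt n (inr i)) (pt n (inr j)) =
    r n ^+ 2 * (e n ^+ 2 * B ^+ 2 + (1 - e n ^+ 2) * \sum_i b i ^+ 2).
  transitivity (\sum_i (r n ^+ 2 * e n ^+ 2 * B * b i + r n ^+ 2 * (1 - e n ^+ 2) * b i ^+ 2)).
    apply: eq_bigr => i _.
    transitivity (\sum_j (r n ^+ 2 * e n ^+ 2 * b i * b j +
        (i == j)%:R * (r n ^+ 2 * (1 - e n ^+ 2) * b i * b j))).
      by apply: eq_bigr => j _; rewrite covij; ring.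
    rewrite big_split/= -mulr_sumr -/B; congr (_ + _); first ring.
    rewrite (bigD1 i)//= eqxx mul1r big1 ?addr0; first ring.
    by move=> j; rewrite eq_sym => /negbTE ->; rewrite mul0r.
  by rewrite big_split/= -!mulr_sumr -/B; ring.
rewrite /q big_sumType/= big_bool/=.
rewrite !big_sumType/= !big_bool/=.
have -> : \sum_i (\sum_k coef n (inr i) * coef n k * fieldcov (pt n (inr i)) (pt n k)) =
   \sum_i ((a - r n * B) * e n * (r n * b i)) +
   \sum_i (t * (r n * b i) * fieldcov c (pt n (inr i))) +
   \sum_i \sum_j r n * b i * (r n * b j) * fieldcov (pt n (inr i)) (pt n (inr j)).
  rewrite -!big_split/=; apply: eq_bigr => i _; rewrite big_sumType/= big_bool/=.
  by rewrite !(fieldcovC (pt n (inr i)) x0) !(fieldcovC (pt n (inr i)) c) cov0i; ring.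
rewrite S2 !fieldcov_refl (fieldcovC c x0) -/K.
under eq_bigr do rewrite cov0i.
set D := \sum_i b i * (r n * (expR _ - 1)).
have A1 : \sum_i (a - r n * B) * (r n * b i) * e n = (a - r n * B) * (r n * B) * e n.
  by rewrite -mulr_suml -mulr_sumr S1.
have A2 : \sum_i (a - r n * B) * e n * (r n * b i) = (a - r n * B) * e n * (r n * B).
  by rewrite -mulr_sumr S1.
have A3 : \sum_i t * (r n * b i) * fieldcov c (pt n (inr i)) = t * K * (D + r n * B).
  rewrite /D -S1 -big_split/= mulr_sumr; apply: eq_bigr => i _.
  by rewrite covci; ring.
by rewrite A1 A2 A3; ring.
Qed.

(** [r (e - 1)] tends to 0 and [r^2 (e^2 - 1)] to -1, the latter giving the partial derivatives unit
    variance and no correlation. The last factor tends to [(c - x0) 0 i], which is the covariance of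
    the [i]-th partial derivative with [phi c], up to [K]. *)
Let q_cvg : q n @[n --> \oo] -->
  a ^+ 2 + \sum_i b i ^+ 2 + t ^+ 2 + 2 * t * K * (a + \sum_i b i * (c - x0) 0 i).
Proof.
have h0 : (r n)^-1 @[n --> \oo] --> 0 by exact: cvg_harmonic.
have rr n : r n != 0 by rewrite pnatr_eq0.
have h2 : (r n)^-1 ^+ 2 @[n --> \oo] --> 0.
  by rewrite -[X in _ --> X](mulr0 0); apply: cvgM.
have E1 : r n * (e n - 1) @[n --> \oo] --> 0.
  apply: cvg_mul_expRB1.
    rewrite -[X in _ --> X](mul0r 2^-1) -oppr0; apply: cvgM; last exact: cvg_cst.
    exact: cvgN.
  rewrite (_ : (fun n => _) = (fun n => - 2^-1 * (r n)^-1)).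
    by rewrite -[X in _ --> X](mulr0 (- 2^-1)); apply: cvgM => //; exact: cvg_cst.
  by apply/funext => n; move: (rr n); move: (r n) => z z0; field.
have E2 : r n ^+ 2 * (e n ^+ 2 - 1) @[n --> \oo] --> (-1 : R).
  rewrite (_ : (fun n => _) = (fun n => r n ^+ 2 * (expR (- (r n)^-1 ^+ 2) - 1))); last first.
    apply/funext => n; congr (_ * (_ - _)); rewrite [LHS]expr2 /e -expRD; congr expR.
    by move: (r n)^-1 => h; field.
  apply: cvg_mul_expRB1; first by rewrite -oppr0; exact: cvgN.
  rewrite (_ : (fun n => _) = (fun=> -1)); first exact: cvg_cst.
  by apply/funext => n; move: (rr n); move: (r n) => z z0; field.
have E3 i : r n * (expR ((r n)^-1 * (c - x0) 0 i - (r n)^-1 ^+ 2 / 2) - 1) @[n --> \oo] -->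
    (c - x0) 0 i.
  apply: cvg_mul_expRB1.
    rewrite -[X in _ --> X](subrr 0); apply: cvgB.
      by rewrite -[X in _ --> X](mul0r ((c - x0) 0 i)); apply: cvgM => //; exact: cvg_cst.
    by rewrite -[X in _ --> X](mul0r 2^-1); apply: cvgM => //; exact: cvg_cst.
  rewrite (_ : (fun n => _) = (fun n => (c - x0) 0 i - (r n)^-1 * 2^-1)).
    rewrite -[X in _ --> X]subr0; apply: cvgB; first exact: cvg_cst.
    by rewrite -[X in _ --> X](mul0r 2^-1); apply: cvgM => //; exact: cvg_cst.
  by apply/funext => n; move: (rr n); move: (r n) => z z0; field.
rewrite (funext qE).
have -> : a ^+ 2 + \sum_i b i ^+ 2 + t ^+ 2 + 2 * t * K * (a + \sum_i b i * (c - x0) 0 i) =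
    a ^+ 2 + 2 * a * B * 0 + (B * 0) ^+ 2 - (-1) * \sum_i b i ^+ 2 + t ^+ 2 +
    2 * t * a * K + 2 * t * K * \sum_i b i * (c - x0) 0 i by ring.
apply: cvgD; last first.
  apply: cvgM; first exact: cvg_cst.
  by apply: cvg_big => [|i _]; [exact: add_continuous|]; apply: cvgM; [exact: cvg_cst|exact: E3].
apply: cvgD; last exact: cvg_cst.
apply: cvgD; last exact: cvg_cst.
apply: cvgB; last by apply: cvgM => //; exact: cvg_cst.
apply: cvgD.
  by apply: cvgD; [exact: cvg_cst|apply: cvgM => //; exact: cvg_cst].
by apply: cvgM; apply: cvgM => //; exact: cvg_cst.
Qed.

(** The value and the partial derivatives at [x0] are independent standard normals, and their
    covariances with [phi c] are [K] and [K (c - x0) 0 i]. *)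
Lemma field_gradient_char k :
  \int[P]_w sin (a * phi x0 w + \sum_i b i * G i w + t * phi c w + k) =
  sin k * expR (- ((a ^+ 2 + \sum_i b i ^+ 2 + t ^+ 2 +
    2 * t * K * (a + \sum_i b i * (c - x0) 0 i)) / 2)).
Proof.
have mL n : measurable_fun setT (fun w => sin (L n w + k)).
  apply: (bounded_mfun_sin _).1; apply: measurable_funD => //.
  by apply: measurable_sum => j; exact: measurable_funM.
have bL n w : `|sin (L n w + k)| <= 1 by exact: sin_max.
have cL w : sin (L n w + k) @[n --> \oo] -->
    sin (a * phi x0 w + \sum_i b i * G i w + t * phi c w + k).
  apply: (continuous_cvg_seq (@continuous_sin R)).
  apply: cvgD; last exact: cvg_cst.
  rewrite (funext (fun n => LE n w)); apply: cvgD; last exact: cvg_cst.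
  apply: cvgD; first exact: cvg_cst.
  by apply: cvg_big => [|i _]; [exact: add_continuous|];
    apply: cvgM; [exact: cvg_cst|exact: cvg_increment].
have [_ H1] := bounded_cvg_Rintegral P mL bL cL.
have E n : \int[P]_w sin (L n w + k) = sin k * expR (- (q n / 2)).
  exact: field_combination_char.
have H2 : \int[P]_w sin (L n w + k) @[n --> \oo] --> sin k * expR (- ((a ^+ 2 +
    \sum_i b i ^+ 2 + t ^+ 2 + 2 * t * K * (a + \sum_i b i * (c - x0) 0 i)) / 2)).
  rewrite (funext E); apply: cvgM; first exact: cvg_cst.
  apply: (continuous_cvg_seq (@continuous_expR R)).
  by apply: cvgN; apply: cvgM; [exact: q_cvg|exact: cvg_cst].
by rewrite (cvg_unique _ H1 H2).
Qed.

End quadratic_form_limit.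

Let I : finType := (unit + 'I_N)%type.
Let Z (i : I) : T -> R := if i is inr i' then G i' else phi x0.

Lemma measurable_value_gradient i : measurable_fun setT (Z i).
Proof. by case: i => [[]|i] //; exact: measurable_gradient. Qed.

Let lincombE s w : lincomb Z s w = s (inl tt) * phi x0 w + \sum_i s (inr i) * G i w.
Proof. by rewrite /lincomb sum_unit_sum. Qed.

(* [lincomb Z (mu c)] and [vc c] are the mean and the variance of [phi c] given
   the value and the gradient at [x0]. *)
Let mu (c : 'rV[R]_N) (i : I) : R :=
  fieldcov x0 c * (if i is inr i' then (c - x0) 0 i' else 1).

Let vc (c : 'rV[R]_N) : R := 1 - fieldcov x0 c ^+ 2 * (1 + sqnorm (c - x0)).

Lemma lincomb_value_char s k :
  \int[P]_w sin (lincomb Z s w + k) = sin k * expR (- ((\sum_i s i ^+ 2) / 2)).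
Proof.
have := field_gradient_char (s (inl tt)) 0 (fun i => s (inr i)) x0 k.
rewrite mulr0 !mul0r expr0n/= !addr0 sum_unit_sum => <-.
by apply: eq_Rintegral => w _; rewrite lincombE mul0r addr0.
Qed.

(** Completing the square. The family [Z] is orthonormal, so the covariances [mu c] are the
    regression coefficients of [phi c] on it, and the residual variance is 1 minus the sum of their
    squares, which is [vc c]. *)
Lemma lincomb_field_char s t c k :
  \int[P]_w sin (lincomb Z s w + t * phi c w + k) =
  expR (- (t ^+ 2 * vc c / 2)) * \int[P]_w sin (lincomb Z (fun i => s i + t * mu c i) w + k).
Proof.
rewrite lincomb_value_char mulrCA -expRD.
under eq_Rintegral do rewrite lincombE.
rewrite field_gradient_char; congr (_ * expR _); rewrite -/(fieldcov x0 c).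
rewrite sum_unit_sum /vc /mu mulr1 /sqnorm.
set K := fieldcov x0 c.
have -> : \sum_i (s (inr i) + t * (K * (c - x0) 0 i)) ^+ 2 =
    \sum_i s (inr i) ^+ 2 + 2 * t * K * \sum_i s (inr i) * (c - x0) 0 i +
    t ^+ 2 * K ^+ 2 * \sum_i (c - x0) 0 i ^+ 2.
  by rewrite !mulr_sumr -!big_split/=; apply: eq_bigr => i _; ring.
by field.
Qed.

(** For a deterministic [c] the factor carrying the residual variance is a constant, as
    [sin_given_family] demands. *)
Lemma field_value_given_gradient t c k (A : set T) : <<s generated_by_family Z >> A ->
  \int[P]_w (sin (t * phi c w + k) * \1_A w) =
  \int[P]_w (expR (- (t ^+ 2 * vc c / 2)) * sin (t * lincomb Z (mu c) w + k) * \1_A w).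
Proof.
have mZ := measurable_value_gradient.
apply: sin_given_family => //.
- by apply: measurable_funD => //; exact: measurable_funM.
- by apply: measurable_funD => //; apply: measurable_funM => //; exact: measurable_lincomb.
move=> s k'; under eq_Rintegral do rewrite -addrA -addrA addrA.
rewrite lincomb_field_char; congr (_ * _); apply: eq_Rintegral => w _.
rewrite /lincomb mulr_sumr !addrA -big_split/=; congr (sin (_ + _ + _)).
by apply: eq_bigr => i _; ring.
Qed.

Let gz := <<s generated_by_family Z >>.
Let F t k c w := expR (- (t ^+ 2 * vc c / 2)) * sin (t * lincomb Z (mu c) w + k).

(* The fixed point of [field_value_given_gradient] may be replaced by the random
   point [Y + c]. Quantifying over [c] makes this stable under adding
   [\1_D *: v], hence true for simple functions [Y]. *)
Definition substitutable (Y : T -> 'rV[R]_N) := forall (c : 'rV[R]_N) (t k : R),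
  [/\ measurable_fun setT (fun w => phi (Y w + c) w),
      measurable_fun setT (fun w => F t k (Y w + c) w) &
      forall A, gz A ->
        \int[P]_w (sin (t * phi (Y w + c) w + k) * \1_A w) =
        \int[P]_w (F t k (Y w + c) w * \1_A w)].

Let mZ := measurable_value_gradient.

Let gz_measurable A : gz A -> measurable A.
Proof. by move=> /(generated_by_family_trig_multiplier P P mZ)[]. Qed.

Let vc_ge0 c : 0 <= vc c.
Proof.
rewrite /vc subr_ge0 /fieldcov expr2 -expRD.
have -> : sqnorm (x0 - c) = sqnorm (c - x0).
  by apply: eq_bigr => i _; rewrite !mxE -sqrrN opprB.
set u := sqnorm _.
have -> : - u / 2 + - u / 2 = - u by field.
by rewrite -ler_pdivlMl ?expR_gt0// expRN invrK mulr1 expR_ge1Dx.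
Qed.

Let F_le1 t k c w : `|F t k c w| <= 1.
Proof.
rewrite /F normrM ger0_norm ?expR_ge0// -[leRHS]mulr1 ler_pM ?expR_ge0// ?sin_max//.
by rewrite -[leRHS]expR0 ler_expR oppr_le0 divr_ge0// mulr_ge0// sqr_ge0.
Qed.

Lemma substitutable_cst0 : substitutable (fun=> 0).
Proof.
move=> c t k; split; first by rewrite add0r.
- apply: measurable_funM => //; apply: (bounded_mfun_sin _).1.
  apply: measurable_funD => //; apply: measurable_funM => //.
  by rewrite add0r; exact: measurable_lincomb.
- by move=> A GA; rewrite add0r; exact: field_value_given_gradient.
Qed.

Lemma substitutable_shift Y c : substitutable Y -> substitutable (fun w => Y w + c).
Proof.
move=> SY c' t k; have [h1 h2 h3] := SY (c + c') t k.
split; [by under eq_fun do rewrite -addrA|by under eq_fun do rewrite -addrA|].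
move=> A GA; under eq_Rintegral do rewrite -addrA.
by under [in RHS]eq_Rintegral do rewrite -addrA; exact: h3.
Qed.

(** On [D] the point is [Y + (v + c)] and off [D] it is [Y + c]. Since [D] belongs to the generated
    sigma-algebra, the parts of [A] inside and outside [D] are again admissible events. *)
Lemma substitutable_step Y D (v : 'rV[R]_N) : substitutable Y -> gz D ->
  substitutable (fun w => Y w + \1_D w *: v).
Proof.
move=> SY GD c t k.
have mD := gz_measurable GD.
have glue (H : 'rV[R]_N -> T -> R) w : H (Y w + \1_D w *: v + c) w =
    \1_D w * H (Y w + (v + c)) w + \1_(~` D) w * H (Y w + c) w.
  rewrite !indicE in_setC; case: (w \in D) => /=.
    by rewrite scale1r mul1r mul0r addr0 addrA.
  by rewrite scale0r addr0 mul1r mul0r add0r.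
have mglue (H : 'rV[R]_N -> T -> R) : measurable_fun setT (fun w => H (Y w + (v + c)) w) ->
    measurable_fun setT (fun w => H (Y w + c) w) ->
    measurable_fun setT (fun w => H (Y w + \1_D w *: v + c) w).
  move=> m1 m2; rewrite (funext (glue H)); apply: measurable_funD;
    by apply: measurable_funM => //; apply: measurable_indic => //; exact: measurableC.
have [m1 mF1 E1] := SY (v + c) t k.
have [m2 mF2 E2] := SY c t k.
split; [exact: (mglue (fun c w => phi c w))|exact: (mglue (F t k))|].
move=> A GA; have mA := gz_measurable GA.
have GAD : gz (A `&` D).
  exact: (@measurableI _ (g_sigma_algebraType (generated_by_family Z)) A D).
have GAC : gz (A `&` ~` D).
  apply: (@measurableI _ (g_sigma_algebraType (generated_by_family Z))) => //.
  exact: (@measurableC _ (g_sigma_algebraType (generated_by_family Z))).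
have split_int (H : 'rV[R]_N -> T -> R) :
    bounded_mfun (fun w => H (Y w + (v + c)) w) -> bounded_mfun (fun w => H (Y w + c) w) ->
    \int[P]_w (H (Y w + \1_D w *: v + c) w * \1_A w) =
    \int[P]_w (H (Y w + (v + c)) w * \1_(A `&` D) w) +
    \int[P]_w (H (Y w + c) w * \1_(A `&` ~` D) w).
  move=> b1 b2; rewrite -RintegralD//.
  - apply: eq_Rintegral => w _; rewrite glue !indicI/= /mul_fun; ring.
  - apply: bounded_mfun_integrable; apply: bounded_mfunM => //.
    by apply: bounded_mfun_indic; exact: gz_measurable.
  - apply: bounded_mfun_integrable; apply: bounded_mfunM => //.
    by apply: bounded_mfun_indic; exact: gz_measurable.
have bs (f : T -> R) : measurable_fun setT f -> bounded_mfun (fun w => sin (t * f w + k)).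
  by move=> mf; apply: bounded_mfun_sin; apply: measurable_funD => //; exact: measurable_funM.
rewrite (split_int (fun c w => sin (t * phi c w + k))); [|exact: bs..].
rewrite (split_int (F t k)).
- by rewrite E1// E2.
- by split => //; exists 1.
- by split => //; exists 1.
Qed.

Lemma substitutable_sum (K : Type) (s : seq K) (D : K -> set T) (v : K -> 'rV[R]_N) :
  (forall j, gz (D j)) -> substitutable (fun w => \sum_(j <- s) \1_(D j) w *: v j).
Proof.
move=> GD; elim: s => [|j s IH].
  by under eq_fun do rewrite big_nil; exact: substitutable_cst0.
by under eq_fun do rewrite big_cons addrC; exact: substitutable_step.
Qed.

Lemma substitutable_cvg (Y_ : nat -> T -> 'rV[R]_N) (Y : T -> 'rV[R]_N) :
  (forall n, substitutable (Y_ n)) -> (forall w i, Y_ n w 0 i @[n --> \oo] --> Y w 0 i) ->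
  substitutable Y.
Proof.
move=> SY YE c t k.
have YcE w i : (Y_ n w + c) 0 i @[n --> \oo] --> (Y w + c) 0 i.
  rewrite (_ : (fun n => _) = (fun n => Y_ n w 0 i + c 0 i)); last first.
    by apply/funext => n; rewrite mxE.
  by rewrite mxE; apply: cvgD; [exact: YE|exact: cvg_cst].
have cphi w : phi (Y_ n w + c) w @[n --> \oo] --> phi (Y w + c) w.
  apply: (@cvg_comp _ _ _ (fun n => Y_ n w + c) (fun x => phi x w) _ _ _
    (cvg_row_entrywise (YcE w))).
  (* Continuity of the sample path at the random limit point. *)
  exact: differentiable_continuous (@hdiff w (Y w + c)).
have mphi : measurable_fun setT (fun w => phi (Y w + c) w).
  apply: (measurable_fun_cvg (h := fun n w => phi (Y_ n w + c) w)) => // n.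
  by have [] := SY n c t k.
have csq w (y : 'rV[R]_N) : sqnorm (y - (Y_ n w + c)) @[n --> \oo] --> sqnorm (y - (Y w + c)).
  apply: cvg_big => [|i _]; first exact: add_continuous.
  rewrite (_ : (fun n => _) = (fun n => (y 0 i - (Y_ n w + c) 0 i) ^+ 2)); last first.
    by apply/funext => n; rewrite !mxE.
  rewrite [X in _ --> X](_ : _ = (y 0 i - (Y w + c) 0 i) ^+ 2); last by rewrite !mxE.
  apply: (continuous_cvg_seq (@exprn_continuous R 2)).
  by apply: cvgB; [exact: cvg_cst|exact: YcE].
have ccov w : fieldcov x0 (Y_ n w + c) @[n --> \oo] --> fieldcov x0 (Y w + c).
  apply: (continuous_cvg_seq (@continuous_expR R)).
  by apply: cvgM; [apply: cvgN; exact: csq|exact: cvg_cst].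
have cF w : F t k (Y_ n w + c) w @[n --> \oo] --> F t k (Y w + c) w.
  apply: cvgM.
    apply: (continuous_cvg_seq (@continuous_expR R)); apply: cvgN.
    apply: cvgM; last exact: cvg_cst; apply: cvgM; first exact: cvg_cst.
    apply: cvgB; first exact: cvg_cst; apply: cvgM.
      by apply: (continuous_cvg_seq (@exprn_continuous R 2)); exact: ccov.
    apply: cvgD; first exact: cvg_cst.
    rewrite (_ : sqnorm _ = sqnorm (x0 - (Y w + c))); last first.
      by apply: eq_bigr => i _; rewrite !mxE -sqrrN opprB.
    rewrite (_ : (fun n => _) = (fun n => sqnorm (x0 - (Y_ n w + c)))); last first.
      by apply/funext => n; apply: eq_bigr => i _; rewrite !mxE -sqrrN opprB.
    exact: csq.
  apply: (continuous_cvg_seq (@continuous_sin R)).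
  apply: cvgD; last exact: cvg_cst; apply: cvgM; first exact: cvg_cst.
  apply: cvg_big => [|i _]; first exact: add_continuous.
  apply: cvgM; last exact: cvg_cst.
  apply: cvgM; first exact: ccov.
  case: i => [_|i]; first exact: cvg_cst.
  rewrite (_ : (fun n => _) = (fun n => (Y_ n w + c) 0 i - x0 0 i)); last first.
    by apply/funext => n; rewrite !mxE.
  rewrite [X in _ --> X](_ : _ = (Y w + c) 0 i - x0 0 i); last by rewrite !mxE.
  by apply: cvgB; [exact: YcE|exact: cvg_cst].
have mF : measurable_fun setT (fun w => F t k (Y w + c) w).
  apply: (measurable_fun_cvg (h := fun n w => F t k (Y_ n w + c) w)) => // n.
  by have [] := SY n c t k.
split => // A GA; have mA := gz_measurable GA.
have m1A : measurable_fun setT (\1_A : T -> R) by exact: measurable_indic.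
have i1 w : `|\1_A w : R| <= 1 by rewrite indicE; case: (_ \in _); rewrite ?normr1 ?normr0.
have [_ H1] : bounded_mfun (fun w => sin (t * phi (Y w + c) w + k) * \1_A w) /\
    (\int[P]_w (sin (t * phi (Y_ n w + c) w + k) * \1_A w)) @[n --> \oo] -->
    \int[P]_w (sin (t * phi (Y w + c) w + k) * \1_A w).
  apply: (@bounded_cvg_Rintegral _ _ _ _ _ _ 1).
  - move=> n; apply: measurable_funM => //; apply: (bounded_mfun_sin _).1.
    apply: measurable_funD => //; apply: measurable_funM => //.
    by have [] := SY n c t k.
  - by move=> n w; rewrite normrM mulr_ile1 ?sin_max.
  - move=> w; apply: cvgM; last exact: cvg_cst.
    apply: (continuous_cvg_seq (@continuous_sin R)).
    apply: cvgD; last exact: cvg_cst.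
    by apply: cvgM; [exact: cvg_cst|exact: cphi].
have [_ H2] : bounded_mfun (fun w => F t k (Y w + c) w * \1_A w) /\
    (\int[P]_w (F t k (Y_ n w + c) w * \1_A w)) @[n --> \oo] -->
    \int[P]_w (F t k (Y w + c) w * \1_A w).
  apply: (@bounded_cvg_Rintegral _ _ _ _ _ _ 1).
  - by move=> n; apply: measurable_funM => //; have [] := SY n c t k.
  - by move=> n w; rewrite normrM mulr_ile1.
  - by move=> w; apply: cvgM; [exact: cF|exact: cvg_cst].
have E n : \int[P]_w (sin (t * phi (Y_ n w + c) w + k) * \1_A w) =
    \int[P]_w (F t k (Y_ n w + c) w * \1_A w) by have [_ _ ->] := SY n c t k.
by move: H1; rewrite (funext E) => H1; rewrite (cvg_unique _ H1 H2).
Qed.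

(** Each coordinate of the gradient is rounded by [grid_round]; the indicators in that sum are
    events about one partial derivative, hence in the generated sigma-algebra, so the rounded step
    is a sum to which [substitutable_sum] applies. *)
Lemma substitutable_gradient (eta : R) :
  substitutable (fun w => - eta *: gradient (fun x => phi x w) x0).
Proof.
pose M n := (2 * n.+1 ^ 2)%N.
pose D n (ij : 'I_N * 'I_(M n)) : set T :=
  [set w | - n.+1%:R + ij.2.+1%:R / n.+1%:R <= G ij.1 w].
pose v n (ij : 'I_N * 'I_(M n)) : 'rV[R]_N := (- eta / n.+1%:R) *: delta_mx 0 ij.1.
have GD n ij : gz (D n ij).
  apply: sub_sigma_algebra; exists (inr ij.1), `[- n.+1%:R + ij.2.+1%:R / n.+1%:R, +oo[%classic.
  split; first exact: measurable_itv.
  by apply/seteqP; split => w /=; rewrite in_itv/= andbT.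
(* The constant row is the offset [- (n+1)] of [grid_round] multiplied by [- eta]. *)
apply: (@substitutable_cvg (fun n w => \sum_(ij : 'I_N * 'I_(M n)) \1_(D n ij) w *: v n ij +
   \row_i (eta * n.+1%:R))).
  by move=> n; apply: substitutable_shift; exact: substitutable_sum.
move=> w i; rewrite (_ : (fun n => _) = (fun n => - eta * grid_round n (G i w))); last first.
  apply/funext => n; rewrite mxE summxE mxE /grid_round.
  rewrite -(pair_bigA _ (fun i' j => (\1_(D n (i', j)) w *: v n (i', j)) 0 i))/=.
  rewrite (bigD1 i)//= [X in _ + X + _]big1 ?addr0; last first.
    move=> i' ii'; rewrite big1// => j _; rewrite !mxE eq_sym (negbTE ii').
    by rewrite andbF !mulr0.
  rewrite mulrDr mulrNN addrC; congr (_ + _); rewrite mulr_sumr; apply: eq_bigr => j _.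
  rewrite !mxE !eqxx/= mulr1 indicE mem_setE /= mulrCA.
  by [].
rewrite mxE; apply: cvgM; first exact: cvg_cst.
exact: grid_round_cvg.
Qed.

(** At the point [c = x0 - eta Xi] one has [|c - x0|^2 = eta^2 |Xi|^2] and the inner product of
    [c - x0] with [Xi] is [- eta |Xi|^2]; the conditional mean and variance at [c] become [m1] and
    [v1]. *)
Lemma descent_char (eta t k : R) (A : set T) : gz A ->
  let Xi w := gradient (fun x => phi x w) x0 in
  measurable_fun setT (fun w => phi (x0 - eta *: Xi w) w) /\
  \int[P]_w (sin (t * phi (x0 - eta *: Xi w) w + k) * \1_A w) =
  \int[P]_w (expR (- (t ^+ 2 * v1 eta (sqnorm (Xi w)) / 2)) *
    sin (t * m1 eta (phi x0 w) (sqnorm (Xi w)) + k) * \1_A w).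
Proof.
move=> GA Xi; have [h1 _ h3] := substitutable_gradient eta x0 t k.
have E w : - eta *: Xi w + x0 = x0 - eta *: Xi w by rewrite addrC scaleNr.
split; first by under eq_fun do rewrite -E.
under eq_Rintegral do rewrite -E; rewrite h3//.
apply: eq_Rintegral => w _; congr (_ * _).
set s := sqnorm (Xi w).
set c := - eta *: Xi w + x0.
have cx : c - x0 = - eta *: Xi w by rewrite /c addrK.
have sE : sqnorm (c - x0) = eta ^+ 2 * s.
  rewrite cx /s /sqnorm mulr_sumr; apply: eq_bigr => i _.
  by rewrite mxE exprMn sqrrN.
have cE : fieldcov x0 c = expR (- (eta ^+ 2 / 2 * s)).
  rewrite /fieldcov (_ : sqnorm (x0 - c) = sqnorm (c - x0)).
    by rewrite sE; congr expR; field.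
  by apply: eq_bigr => i _; rewrite !mxE -sqrrN opprB.
have vE : vc c = v1 eta s.
  rewrite /vc /v1 sE cE [expR _ ^+ 2]expr2 -expRD; congr (1 - expR _ * _).
  by field.
have lE : lincomb Z (mu c) w = m1 eta (phi x0 w) s.
  rewrite lincombE /mu cE mulr1 /m1 mulrBr; congr (_ + _).
  move: (expR _) => K; rewrite cx mulrA -mulrN /s /sqnorm -sumrN mulr_sumr.
  apply: eq_bigr => i _; rewrite [X in _ * X * _]mxE -/(Xi w) /G -/(Xi w); ring.
by rewrite /F vE lE.
Qed.

Lemma measurable_sqnorm_gradient_gz :
  measurable_fun (setT : set (g_sigma_algebraType (generated_by_family Z)))
    (fun w => sqnorm (gradient (fun x => phi x w) x0)).
Proof.
apply: measurable_sum => i; apply: measurable_funX.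
exact: (@measurable_generated_by_family _ _ _ _ Z (inr i)).
Qed.

Lemma measurable_sqnorm_gradient :
  measurable_fun setT (fun w => sqnorm (gradient (fun x => phi x w) x0)).
Proof.
by apply: measurable_sum => i; apply: measurable_funX; exact: measurable_gradient.
Qed.

Lemma descent_joint_law (eta : R) (A : set T) (B : set R) : gz A -> measurable B ->
  let Xi w := gradient (fun x => phi x w) x0 in
  P (A `&` (fun w => phi (x0 - eta *: Xi w) w) @^-1` B) =
  (\int[P]_(w in A) normal_law (m1 eta (phi x0 w) (sqnorm (Xi w)))
     (v1 eta (sqnorm (Xi w))) B)%E.
Proof.
move=> GA mB Xi; have mA := gz_measurable GA.
pose s w := sqnorm (Xi w).
have ms : measurable_fun setT s by exact: measurable_sqnorm_gradient.
have [mPhi _] := descent_char eta 0 0 GA.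
apply: normal_mixture => //.
- exact: (measurableT_comp (measurable_m1 eta) (measurable_fun_pair (f := phi x0) _ ms)).
- exact: (measurableT_comp (measurable_v1 eta) ms).
- by move=> w; exact: v1_ge0.
- by move=> t k; exact: (descent_char eta t k GA).2.
Qed.

(** * Laws of the value, the squared gradient norm and the field after one step *)

Let char_G_value (s : 'I_N -> R) t k :
  \int[P]_w sin (lincomb G s w + t * phi x0 w + k) =
  sin k * expR (- ((\sum_i s i ^+ 2 + t ^+ 2) / 2)).
Proof.
have := lincomb_value_char (fun i => if i is inr j then s j else t) k.
rewrite sum_unit_sum [t ^+ 2 + _]addrC => <-.
by apply: eq_Rintegral => w _; rewrite lincombE /= [t * _ + _]addrC.
Qed.

Let char_G (s : 'I_N -> R) k :
  \int[P]_w sin (lincomb G s w + k) = sin k * expR (- ((\sum_i s i ^+ 2) / 2)).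
Proof.
have := char_G_value s 0 k; rewrite expr0n/= addr0 => <-.
by apply: eq_Rintegral => w _; rewrite mul0r addr0.
Qed.

Let mG i : measurable_fun setT (G i).
Proof. exact: measurable_gradient. Qed.

Let value_independent_gradient (A : set T) (B : set R) :
  <<s generated_by_family G >> A -> measurable B ->
  P (A `&` phi x0 @^-1` B) = (P A * normal_prob 0 1 B)%E.
Proof.
move=> GA mB; apply: (normal_independent_family (Z := G)) => // s t k.
rewrite char_G_value char_G mulrCA -expRD; congr (_ * expR _).
by field.
Qed.

Lemma value_law (B : set R) : measurable B -> P (phi x0 @^-1` B) = normal_prob 0 1 B.
Proof.
move=> mB; rewrite -[X in P X]setTI value_independent_gradient//.
  by rewrite probability_setT mul1e.
exact: (@measurableT _ (g_sigma_algebraType (generated_by_family G))).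
Qed.

Lemma value_independent_sqnorm_gradient (A B : set R) : measurable A -> measurable B ->
  P ((fun w => sqnorm (gradient (fun x => phi x w) x0)) @^-1` A `&` phi x0 @^-1` B) =
  (P ((fun w => sqnorm (gradient (fun x => phi x w) x0)) @^-1` A) * normal_prob 0 1 B)%E.
Proof.
move=> mA mB; apply: value_independent_gradient => //.
apply: preimage_generated_by_family mA.
apply: measurable_sum => i; apply: measurable_funX.
exact: (@measurable_generated_by_family _ _ _ _ G i).
Qed.

Lemma sqnorm_gradient_pdf : (0 < N)%N ->
  has_pdf P (fun w => sqnorm (gradient (fun x => phi x w) x0)) (chi2_pdf N).
Proof.
move=> N0; apply: radial_law => //.
- exact: measurable_sqnorm_gradient.
- by move=> w; apply: sumr_ge0 => i _; exact: sqr_ge0.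
- exact: (radial_sum_sqr mG char_G).
Qed.

(** The kernel is a function of the value and the squared norm alone, and events about this pair
    belong to the sigma-algebra of value and gradient, over which the joint law is known. *)
Lemma descent_conditional_law (eta : R) :
  let Xi w := gradient (fun x => phi x w) x0 in
  conditional_law P (fun w => (phi x0 w, sqnorm (Xi w)))
    (fun w => phi (x0 - eta *: Xi w) w)
    (fun z => normal_law (m1 eta z.1 z.2) (v1 eta z.2)).
Proof.
move=> Xi.
have [mPhi1 _] := descent_char eta 0 0
  (@measurableT _ (g_sigma_algebraType (generated_by_family Z))).
have mS := measurable_sqnorm_gradient.
split => //.
- exact: measurable_fun_pair.
- by move=> z; apply: normal_law_probability; exact: v1_ge0.
- move=> B mB; apply: measurable_normal_law => //.
  + exact: measurable_m1.
  + exact: (measurableT_comp (measurable_v1 eta) measurable_snd).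
  + by move=> z; exact: v1_ge0.
- move=> A B mA mB; apply: descent_joint_law => //.
  apply: preimage_generated_by_family mA; apply: measurable_fun_pair.
    exact: (@measurable_generated_by_family _ _ _ _ Z (inl tt)).
  exact: measurable_sqnorm_gradient_gz.
Qed.

(** The conditional law on the whole space gives the law of the new value as an expectation over the
    pair; independence of value and squared norm, with their known laws, turns it into the iterated
    integral. *)
Lemma descent_pdf (eta : R) : (0 < N)%N -> 0 < eta ->
  exists f : R -> R,
    has_pdf P (fun w => phi (x0 - eta *: gradient (fun x => phi x w) x0) w) f /\
    forall y, (f y)%:E = (\int[@lebesgue_measure R]_p
      \int[@lebesgue_measure R]_(s in `[0%R, +oo[)
        ((normal_pdf 0 1 p * chi2_pdf N s) / Num.sqrt (2 * pi * v1 eta s)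
          * expR (- ((y - m1 eta p s) ^+ 2 / (2 * v1 eta s))))%:E)%E.
Proof.
move=> N0 eta0; have Spdf := sqnorm_gradient_pdf N0.
have [mchi chi_ge0 [mS Slaw]] := Spdf.
have [_ mPhi1 _ mk lawPhi1] := descent_conditional_law eta.
pose S w := sqnorm (gradient (fun x => phi x w) x0).
apply: descent_density_has_pdf => //.
- by move=> s; rewrite /chi2_pdf ltNge => ->.
- by rewrite -[LHS](Slaw setT)// preimage_setT probability_setT.
move=> B mB; have := lawPhi1 setT B measurableT mB; rewrite preimage_setT setTI => ->.
pose N01 : probability (measurableTypeR R) R := normal_prob 0 1.
pose h (z : R * measurableTypeR R) := normal_law (m1 eta z.2 z.1) (v1 eta z.1) B.
have mh : measurable_fun setT h.
  apply: measurable_normal_law => //; last by move=> z; exact: v1_ge0.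
    exact: (measurableT_comp (measurable_m1 eta)
      (measurable_fun_pair measurable_snd measurable_fst)).
  exact: (measurableT_comp (measurable_v1 eta) measurable_fst).
have h0 z : (0 <= h z)%E.
  by rewrite /h; have [q ->] := normal_law_probability (m1 eta z.2 z.1) (v1_ge0 eta z.1).
transitivity (\int[P]_w h (S w, phi x0 w))%E => //.
have mPhi : measurable_fun setT (phi x0) by [].
rewrite (@ge0_independent_integral _ _ _ _ _ _ _ P N01 S (phi x0) mS mPhi
  value_independent_sqnorm_gradient)//.
have mH : measurable_fun setT (fun s => \int[N01]_y h (s, y))%E.
  exact: (@measurable_fun_fubini_tonelli_F _ _ _ _ _ N01 h).
rewrite (has_pdf_ge0_integral (g := fun s => \int[N01]_y h (s, y))%E Spdf)//.
  by apply: eq_integral => s _; rewrite muleC.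
by move=> s; exact: integral_ge0.
Qed.

Lemma value_pdf : has_pdf P (phi x0) (normal_pdf 0 1).
Proof.
split; [exact: measurable_normal_pdf|by move=> y; exact: normal_pdf_ge0|].
by split => // B mB; exact: value_law.
Qed.

End gaussian_field_transforms.

Unset Implicit Arguments.

Theorem mainTheorem1 (R : realType) (d : measure_display)
    (T : measurableType d) (P : probability T R)
    (N : nat) (hN : (1 <= N)%N) (eta : R) (heta : 0 < eta)
    (x0 : 'rV[R]_N) (phi : 'rV[R]_N -> {RV P >-> R})
    (hgauss : gaussian_field P phi)
    (hsmooth : forall w : T, continuously_differentiable (fun x => phi x w))
    (hcentered : forall x, ('E_P[phi x] = 0)%E)
    (hcov : forall x x',
      ('E_P[(fun w => phi x w * phi x' w)%R]
         = (expR (- sqnorm (x - x') / 2))%:E)%E) :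
  let Phi0 := fun w : T => phi x0 w in
  let Xi0 := fun w : T => gradient (fun x => phi x w) x0 in
  let Xi0sq := fun w : T => sqnorm (Xi0 w) in
  let x1 := fun w : T => x0 - eta *: Xi0 w in
  let Phi1 := fun w : T => phi (x1 w) w in
  [/\ conditional_law P (fun w => (Phi0 w, Xi0sq w)) Phi1
        (fun z => normal_law (m1 eta z.1 z.2) (v1 eta z.2)),
      has_pdf P Phi0 (normal_pdf 0 1),
      has_pdf P Xi0sq (chi2_pdf N) &
      exists fPhi1 : R -> R, has_pdf P Phi1 fPhi1 /\
        forall y : R,
          (fPhi1 y)%:E =
          (\int[@lebesgue_measure R]_p
             \int[@lebesgue_measure R]_(s in `[0%R, +oo[)
               ((normal_pdf 0 1 p * chi2_pdf N s)
                  / Num.sqrt (2 * pi * v1 eta s)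
                * expR (- ((y - m1 eta p s) ^+ 2 / (2 * v1 eta s))))%:E)%E].
Proof.
move=> Phi0 Xi0 Xi0sq x1 Phi1.
have hdiff w x : differentiable (fun x => phi x w) x by have [] := hsmooth w.
split.
- exact: descent_conditional_law.
- exact: value_pdf.
- exact: sqnorm_gradient_pdf.
- exact: descent_pdf.
Qed.
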